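(* Let $K$ be an algebraically closed field of characteristic $p\ge 0$. Let $X\subset\mathbb{P}^{n+1}$ ($n\ge 2$) be an irreducible hypersurface of degree $d\ge 4$ with $0\le s(X)\le n-2$ (resp. $s(X)=-1$), and let $P\in\mathbb{P}^{n+1}$ be a Galois point for $X$. Then the following hold. (i) A general hyperplane $H$ passing through $P$ satisfies the following condition: $(\star)$ the hyperplane section $X_H:=X\cap H$ is an irreducible hypersurface in $H\cong\mathbb{P}^n$ of degree $d$ with $s(X_H)=s(X)-1$ (resp. $s(X_H)=-1$), and a general tangent space of $X_H$ does not contain $P$. (ii) Let $H$ be a hyperplane passing through $P$ and satisfying the condition $(\star)$. Then the point $P$ is Galois with respect to $X_H$. (iii) The Galois groups are isomorphic: $G_P(X)\cong G_P(X_H)$ for any hyperplane $H$ passing through $P$ and satisfying $(\star)$.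
   Context: A hypersurface in a projective space is irreducible and reduced. $s(X):=\dim\mathrm{Sing}(X)$, with $\dim\emptyset=-1$. For a hypersurface $X\subset\mathbb{P}^{n+1}$, a point $P\in X_{\rm sm}\cup(\mathbb{P}^{n+1}\setminus X)$ ($X_{\rm sm}$ the smooth locus) is a Galois point for $X$ if the function field extension $K(X)/K(\mathbb{P}^n)$ induced by the projection $\pi_P:X\dashrightarrow\mathbb{P}^n$ from $P$ is Galois; $G_P(X)$ denotes its Galois group. The same definitions apply to $X_H\subset H\cong\mathbb{P}^n$ and $P\in H$. ''A general hyperplane through $P$'' means every hyperplane in some nonempty Zariski open subset of the space of hyperplanes through $P$; ''a general tangent space of $X_H$ does not contain $P$'' means that $P\notin\mathbb{T}_x X_H$ for general $x\in X_H$, where $\mathbb{T}_xX_H\subset H$ is the projective tangent space. *)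

(* Defs.v *)
From HB Require Import structures.
From mathcomp Require Import all_boot all_order all_fingroup all_algebra.
From mathcomp Require Import all_solvable all_field.
From mathcomp Require Import mpoly.

Set Implicit Arguments.
Unset Strict Implicit.
Unset Printing Implicit Defensive.

Import Order.TTheory GRing.Theory Num.Theory.

Local Open Scope ring_scope.

(* The point [v] of P^{r-1}(K) is represented by any of its nonzero vectors of
   homogeneous coordinates, in row form.  A subset of P^{r-1} is a predicate on
   coordinate vectors; all the subsets below consist of nonzero vectors and are
   stable under scaling by K^*. *)
Definition pset (K : fieldType) (r : nat) := 'rV[K]_r -> Prop.

Section ZariskiTopology.
Variables (K : fieldType) (r : nat).
Implicit Types (Y Z : pset K r) (x : 'rV[K]_r).

Definition psubset Y Z : Prop := forall x, Y x -> Z x.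

Definition zariski_closed Z : Prop :=
  exists S : {mpoly K[r]} -> Prop,
    (forall g, S g -> exists d : nat, g \is d.-homog) /\
    (forall x, Z x <-> x != 0 /\ forall g, S g -> g.@[x 0] = 0).

Definition irreducible_closed Z : Prop :=
  [/\ zariski_closed Z, exists x, Z x
    & forall Z1 Z2, zariski_closed Z1 -> zariski_closed Z2 ->
        (forall x, Z x -> Z1 x \/ Z2 x) -> psubset Z Z1 \/ psubset Z Z2].

(* Strictly increasing chain C 0 < C 1 < ... < C m. *)
Definition irreducible_chain Y (m : nat) : Prop :=
  exists C : nat -> pset K r,
    (forall i, (i <= m)%N -> irreducible_closed (C i) /\ psubset (C i) Y) /\
    (forall i, (i < m)%N ->
       psubset (C i) (C i.+1) /\ ~ psubset (C i.+1) (C i)).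

(* dim Y = s (Krull dimension) for Y closed, with the convention
   dim(empty) = -1. *)
Definition has_dim Y (s : int) : Prop :=
  (s = -1 /\ forall x, ~ Y x) \/
  (exists m : nat, [/\ s = m%:Z, irreducible_chain Y m
     & forall m', irreducible_chain Y m' -> (m' <= m)%N]).

(* "A general x in Y satisfies Q": Q holds on some nonempty open subset of Y. *)
Definition generally Y (Q : 'rV[K]_r -> Prop) : Prop :=
  exists Z, [/\ zariski_closed Z, exists x, Y x /\ ~ Z x
    & forall x, Y x -> ~ Z x -> Q x].

End ZariskiTopology.

Section Hypersurface.
Variables (K : fieldType) (r : nat).
Implicit Types (F : {mpoly K[r]}) (x y P : 'rV[K]_r).

Definition irreducible_mpoly F : Prop :=
  [/\ F != 0, F \isn't a GRing.unit
    & forall f g, F = f * g -> f \is a GRing.unit \/ g \is a GRing.unit].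

(* An irreducible reduced hypersurface of degree d is given by its equation,
   which is unique up to K^*. *)
Definition hypersurface (d : nat) F : Prop :=
  F \is d.-homog /\ irreducible_mpoly F.

Definition zeros F : pset K r := fun x => x != 0 /\ F.@[x 0] = 0.

(* F = 0 is kept among the equations: when the characteristic divides deg F it
   does not follow from the vanishing of the partial derivatives. *)
Definition Sing F : pset K r :=
  fun x => zeros F x /\ forall i : 'I_r, (F^`M(i)).@[x 0] = 0.

Definition smooth_locus F : pset K r := fun x => zeros F x /\ ~ Sing F x.

(* y lies in the projective tangent space T_x; at a singular point x this is
   the whole ambient space. *)
Definition in_tangent_space F x y : Prop :=
  \sum_(i < r) (F^`M(i)).@[x 0] * y 0 i = 0.

End Hypersurface.

Section FunctionField.
Variables (K : fieldType).

(* With I the homogeneous prime ideal of a projective variety Y in P^{r-1}, this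
   says that E, with structure map iota, is the function field K(Y): g/h |->
   g(xi)/h(xi), for forms g, h of the same degree with h not in I, identifies
   the degree-0 homogeneous fractions of K[x]/I with E.  The vector xi gives
   homogeneous coordinates, over E, of the generic point of Y. *)
Definition function_field_at (r : nat) (I : {mpoly K[r]} -> Prop)
    (E : fieldType) (iota : K -> E) (xi : 'rV[E]_r) : Prop :=
  (forall (m : nat) (g : {mpoly K[r]}), g \is m.-homog ->
     (mmap iota (xi 0) g = 0 <-> I g)) /\
  (forall z : E, exists (m : nat) (g h : {mpoly K[r]}),
     [/\ g \is m.-homog, h \is m.-homog, mmap iota (xi 0) h != 0
       & z = mmap iota (xi 0) g / mmap iota (xi 0) h]).

(* L/k is the extension K(X)/K(P^{N-1}) induced by the projection pi_P from P,
   where X is the hypersurface F = 0 in P^N.  The projection is v |-> v *m lam,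
   for lam a linear map with kernel the line P; the last condition says that
   k -> L sends the generic point of P^{N-1} to the image by pi_P of the
   generic point of X. *)
Definition projection_extension (N : nat) (F : {mpoly K[N.+1]})
    (P : 'rV[K]_N.+1) (k : fieldType) (L : fieldExtType k) : Prop :=
  exists (iota : {rmorphism K -> k}) (lam : 'M[K]_(N.+1, N))
         (eta : 'rV[k]_N) (xi : 'rV[L]_N.+1) (c : L),
  let iotaL : K -> L := fun a => in_alg L (iota a) in
  [/\ (kermx lam == P)%MS,
      function_field_at (fun g => g = 0) iota eta,
      function_field_at (fun g => exists q, g = q * F) iotaL xi,
      c != 0
    & map_mx (in_alg L) eta = c *: (xi *m map_mx iotaL lam)].

Definition galois_point (N : nat) (F : {mpoly K[N.+1]}) (P : 'rV[K]_N.+1) :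
    Prop :=
  [/\ P != 0, smooth_locus F P \/ ~ zeros F P
    & exists (k : fieldType) (L : splittingFieldType k),
        projection_extension F P L /\ galois 1%AS {:L}%AS].

End FunctionField.

Section HyperplaneSection.
Variables (K : fieldType) (N : nat).

(* A hyperplane of P^N is a point h of the dual space. *)
Definition on_hyperplane (h v : 'rV[K]_N.+1) : Prop := v *m h^T = 0.

Definition hyperplanes_through (P : 'rV[K]_N.+1) : pset K N.+1 :=
  fun h => h != 0 /\ on_hyperplane h P.

(* The rows of A form a basis of the linear space of H, so u |-> u *m A is an
   identification of P^{N-1} with H; Q is the point of P^{N-1} corresponding
   to P. *)
Definition hyperplane_chart (h P : 'rV[K]_N.+1) (A : 'M[K]_(N, N.+1))
    (Q : 'rV[K]_N) : Prop :=
  [/\ row_free A, (A == kermx h^T)%MS & Q *m A = P].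

(* Equation of the hyperplane section X_H in the chart A. *)
Definition section_eq (F : {mpoly K[N.+1]}) (A : 'M[K]_(N, N.+1)) :
    {mpoly K[N]} :=
  F \mPo [tuple \sum_(i < N) A i j *: 'X_i | j < N.+1].

End HyperplaneSection.

(* The condition "star" on a hyperplane section G = 0, at the point Q. *)
Definition star (K : fieldType) (r d : nat) (t : int) (G : {mpoly K[r]})
    (Q : 'rV[K]_r) : Prop :=
  [/\ hypersurface d G, has_dim (Sing G) t
    & generally (zeros G) (fun x => ~ in_tangent_space G x Q)].

(* Main.v *)
(* The least number of forms of positive degree without common zero on a closed
   set is its dimension plus one, and it drops by one in a general hyperplane
   section: this follows from the algebraic dependence of forms modulo an ideal,
   by counting monomials, and from the Nullstellensatz.

   (i) Let D_P F be the derivative of the equation F of X in the direction P; it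
   is nonzero because K(X) is separable over the field of the projection.  The
   hyperplanes through P that are tangent to X at a smooth point are images under
   the Gauss map of points of F = D_P F = 0, a set of dimension n - 1, while the
   hyperplanes through P form a space of dimension n.  So for a general H the
   singular locus of X_H is the section by H of that of X; as its codimension is
   large, X_H is irreducible, since two components would meet in codimension two.

   (ii), (iii) In a chart with P = (1 : 0 : ... : 0), K(X) = Frac(S)[T]/(f) for a
   polynomial ring S, and X_H is given by the reduction f' of f modulo a variable
   of S.  The local ring of S[T]/(f) at this variable has residue field K(X_H).
   If the leading coefficient of f survives in f', the conjugates of the root T
   lie in this local ring and their residues are the roots of f'; this makes
   K(X_H) Galois and identifies the groups.  Otherwise H is the tangent space of X
   at P, exactly one conjugate of T has a pole, and evaluating traces shows that
   the residue field is of degree one over the base, so that d - 1 = 2. *)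

Require Import Defs.
From HB Require Import structures.
From mathcomp Require Import all_boot all_order all_fingroup all_algebra.
From mathcomp Require Import all_solvable all_field.
From mathcomp Require Import mpoly zify ring.
From Stdlib Require Import Classical ClassicalEpsilon.

Set Implicit Arguments.
Unset Strict Implicit.
Unset Printing Implicit Defensive.

Import Order.TTheory GRing.Theory Num.Theory.

Local Open Scope ring_scope.

(** * Polynomial rings *)

(** A Galois point is known only through unspecified fields [k] and [L], and (iii) ranges over
    further pairs of fields that are not given as Galois. So each projection extension is first
    turned into a [model], a presentation by the polynomial f of a chart centred at P; two models of
    the same f are compared by the specialization theorem itself, for the identity reduction.
    Conversely (ii) asks for a function field of the section, which is built by adjoining a root of
    f' to a fraction field. The local ring with residue field K(X_H) is not constructed: the
    relation [place] records which element has which residue. It is single-valued, and it behaves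
    like a discrete valuation ring with the reduced variable as uniformizer. Since P is not a
    singular point, f has degree at least d - 1 in T, so its leading coefficient has degree at most
    one. This is why, in the tangent case, the poles of the conjugates have total order exactly one.
    The bound d >= 4 serves to exclude the degree two that results. *)

Lemma mpoly_ring_ind (R : nzRingType) n (P : {mpoly R[n]} -> Prop) :
  (forall c, P c%:MP) -> (forall i, P 'X_i) ->
  (forall p q, P p -> P q -> P (p + q)) ->
  (forall p q, P p -> P q -> P (p * q)) -> forall p, P p.
Proof.
move=> PC PX PD PM p; rewrite [p]mpolyE.
apply: (big_ind P); [by rewrite -mpolyC0; apply: PC | exact: PD |].
move=> m _; rewrite -mul_mpolyC; apply: (PM) => //.
rewrite mpolyXE_id; apply: (big_ind P); [by rewrite -mpolyC1 | exact: PM |].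
move=> i _; elim: (m i) => [|k IH]; first by rewrite expr0 -mpolyC1.
by rewrite exprS; apply: PM.
Qed.

Lemma eq_mpoly_rmorph (R : nzRingType) n (S : nzRingType)
    (f g : {rmorphism {mpoly R[n]} -> S}) :
  (forall c, f c%:MP = g c%:MP) -> (forall i, f 'X_i = g 'X_i) -> f =1 g.
Proof.
move=> eqC eqX; apply: mpoly_ring_ind => // p q Hp Hq.
  by rewrite !rmorphD /= Hp Hq.
by rewrite !rmorphM /= Hp Hq.
Qed.

Section Muni.
Variables (R : comNzRingType) (n : nat).

Lemma muni_widen (i : 'I_n) :
  muni ('X_(widen_ord (leqnSn n) i) : {mpoly R[n.+1]}) = ('X_i)%:P.
Proof.
rewrite muniE msuppX big_seq1 mcoeffX eqxx scale1r.
have -> : (U_(widen_ord (leqnSn n) i)%MM ord_max = 0)%N.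
  by rewrite mnm1E -val_eqE /= ltn_eqF.
rewrite expr0 alg_polyC; congr (_%:P); congr ('X_[_]).
by apply/mnmP => j; rewrite mnmE !mnm1E -!val_eqE.
Qed.

Lemma muni_max : muni ('X_ord_max : {mpoly R[n.+1]}) = 'X.
Proof.
rewrite muniE msuppX big_seq1 mcoeffX eqxx scale1r mnm1E eqxx expr1.
have -> : [multinom (U_(ord_max) (widen_ord (leqnSn n) i) : nat)%MM | i < n]
          = 0%MM.
  apply/mnmP => j; rewrite mnmE mnm1E mnm0E -val_eqE /=.
  by rewrite gtn_eqF.
by rewrite mpolyX0 scale1r.
Qed.

Lemma ordS_ind (P : 'I_n.+1 -> Prop) :
  (forall i, P (widen_ord (leqnSn n) i)) -> P ord_max -> forall i, P i.
Proof.
move=> Pw Pm i; have [lt_in|le_ni] := ltnP i n.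
  by have := Pw (Ordinal lt_in); congr P; apply: val_inj.
by have -> : i = ord_max by apply: val_inj; apply/eqP; rewrite eqn_leq -ltnS ltn_ord.
Qed.

Definition of_uni (p : {poly {mpoly R[n]}}) : {mpoly R[n.+1]} :=
  (map_poly (@mwiden n R) p).['X_ord_max].

Lemma of_uni_is_zmod_morphism : zmod_morphism of_uni.
Proof. by move=> p q; rewrite /of_uni rmorphB hornerD hornerN. Qed.

Lemma of_uni_is_monoid_morphism : monoid_morphism of_uni.
Proof. by split=> [|p q]; rewrite /of_uni ?rmorph1 ?hornerC // rmorphM hornerM. Qed.

HB.instance Definition _ := GRing.isZmodMorphism.Build _ _ of_uni of_uni_is_zmod_morphism.
HB.instance Definition _ := GRing.isMonoidMorphism.Build _ _ of_uni of_uni_is_monoid_morphism.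

Lemma muniK : cancel (@muni n R) of_uni.
Proof.
apply: (@eq_mpoly_rmorph R n.+1 {mpoly R[n.+1]} (of_uni \o @muni n R) idfun) => /=.
  by move=> c; rewrite muniC /of_uni map_polyC hornerC /= mwidenC.
apply: ordS_ind => [i|]; last by rewrite muni_max /of_uni map_polyX hornerX.
rewrite muni_widen /of_uni map_polyC hornerC /= mwidenX mnmwiden1.
by [].
Qed.

Lemma of_uniC p : of_uni p%:P = mwiden p.
Proof. by rewrite /of_uni map_polyC hornerC. Qed.

Lemma of_uniX : of_uni 'X = 'X_ord_max.
Proof. by rewrite /of_uni map_polyX hornerX. Qed.

Lemma muni_mwiden (p : {mpoly R[n]}) : muni (mwiden p) = p%:P.
Proof.
apply: (@eq_mpoly_rmorph R n {poly {mpoly R[n]}}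
  (@muni n R \o @mwiden n R) polyC) => /= [c|i].
  by rewrite mwidenC muniC.
by rewrite mwidenX mnmwiden1 muni_widen.
Qed.

Lemma of_uniK : cancel of_uni (@muni n R).
Proof.
elim/poly_ind => [|p c IH]; first by rewrite !rmorph0.
by rewrite rmorphD rmorphM /= of_uniC of_uniX rmorphD rmorphM /= IH muni_max muni_mwiden.
Qed.

Lemma muni_inj : injective (@muni n R).
Proof. exact: can_inj muniK. Qed.

Lemma muni_eq0 p : (@muni n R p == 0) = (p == 0).
Proof. by rewrite -(muni0 n R) (inj_eq muni_inj). Qed.

Lemma meval_muni (v : 'I_n.+1 -> R) p :
  p.@[v] = (map_poly (meval (fun i => v (widen_ord (leqnSn n) i))) (muni p)).[v ord_max].
Proof.
pose w i := v (widen_ord (leqnSn n) i).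
apply: (@eq_mpoly_rmorph R n.+1 R (meval v)
  (horner_eval (v ord_max) \o (map_poly (meval w) \o @muni n R))) => /= [c|].
  by rewrite mevalC muniC map_polyC /horner_eval hornerC /= mevalC.
apply: ordS_ind => [i|]; rewrite /horner_eval /= mevalXU.
  by rewrite muni_widen map_polyC hornerC /= mevalXU.
by rewrite muni_max map_polyX hornerX.
Qed.
End Muni.

Section Infinite.
Variable K : closedFieldType.

(** A root of [q * 'X + 1] cannot be a zero of [q], hence lies outside [s]; the factor ['X] keeps
    the degree positive when [s] is empty. *)
Lemma exists_notin (s : seq K) : exists x, x \notin s.
Proof.
pose q : {poly K} := \prod_(a <- s) ('X - a%:P).
have sq : (0 < size q)%N by rewrite size_prod_XsubC.
have sqX : size (q * 'X) = (size q).+1.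
  by rewrite size_mulX // -size_poly_gt0.
have [|x /rootP] := @closed_rootP K (q * 'X + 1) _.
  by rewrite size_polyDl ?size_poly1 sqX ?ltnS // eqSS -lt0n.
rewrite hornerD hornerM hornerC => Hx; exists x; apply/negP => xs.
have /rootP qx : root q x by rewrite root_prod_XsubC.
by move: Hx; rewrite qx mul0r add0r => /eqP; rewrite oner_eq0.
Qed.

Lemma poly_nonroot (p : {poly K}) : p != 0 -> exists x, p.[x] != 0.
Proof.
move=> p0; have [rs Hrs] := closed_field_poly_normal p.
have [x Hx] := exists_notin rs; exists x.
rewrite Hrs hornerZ mulf_neq0 ?lead_coef_eq0 //.
by rewrite -[_ == 0]/(root _ x) root_prod_XsubC.
Qed.

Lemma mpoly_nonzero n (p : {mpoly K[n]}) : p != 0 -> exists v, p.@[v] != 0.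
Proof.
elim: n p => [|n IH] p p0.
  exists (fun=> 0); have := p0; apply: contraNneq.
  rewrite -(mpolyKC p); rewrite mevalC => ->; by rewrite mpolyC0.
have: muni p != 0 by rewrite muni_eq0.
rewrite -lead_coef_eq0 => /IH [w Hw].
have: map_poly (meval w) (muni p) != 0.
  apply: contraNneq Hw => /polyP/(_ (size (muni p)).-1).
  by rewrite coef_map coef0 /= => ->.
move=> /poly_nonroot [x Hx].
pose v (i : 'I_n.+1) := if insub (val i) is Some j then w j else x.
exists v; rewrite meval_muni.
have -> : v ord_max = x by rewrite /v insubF //= ltnn.
rewrite (@eq_map_poly _ _ _ (meval w)) // => q; apply: meval_eq => i.
by rewrite /v /= insubT //= => H; congr w; apply: val_inj.
Qed.

Lemma mpoly_eval_inj n (p q : {mpoly K[n]}) :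
  (forall v : 'rV_n, p.@[v 0] = q.@[v 0]) -> p = q.
Proof.
move=> E; apply/eqP; rewrite -subr_eq0; apply/negP => /negP/mpoly_nonzero [v].
rewrite mevalB -(@meval_eq _ _ (fun i => (\row_j v j) 0 i)) => [|i]; last by rewrite mxE.
by rewrite -(@meval_eq _ _ (fun i => (\row_j v j) 0 i) v q) ?E ?subrr ?eqxx // => i; rewrite mxE.
Qed.

Lemma mpoly_nonzero_row n (p : {mpoly K[n]}) : p != 0 -> exists v : 'rV_n, p.@[v 0] != 0.
Proof.
move=> p0; apply: NNPP => H; case/eqP: p0; apply: mpoly_eval_inj => v.
by rewrite meval0; apply/eqP; apply: contra_notT H => Hv; exists v.
Qed.
End Infinite.

Section Homogeneous.
Variables (R : comNzRingType) (r : nat).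

Lemma mmap_scale (E : comNzRingType) (f : R -> E) (c : E) (x : 'rV[E]_r)
    d (p : {mpoly R[r]}) :
  p \is d.-homog -> mmap f ((c *: x) 0) p = c ^+ d * mmap f (x 0) p.
Proof.
move=> hp; rewrite /mmap mulr_sumr; apply: eq_big_seq => m hm.
rewrite mulrCA; congr (_ * _).
have /= <- := dhomog_mf hp hm; rewrite /mmap1 mdegE -prodrXr -big_split /=.
by apply: eq_bigr => i _; rewrite mxE exprMn.
Qed.

Lemma meval_scale c (x : 'rV[R]_r) d (p : {mpoly R[r]}) :
  p \is d.-homog -> p.@[(c *: x) 0] = c ^+ d * p.@[x 0].
Proof. exact: mmap_scale. Qed.

Lemma meval_homog0 d (p : {mpoly R[r]}) :
  (0 < d)%N -> p \is d.-homog -> p.@[(0 : 'rV_r) 0] = 0.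
Proof.
move=> d0 hp; have := meval_scale 0 0 hp.
by rewrite scale0r expr0n gtn_eqF // mul0r.
Qed.
End Homogeneous.

Notation homog_part d p := (pihomog mdeg d p).

Lemma homog_part_sum (R : nzRingType) r (p : {mpoly R[r]}) :
  p = \sum_(d < msize p) homog_part d p.
Proof. exact: (@pihomog_partitionE _ _ mdeg). Qed.

Lemma homog_part_neq0 (R : nzRingType) r (p : {mpoly R[r]}) :
  p != 0 -> exists d, homog_part d p != 0.
Proof.
move=> p0; apply: NNPP => H; case/eqP: p0.
rewrite [p]homog_part_sum big1 // => i _; apply/eqP; apply: contra_notT H => Hi.
by exists i.
Qed.

Section HomogeneousEval.
Variables (K : closedFieldType) (r : nat).

Lemma meval_homog_part (p : {mpoly K[r]}) (x : 'rV[K]_r) :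
  (forall c, c != 0 -> p.@[(c *: x) 0] = 0) ->
  forall d, (homog_part d p).@[x 0] = 0.
Proof.
move=> H d; have [lt_d|le_d] := ltnP d (msize p); last first.
  rewrite pihomogE big_seq_cond big1 ?meval0 // => m /andP[/msize_mdeg_lt lt_m].
  by move=> /eqP E; rewrite E ltnNge le_d in lt_m.
pose q : {poly K} := \poly_(i < msize p) (homog_part i p).@[x 0].
have Hq c : c != 0 -> q.[c] = 0.
  move=> c0; rewrite -(H c c0) {1}[p]homog_part_sum raddf_sum /= /q horner_poly.
  apply: eq_bigr => i _; rewrite (meval_scale _ _ (pihomogP _ _ _)).
  by rewrite mulrC.
(* The values of [q] are known only at nonzero arguments; the factor ['X] takes care of zero. *)
have : q * 'X = 0.
  apply/eqP; apply: contraT => /poly_nonroot [c].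
  rewrite hornerM hornerX; have [->|c0] := eqVneq c 0; first by rewrite mulr0 eqxx.
  by rewrite Hq // mul0r eqxx.
move/eqP; rewrite mulf_eq0 polyX_eq0 orbF => /eqP/polyP/(_ d).
by rewrite coef_poly lt_d coef0.
Qed.

End HomogeneousEval.

Lemma XnM_mono (R : idomainType) (A B : {poly R}) (c : R) d :
  c != 0 -> A * B = c *: 'X^d -> exists i a, A = a *: 'X^i.
Proof.
move=> c0 E.
have cX0 : c *: 'X^d != 0 by rewrite -mul_polyC mulf_neq0 ?polyC_eq0 // expf_neq0 ?polyX_eq0.
have A0 : A != 0 by apply: contraNneq cX0 => A0; rewrite -E A0 mul0r.
have B0 : B != 0 by apply: contraNneq cX0 => B0; rewrite -E B0 mulr0.
have split0 (p : {poly R}) : p != 0 -> exists i q, p = q * 'X^i /\ q.[0] != 0.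
  move=> p0; have [n [q Hq Ep]] := multiplicity_XsubC p 0.
  exists n, q; split; first by rewrite Ep subr0.
  by rewrite p0 in Hq.
have [i [A' [EA A'0]]] := split0 A A0; have [j [B' [EB B'0]]] := split0 B B0.
have E' : A' * B' * 'X^(i + j) = c *: 'X^d.
  by rewrite -E EA EB exprD mulrACA.
have AB0 : A' * B' != 0.
  by apply: contraNneq (mulf_neq0 A'0 B'0) => H; rewrite -hornerM H horner0.
have le_ij : (i + j <= d)%N.
  rewrite leqNgt; apply/negP => lt_d; move/polyP/(_ d): E'.
  rewrite coefMXn lt_d coefZ coefXn eqxx mulr1 => H.
  by rewrite -H eqxx in c0.
have {}E' : A' * B' = c *: 'X^(d - (i + j)).
  have X0 : 'X^(i + j) != 0 :> {poly R} by rewrite expf_neq0 // polyX_eq0.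
  apply: (mulIf X0); rewrite E' -scalerAl -exprD subnK //.
have d0 : (d - (i + j) = 0)%N.
  apply/eqP; apply: contraNT (mulf_neq0 A'0 B'0) => /negPf nd.
  by rewrite -hornerM E' hornerZ hornerXn expr0n nd mulr0.
have A'n0 : A' != 0 by apply: contraNneq A'0 => ->; rewrite horner0.
have B'n0 : B' != 0 by apply: contraNneq B'0 => ->; rewrite horner0.
have : size (A' * B') = 1%N by rewrite E' d0 expr0 alg_polyC size_polyC c0.
rewrite size_mul // => Hs; have sA : (size A' <= 1)%N.
  move: B'n0 Hs; rewrite -size_poly_gt0; case: (size B') => // k _.
  by rewrite addnS /= => <-; rewrite leq_addr.
exists i, A'`_0; rewrite EA {1}(size1_polyC sA) mul_polyC //.
Qed.

Section HomogFactor.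
Variables (R : idomainType) (r : nat).

(* Substituting T x_i for x_i turns the degree into the exponent of T. *)
Definition grade (p : {mpoly R[r]}) : {poly {mpoly R[r]}} :=
  mmap (polyC \o @mpolyC r R) (fun i => ('X_i)%:P * 'X) p.

HB.instance Definition _ := GRing.RMorphism.copy grade
  (mmap (polyC \o @mpolyC r R) (fun i => ('X_i)%:P * 'X)).

Lemma gradeX m : grade 'X_[m] = 'X_[m] *: 'X^(mdeg m).
Proof.
rewrite /grade mmapX /mmap1 mdegE mpolyXE_id -mul_polyC rmorph_prod -prodrXr.
rewrite -big_split; apply: eq_bigr => i _ /=.
by rewrite exprMn rmorphXn.
Qed.

Lemma gradeE p : grade p = \sum_(m <- msupp p) (p@_m *: 'X_[m]) *: 'X^(mdeg m).
Proof.
rewrite {1}[p]mpolyE rmorph_sum /=; apply: eq_bigr => m _.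
rewrite -mul_mpolyC rmorphM /= gradeX {1}/grade mmapC /= mul_polyC scalerA.
by [].
Qed.

Lemma grade_homog d p : p \is d.-homog -> grade p = p *: 'X^d.
Proof.
move=> hp; rewrite gradeE {3}[p]mpolyE scaler_suml; apply: eq_big_seq => m hm.
by have /= -> := dhomog_mf hp hm.
Qed.

Lemma coef_grade p i : (grade p)`_i = homog_part i p.
Proof.
rewrite gradeE coef_sum pihomogE [RHS]big_mkcond /=; apply: eq_bigr => m _.
by rewrite coefZ coefXn eq_sym; case: eqP; rewrite ?mulr1 ?mulr0.
Qed.

(** Under [grade], being homogeneous means being a monomial in the extra variable, and a factor of a
    monomial is a monomial. *)
Lemma homog_factor d (a b : {mpoly R[r]}) :
  a * b != 0 -> a * b \is d.-homog -> exists i, a \is i.-homog.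
Proof.
move=> ab0 hab; have := grade_homog hab; rewrite rmorphM => E.
have [i [c Ec]] := XnM_mono ab0 E; exists i.
have Hp j : homog_part j a = if j == i then c else 0.
  rewrite -coef_grade Ec coefZ coefXn; case: eqP; rewrite ?mulr1 ?mulr0 //.
have -> : a = homog_part i a; last exact: pihomogP.
have [lt_i|le_i] := ltnP i (msize a).
  rewrite {1}[a]homog_part_sum (bigD1 (Ordinal lt_i)) //= big1 ?addr0 // => j.
  by rewrite -val_eqE /= Hp => /negPf ->.
rewrite {1}[a]homog_part_sum big1.
  rewrite pihomogE big_seq_cond big1 // => m /andP[/msize_mdeg_lt lt_m].
  by move=> /eqP E'; rewrite E' ltnNge le_i in lt_m.
move=> j _; rewrite Hp; case: eqP => // ej; move: (ltn_ord j); by rewrite ej ltnNge le_i.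
Qed.
End HomogFactor.

Section LinearSubst.
Variable R : comNzRingType.

(** Pullback of forms along [x |-> x *m M]. As [section_eq F A] is [lsub A F] by conversion,
    hyperplane sections and changes of coordinates share the same lemmas. *)
Definition lsub n r (M : 'M[R]_(n, r)) (g : {mpoly R[r]}) : {mpoly R[n]} :=
  g \mPo [tuple \sum_(i < n) M i j *: 'X_i | j < r].

HB.instance Definition _ n r (M : 'M[R]_(n, r)) := GRing.LRMorphism.copy (lsub M)
  (comp_mpoly [tuple \sum_(i < n) M i j *: 'X_i | j < r]).

Lemma lsubX n r (M : 'M[R]_(n, r)) j : lsub M 'X_j = \sum_(i < n) M i j *: 'X_i.
Proof. by rewrite /lsub comp_mpolyXU -tnth_nth tnth_mktuple. Qed.

Lemma lsubC n r (M : 'M[R]_(n, r)) c : lsub M c%:MP = c%:MP.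
Proof. exact: comp_mpolyC. Qed.

Lemma mmap_lsub (E : comNzRingType) (f : {rmorphism R -> E}) n r
    (M : 'M[R]_(n, r)) (x : 'rV[E]_n) g :
  mmap f (x 0) (lsub M g) = mmap f ((x *m map_mx f M) 0) g.
Proof.
apply: (@eq_mpoly_rmorph R r E (mmap f (x 0) \o lsub M)
  (mmap f ((x *m map_mx f M) 0))) => /= [c|j].
  by rewrite lsubC !mmapC.
rewrite lsubX raddf_sum /= [RHS]mmapX mmap1U mxE.
by apply: eq_bigr => i _; rewrite mmapZ /= mmapX mmap1U mxE mulrC.
Qed.

Lemma meval_lsub n r (M : 'M[R]_(n, r)) (x : 'rV[R]_n) g :
  (lsub M g).@[x 0] = g.@[(x *m M) 0].
Proof. by rewrite [LHS](mmap_lsub idfun) map_mx_id. Qed.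

Lemma lsub_homog n r (M : 'M[R]_(n, r)) d g :
  g \is d.-homog -> lsub M g \is d.-homog.
Proof.
move=> hg; rewrite [g]mpolyE big_seq rmorph_sum /=; apply: rpred_sum => m hm.
rewrite linearZ /=; apply: dhomogZ; have /= <- := dhomog_mf hg hm.
rewrite mpolyXE_id rmorph_prod /= mdegE.
have H (I : finType) (P : pred I) e (q : I -> {mpoly R[n]}) :
  (forall i, q i \is (e i).-homog) ->
  \prod_(i | P i) q i \is (\sum_(i | P i) e i)%N.-homog.
  move=> Hq; elim/big_rec2: _ => [|i k p _ Hp]; first exact: dhomog1.
  by apply: dhomogM.
apply: H => i; rewrite rmorphXn /=.
have := @dhomogMn n R mdeg 1 (lsub M 'X_i) (m i); rewrite mul1n; apply.
by rewrite lsubX; apply: rpred_sum => j _; apply: dhomogZ; rewrite dhomogX /= mdeg1.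
Qed.

Lemma lsubA n r s (A : 'M[R]_(n, r)) (B : 'M[R]_(r, s)) g :
  lsub A (lsub B g) = lsub (A *m B) g.
Proof.
apply: (@eq_mpoly_rmorph R s _ (lsub A \o lsub B) (lsub (A *m B))) => /= [c|j].
  by rewrite !lsubC.
rewrite !lsubX rmorph_sum /=.
under eq_bigr do rewrite linearZ /= lsubX scaler_sumr.
rewrite exchange_big /=; apply: eq_bigr => i _; rewrite mxE scaler_suml.
by apply: eq_bigr => k _; rewrite scalerA mulrC.
Qed.

Lemma lsub1 n (g : {mpoly R[n]}) : lsub 1%:M g = g.
Proof.
apply: (@eq_mpoly_rmorph R n _ (lsub 1%:M) idfun) => /= [c|j].
  exact: lsubC.
rewrite lsubX (bigD1 j) //= mxE eqxx scale1r big1 ?addr0 // => i /negPf ne.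
by rewrite mxE ne scale0r.
Qed.

Lemma mderivXU n (i j : 'I_n) : ('X_j : {mpoly R[n]})^`M(i) = (i == j)%:R.
Proof.
rewrite mderivX mnm1E eq_sym; case: eqP => [->|_]; last by rewrite scale0r.
have -> : (U_(j) - U_(j))%MM = 0%MM by apply/mnmP => k; rewrite mnmBE subnn mnm0E.
by rewrite mpolyX0 scale1r.
Qed.

Lemma mderiv_lsub n r (M : 'M[R]_(n, r)) g i :
  (lsub M g)^`M(i) = \sum_(j < r) M i j *: lsub M (g^`M(j)).
Proof.
elim/mpoly_ring_ind: g => [c|j|p q Hp Hq|p q Hp Hq].
- rewrite lsubC mderivC big1 // => j _; by rewrite mderivC raddf0 scaler0.
- rewrite lsubX raddf_sum /= (bigD1 i) //= linearZ /= mderivXU eqxx.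
  rewrite big1 ?addr0 => [|k /negPf nk]; last first.
    by rewrite linearZ /= mderivXU eq_sym nk scaler0.
  rewrite (bigD1 j) //= mderivXU eqxx mulr1n rmorph1.
  rewrite big1 ?addr0 // => k /negPf nk.
  by rewrite mderivXU nk rmorph0 scaler0.
- rewrite rmorphD /= mderivD Hp Hq -big_split; apply: eq_bigr => j _.
  by rewrite mderivD rmorphD scalerDr.
- rewrite rmorphM /= mderivM Hp Hq mulr_suml mulr_sumr -big_split.
  apply: eq_bigr => j _ /=; rewrite mderivM rmorphD !rmorphM /= scalerDr.
  by rewrite scalerAl scalerAr.
Qed.
End LinearSubst.

(** * Hilbert's basis theorem *)

Section Noetherian.

Definition ideal_gen (R : nzRingType) (a : nat -> R) n (x : R) : Prop :=
  exists c : nat -> R, x = \sum_(i < n) c i * a i.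

Definition noetherian (R : nzRingType) : Prop :=
  forall a : nat -> R, exists n, ideal_gen a n (a n).

Lemma noetherian_surj (R S : nzRingType) (f : {rmorphism R -> S}) (g : S -> R) :
  cancel g f -> noetherian R -> noetherian S.
Proof.
move=> gK nR a; have [n [c Hc]] := nR (g \o a); exists n, (f \o c).
rewrite -[LHS]gK -/((g \o a) n) Hc rmorph_sum; apply: eq_bigr => i _ /=.
by rewrite rmorphM /= gK.
Qed.

Lemma field_noetherian (K : fieldType) : noetherian K.
Proof.
move=> a; have [a0|a0] := eqVneq (a 0) 0.
  by exists 0, (fun=> 0); rewrite big_ord0.
by exists 1, (fun=> a 1 / a 0); rewrite big_ord1 divfK.
Qed.

Variable R : comNzRingType.

Lemma ideal_gen_add (a : nat -> R) n x y :
  ideal_gen a n x -> ideal_gen a n y -> ideal_gen a n (x + y).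
Proof.
move=> [c ->] [e ->]; exists (fun i => c i + e i); rewrite -big_split.
by apply: eq_bigr => i _; rewrite mulrDl.
Qed.

Lemma ideal_gen_mul (a : nat -> R) n z x : ideal_gen a n x -> ideal_gen a n (z * x).
Proof.
move=> [c ->]; exists (fun i => z * c i); rewrite mulr_sumr.
by apply: eq_bigr => i _; rewrite mulrA.
Qed.

Lemma ideal_gen0 (a : nat -> R) n : ideal_gen a n 0.
Proof. by exists (fun=> 0); rewrite big1 // => i _; rewrite mul0r. Qed.

Lemma ideal_gen_sum (a : nat -> R) n m (x : 'I_m -> R) :
  (forall i, ideal_gen a n (x i)) -> ideal_gen a n (\sum_i x i).
Proof.
move=> H; elim/big_rec: _ => [|i y _ Hy]; first exact: ideal_gen0.
exact: ideal_gen_add.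
Qed.

Lemma ideal_gen_mem (a : nat -> R) n i : (i < n)%N -> ideal_gen a n (a i).
Proof.
move=> lt_i; exists (fun j => (j == i)%:R); rewrite (bigD1 (Ordinal lt_i)) //=.
rewrite eqxx mul1r big1 ?addr0 // => j; rewrite -val_eqE /= => /negPf ->.
by rewrite mul0r.
Qed.

Lemma ideal_gen_leq (a : nat -> R) n m x : (n <= m)%N -> ideal_gen a n x -> ideal_gen a m x.
Proof.
move=> le_nm [c ->]; apply: ideal_gen_sum => i; apply: ideal_gen_mul.
by apply: ideal_gen_mem; apply: leq_trans le_nm.
Qed.

Lemma ideal_gen_trans (a b : nat -> R) n m x :
  (forall i, (i < n)%N -> ideal_gen b m (a i)) -> ideal_gen a n x -> ideal_gen b m x.
Proof.
move=> H [c ->]; apply: ideal_gen_sum => i; apply: ideal_gen_mul; exact: H.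
Qed.

Lemma eq_ideal_gen (a b : nat -> R) n x :
  (forall i, (i < n)%N -> a i = b i) -> ideal_gen a n x -> ideal_gen b n x.
Proof. by move=> H [c ->]; exists c; apply: eq_bigr => i _; rewrite H. Qed.

End Noetherian.

Section HilbertBasis.
Variable R : comNzRingType.
Hypothesis nR : noetherian R.
Variable a : nat -> {poly R}.

Let I p := exists n, ideal_gen a n p.

Let I_gen n (f : nat -> {poly R}) : (forall i, (i < n)%N -> I (f i)) ->
  exists m, forall i, (i < n)%N -> ideal_gen a m (f i).
Proof.
elim: n => [|n IH] H; first by exists 0.
have [|m Hm] := IH; first by move=> i lt_i; apply: H; apply: leqW.
have [k Hk] := H n (leqnn _); exists (maxn m k) => i.
rewrite ltnS leq_eqVlt => /orP[/eqP->|lt_i].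
  by apply: ideal_gen_leq Hk; rewrite leq_maxr.
by apply: (@ideal_gen_leq _ _ m); [rewrite leq_maxl | apply: Hm].
Qed.

(** Were [I] not finitely generated, one could choose [f n] in [I] of least size outside the ideal
    of the earlier ones. As the leading coefficients satisfy the chain condition in [R], a
    combination of earlier terms cancels the leading term of some [f n], against minimality. *)
Lemma hilbert_basis_seq : exists n, ideal_gen a n (a n).
Proof.
apply: NNPP => Hno.
have fresh n (f : nat -> {poly R}) : (forall i, (i < n)%N -> I (f i)) ->
    exists p, [/\ I p, ~ ideal_gen f n p &
      forall q, I q -> ~ ideal_gen f n q -> (size p <= size q)%N].
  move=> /I_gen [m Hm].
  have [p0 [Ip0 np0]] : exists p, I p /\ ~ ideal_gen f n p.
    exists (a m); split; first by exists m.+1; apply: ideal_gen_mem.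
    by move=> H; apply: Hno; exists m; apply: ideal_gen_trans Hm H.
  have [k] := ubnP (size p0); elim: k p0 Ip0 np0 => // k IH p Ip np lt_p.
  have [H|H] := classic (forall q, I q -> ~ ideal_gen f n q -> (size p <= size q)%N).
    by exists p.
  have [q Hq] := not_all_ex_not _ _ H.
  have [Iq Hq'] := imply_to_and _ _ Hq; have [nq /negP] := imply_to_and _ _ Hq'.
  rewrite -ltnNge => lt_q; apply: (IH q Iq nq).
  exact: leq_trans lt_q _.
pose good (l : seq {poly R}) p := [/\ I p, ~ ideal_gen (nth 0 l) (size l) p &
   forall q, I q -> ~ ideal_gen (nth 0 l) (size l) q -> (size p <= size q)%N].
pose next l := epsilon (inhabits 0) (good l).
have nextP l : (forall i, (i < size l)%N -> I l`_i) -> good l (next l).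
  by move=> Hl; apply: epsilon_spec; apply: fresh.
pose fix F n := if n is m.+1 then rcons (F m) (next (F m)) else [::].
have sF n : size (F n) = n by elim: n => //= n IH; rewrite size_rcons IH.
pose f n := next (F n).
have nthF n i : (i < n)%N -> (F n)`_i = f i.
  elim: n => // n IH; rewrite ltnS /= nth_rcons sF leq_eqVlt => /orP[/eqP->|lt_i].
    by rewrite ltnn eqxx.
  by rewrite lt_i IH.
have IF n : forall i, (i < size (F n))%N -> I (F n)`_i.
  rewrite sF; elim: n => // n IH i lt_i; rewrite nthF //.
  suff [] : good (F i) (next (F i)) by []; apply: nextP.
  move=> j; rewrite sF => lt_j; rewrite nthF // -(nthF n).
    by apply: IH; lia.
  by lia.
have fP n : [/\ I (f n), ~ ideal_gen f n (f n) &
    forall q, I q -> ~ ideal_gen f n q -> (size (f n) <= size q)%N].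
  have [If nf Hf] := nextP _ (@IF n); rewrite sF in nf Hf.
  have E p : ideal_gen f n p <-> ideal_gen (nth 0 (F n)) n p.
    by split; apply: eq_ideal_gen => i lt_i; rewrite nthF.
  split=> // [/E // | q Iq nq]; apply: Hf => // /E //.
have [n [c Hc]] := nR (fun n => lead_coef (f n)).
have [If nf Hmin] := fP n.
have le_size i : (i < n)%N -> (size (f i) <= size (f n))%N.
  move=> lt_i; have [_ _] := fP i; apply=> //.
  by move=> H; apply: nf; apply: ideal_gen_leq H; apply: ltnW.
(* Each [f i] is shifted to the degree of [f n], so that by [Hc] the top coefficient of [g] is that
   of [f n]; [le_size] makes the subtraction of sizes exact. *)
pose g := \sum_(i < n) (c i *: 'X^(size (f n) - size (f i))) * f i.
have gI : ideal_gen f n g by exists (fun i => c i *: 'X^(size (f n) - size (f i))).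
have ng : ~ ideal_gen f n (f n - g).
  by move=> H; apply: nf; rewrite -(subrK g (f n)); apply: ideal_gen_add.
have Ig : I (f n - g).
  have [m Hm] := @I_gen n.+1 f (fun i _ => let: And3 H _ _ := fP i in H).
  exists m; apply: ideal_gen_add; first exact: Hm.
  rewrite -mulN1r; apply: ideal_gen_mul; apply: ideal_gen_trans gI => i lt_i.
  by apply: Hm; apply: ltnW.
have := Hmin _ Ig ng; rewrite leqNgt => /negP; apply.
have f0 : f n != 0 by apply/eqP => f0; apply: nf; rewrite f0; apply: ideal_gen0.
have sz0 : (0 < size (f n))%N by rewrite size_poly_gt0.
rewrite -(prednK sz0) ltnS; apply/leq_sizeP => j le_j.
rewrite coefB /g coef_sum; apply/eqP; rewrite subr_eq0; apply/eqP.
move: le_j; rewrite leq_eqVlt => /orP[/eqP <-|lt_j].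
  rewrite -/(lead_coef (f n)) Hc; apply: eq_bigr => i _.
  have le_i := le_size i (ltn_ord i).
  rewrite -scalerAl coefZ coefXnM.
  have fi0 : (0 < size (f i))%N.
    rewrite size_poly_gt0; apply/eqP => fi; have [_ + _] := fP i; apply.
    by rewrite fi; apply: ideal_gen0.
  have -> : ((size (f n)).-1 < size (f n) - size (f i) = false)%N by lia.
  by rewrite lead_coefE; congr (_ * (f i)`__); lia.
rewrite nth_default; last by rewrite -(prednK sz0).
rewrite big1 // => i _; have le_i := le_size i (ltn_ord i).
rewrite -scalerAl coefZ coefXnM nth_default ?if_same ?mulr0 //.
rewrite leq_subRL; last by rewrite (leq_trans (leq_subr _ _)) // -(prednK sz0).
by rewrite subnK // -(prednK sz0).
Qed.
End HilbertBasis.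

Lemma mpoly_noetherian (K : fieldType) n : noetherian {mpoly K[n]}.
Proof.
elim: n => [|n IH].
  apply: (@noetherian_surj K _ (@mpolyC 0 K) (@mcoeff 0 K 0%MM)).
    by move=> p; apply: mpolyKC.
  exact: field_noetherian.
apply: (@noetherian_surj {poly {mpoly K[n]}} _ (@of_uni K n) (@muni n K)).
  exact: muniK.
by move=> a; apply: hilbert_basis_seq.
Qed.

(** * Unique factorization in polynomial rings *)

Section UniqueFactorization.

Definition divides (R : comNzRingType) (p a : R) : Prop := exists q, a = q * p.

Definition prime_elt (R : idomainType) (p : R) : Prop :=
  [/\ p != 0, p \isn't a GRing.unit
    & forall a b, divides p (a * b) -> divides p a \/ divides p b].

(** The factors are prime and not merely irreducible: uniqueness is then automatic, and an
    irreducible element is seen to be prime by extracting one factor. *)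
Definition has_prime_decomp (R : idomainType) (a : R) : Prop :=
  exists u s, [/\ u \is a GRing.unit, forall p, p \in s -> prime_elt p
    & a = u * \prod_(p <- s) p].

Definition factorial_dom (R : idomainType) : Prop :=
  forall a : R, a != 0 -> has_prime_decomp a.

Lemma has_prime_decompM (R : idomainType) (a b : R) :
  has_prime_decomp a -> has_prime_decomp b -> has_prime_decomp (a * b).
Proof.
move=> [u [s [Uu Hs ->]]] [v [t [Uv Ht ->]]]; exists (u * v), (s ++ t); split.
- by rewrite unitrM Uu Uv.
- by move=> p; rewrite mem_cat => /orP[/Hs|/Ht].
- by rewrite big_cat /= mulrACA.
Qed.

Lemma prime_decomp_unit (R : idomainType) (u : R) :
  u \is a GRing.unit -> has_prime_decomp u.
Proof. by move=> Uu; exists u, [::]; split=> //; rewrite big_nil mulr1. Qed.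

Lemma prime_decomp_prime (R : idomainType) (p : R) : prime_elt p -> has_prime_decomp p.
Proof.
move=> Hp; exists 1, [:: p]; split; first exact: unitr1.
- by move=> q; rewrite inE => /eqP->.
- by rewrite big_seq1 mul1r.
Qed.

Lemma irreducible_prime (R : idomainType) (a : R) : factorial_dom R ->
  a != 0 -> a \isn't a GRing.unit ->
  (forall b c, a = b * c -> b \is a GRing.unit \/ c \is a GRing.unit) ->
  prime_elt a.
Proof.
move=> fR a0 Ua Ha; have [u [[|p s] [Uu Hs Ea]]] := fR a a0.
  by rewrite Ea big_nil mulr1 Uu in Ua.
have [p0 Up Pp] := Hs p (mem_head _ _).
have E : a = p * (u * \prod_(q <- s) q) by rewrite Ea big_cons mulrCA.
have [Hp|Uv] := Ha _ _ E; first by rewrite Hp in Up.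
set v := u * _ in E Uv; split=> // x y [q Hq].
have [|[r Hr]|[r Hr]] := Pp x y; first by exists (q * v); rewrite Hq E -mulrA [v * p]mulrC.
- by left; exists (r * v^-1); rewrite Hr E -mulrA [p * v]mulrC mulKr.
- by right; exists (r * v^-1); rewrite Hr E -mulrA [p * v]mulrC mulKr.
Qed.

Lemma factorial_iso (R S : idomainType) (f : {rmorphism R -> S}) (g : {rmorphism S -> R}) :
  cancel f g -> cancel g f -> factorial_dom R -> factorial_dom S.
Proof.
move=> fK gK fR a a0.
have [|u [s [Uu Hs Ea]]] := fR (g a).
  by rewrite -(rmorph0 g) (can_eq gK).
exists (f u), (map f s); split; first exact: rmorph_unit.
  move=> _ /mapP[p /Hs [p0 Up Pp] ->]; split.
  - by rewrite -(rmorph0 f) (can_eq fK).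
  - by apply: contra Up => /(rmorph_unit g); rewrite fK.
  - move=> x y [q Hq]; have [|[r Hr]|[r Hr]] := Pp (g x) (g y).
    + by exists (g q); rewrite -rmorphM Hq rmorphM fK.
    + by left; exists (f r); rewrite -rmorphM -Hr gK.
    + by right; exists (f r); rewrite -rmorphM -Hr gK.
by rewrite big_map -rmorph_prod -rmorphM -Ea gK.
Qed.

Lemma field_factorial (K : fieldType) : factorial_dom K.
Proof. by move=> a a0; apply: prime_decomp_unit; rewrite unitfE. Qed.

Section PolyFactorial.
Variable R : idomainType.
Implicit Types (p c : R) (f g : {poly R}).

(** If [p] divides [f * g], it divides the product of the leading coefficients, hence one of them.
    That leading term can be removed without affecting divisibility, and the sum of the sizes
    drops. *)
Lemma prime_polyC p : prime_elt p -> prime_elt p%:P.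
Proof.
move=> [p0 Up Pp]; split; first by rewrite polyC_eq0.
  by rewrite poly_unitE coefC /= (negPf Up) andbF.
move=> f g; have [n] := ubnP (size f + size g).
elim: n f g => // n IH f g lt_n Hfg.
have [->|f0] := eqVneq f 0; first by left; exists 0; rewrite mul0r.
have [->|g0] := eqVneq g 0; first by right; exists 0; rewrite mul0r.
pose tl (h : {poly R}) := h - lead_coef h *: 'X^((size h).-1) : {poly R}.
have tl_size (h : {poly R}) : h != 0 -> (size (tl h) < size h)%N.
  move=> h0; have h1 : (0 < size h)%N by rewrite size_poly_gt0.
  rewrite -[X in (_ < X)%N](prednK h1) ltnS; apply/leq_sizeP => j.
  rewrite leq_eqVlt => /orP[/eqP <-|lt_j].
    by rewrite coefB coefZ coefXn eqxx mulr1 lead_coefE subrr.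
  rewrite coefB coefZ coefXn gtn_eqF // mulr0 subr0 nth_default //.
  by rewrite -(prednK h1).
have tlE (h : {poly R}) : h = tl h + lead_coef h *: 'X^((size h).-1) by rewrite subrK.
have divZ (h k : {poly R}) x : divides p x -> divides p%:P (x *: h * k).
  by move=> [q ->]; exists (q *: h * k); rewrite -!mul_polyC polyCM; ring.
have divB (h k : {poly R}) : divides p%:P h -> divides p%:P k -> divides p%:P (h - k).
  by move=> [q ->] [r ->]; exists (q - r); rewrite mulrBl.
have divD (h k : {poly R}) : divides p%:P h -> divides p%:P k -> divides p%:P (h + k).
  by move=> [q ->] [r ->]; exists (q + r); rewrite mulrDl.
have [] := Pp (lead_coef f) (lead_coef g).
- have [q Hq] := Hfg; exists (lead_coef q).
  by rewrite -lead_coefM Hq lead_coefM lead_coefC.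
- move=> Hlf; have : divides p%:P (tl f * g).
    by rewrite /tl mulrBl; apply: divB => //; apply: divZ.
  move/(IH (tl f) g)=> []; [|move=> Hf; left|by right].
    by rewrite -ltnS; apply: leq_trans lt_n; rewrite ltnS ltn_add2r tl_size.
  by rewrite [f]tlE; apply: divD => //; rewrite -[_ *: _]mulr1; apply: divZ.
- move=> Hlg; have : divides p%:P (f * tl g).
    rewrite /tl mulrBr; apply: divB => //; rewrite mulrC; exact: divZ.
  move/(IH f (tl g))=> []; [|by left|move=> Hg; right].
    by rewrite -ltnS; apply: leq_trans lt_n; rewrite ltnS ltn_add2l tl_size.
  by rewrite [g]tlE; apply: divD => //; rewrite -[_ *: _]mulr1; apply: divZ.
Qed.

Definition primitive_poly f : Prop := forall p, prime_elt p -> ~ divides p%:P f.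

Hypothesis fR : factorial_dom R.

(* Gauss's lemma *)
Lemma primitive_split c f a b : c != 0 -> primitive_poly f -> c *: f = a * b ->
  exists a' b', [/\ f = a' * b', size a' = size a & size b' = size b].
Proof.
move=> c0 Hf; have [u [s [Uu Hs Ec]]] := fR c0.
have [n] := ubnP (size s); elim: n s c c0 Hs a b Ec => // n IH [|p s] c c0 Hs a b Ec lt_n E.
  move: Ec; rewrite big_nil mulr1 => Ec; exists (u^-1 *: a), b; split=> //.
    by rewrite -scalerAl -E scalerA Ec mulVr // scale1r.
  by rewrite size_scale // invr_eq0; apply: contraTneq Uu => ->; rewrite unitr0.
have Pp := Hs p (mem_head _ _); have [p0 _ _] := Pp.
have [_ _ PpP] := prime_polyC Pp.
set c' := u * \prod_(q <- s) q.
have Ec' : c = p * c' by rewrite Ec big_cons mulrCA.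
have c'0 : c' != 0 by apply: contraNneq c0; rewrite Ec' => ->; rewrite mulr0.
have pP0 : p%:P != 0 by rewrite polyC_eq0.
have Hs' q : q \in s -> prime_elt q by move=> Hq; apply: Hs; rewrite inE Hq orbT.
have E' : c' *: f * p%:P = a * b by rewrite -E Ec' mulrC mul_polyC scalerA.
have [|[q Hq]|[q Hq]] := PpP a b; first by exists (c' *: f); rewrite E'.
- have [|a' [b' [-> Ha Hb]]] := IH s c' c'0 Hs' q b erefl lt_n.
    by apply: (mulIf pP0); rewrite E' Hq mulrAC.
  by exists a', b'; split=> //; rewrite Ha Hq mulrC mul_polyC size_scale.
- have [|a' [b' [-> Ha Hb]]] := IH s c' c'0 Hs' a q erefl lt_n.
    by apply: (mulIf pP0); rewrite E' Hq mulrA.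
  by exists a', b'; split=> //; rewrite Hb Hq mulrC mul_polyC size_scale.
Qed.

(** The primes of [c] are cancelled one at a time: each divides [q * f] but not the primitive [f],
    hence divides [q]. *)
Lemma primitive_cancel c f a q : c != 0 -> primitive_poly f -> c *: a = q * f ->
  divides f a.
Proof.
move=> c0 Hf; have [u [s [Uu Hs Ec]]] := fR c0.
elim: s c c0 Hs q Ec => [|p s IH] c c0 Hs q Ec E.
  move: Ec; rewrite big_nil mulr1 => Ec; exists (u^-1 *: q).
  by rewrite -scalerAl -E scalerA Ec mulVr // scale1r.
have Pp := Hs p (mem_head _ _); have [p0 _ _] := Pp.
have [_ _ PpP] := prime_polyC Pp.
set c' := u * \prod_(q <- s) q.
have Ec' : c = p * c' by rewrite Ec big_cons mulrCA.
have c'0 : c' != 0 by apply: contraNneq c0; rewrite Ec' => ->; rewrite mulr0.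
have pP0 : p%:P != 0 by rewrite polyC_eq0.
have E' : c' *: a * p%:P = q * f by rewrite -E Ec' mulrC mul_polyC scalerA.
have [|[r Hr]|/(Hf _ Pp)//] := PpP q f; first by exists (c' *: a); rewrite E'.
apply: (IH c' c'0 _ r erefl); first by move=> x Hx; apply: Hs; rewrite inE Hx orbT.
by apply: (mulIf pP0); rewrite E' Hr mulrAC.
Qed.

(** Over a domain [%|] is divisibility up to a scalar, so [gcdp g a] is a gcd over the fraction
    field. By [primitive_split] it has the size of a true factor of [g], hence is constant or
    associate to [g]; so [g] divides [b] or [a] up to a scalar, which [primitive_cancel] removes. *)
Lemma primitive_prime g : (1 < size g)%N -> primitive_poly g ->
  (forall a b, g = a * b -> size a = size g \/ size b = size g) -> prime_elt g.
Proof.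
move=> sg Pg Hg; have g0 : g != 0 by rewrite -size_poly_gt0 ltnW.
split=> //; first by rewrite poly_unitE gtn_eqF.
move=> a b [q Hq].
have dP (x : {poly R}) : g %| x -> divides g x.
  by move=> /Pdiv.Idomain.dvdpP [[c r] /= c0 Hc]; apply: primitive_cancel c0 Pg Hc.
have Hdg := dvdp_gcdl g a; have Hda := dvdp_gcdr g a.
have /Pdiv.Idomain.dvdpP [[c r] /= c0 Hc] := Hdg.
have [r' [d' [Eg sr sd]]] := primitive_split c0 Pg Hc.
have [r0 d0] : r' != 0 /\ d' != 0.
  by move: g0; rewrite Eg mulf_eq0 negb_or => /andP.
have sg' : size g = (size r' + size d').-1 by rewrite {1}Eg size_mul.
have := r0; have := d0; rewrite -!size_poly_gt0 => d0' r0'.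
have [E|E] := Hg _ _ Eg.
- right; apply: dP; rewrite -(@Gauss_dvdpr _ b a).
    by apply/Pdiv.Idomain.dvdpP; exists (1, q); rewrite ?oner_eq0 // scale1r -Hq.
  by rewrite /coprimep -sd; lia.
- left; apply: dP; apply: dvdp_trans Hda.
  rewrite -(eqp_dvdl _ (_ : gcdp g a %= g)) // -dvdp_size_eqp // -sd E //.
Qed.

(** Cancelling a prime lowers the number of prime factors by exactly one; this count is the
    termination measure of [primitive_part], applied to leading coefficients. *)
Lemma prime_cofactor p b u s : prime_elt p -> u \is a GRing.unit ->
  (forall q, q \in s -> prime_elt q) -> p * b = u * \prod_(q <- s) q ->
  exists v t, [/\ v \is a GRing.unit, forall q, q \in t -> prime_elt q,
    b = v * \prod_(q <- t) q & size s = (size t).+1].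
Proof.
move=> [p0 Up Pp]; elim: s b => [|q s IH] b Uu Hs E.
  by case/negP: Up; move: E; rewrite big_nil mulr1 => E; rewrite -E unitrM in Uu; case/andP: Uu.
have [q0 Uq Pq] := Hs q (mem_head _ _).
have Hs' x : x \in s -> prime_elt x by move=> Hx; apply: Hs; rewrite inE Hx orbT.
have [|[r Hr]|[r Hr]] := Pq p b.
- by exists (u * \prod_(q <- s) q); rewrite E big_cons mulrCA mulrC.
- have [|[t Ht]|[t Ht]] := Pp r q; first by exists 1; rewrite mul1r.
    have H : t * q = 1 by apply: (mulIf p0); rewrite mul1r mulrAC -Ht -Hr.
    by case/negP: Uq; apply/unitrPr; exists t; rewrite mulrC.
  have H : r * t = 1 by apply: (mulIf p0); rewrite mul1r -mulrA -Ht -Hr.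
  have Ut : t \is a GRing.unit by apply/unitrPr; exists r; rewrite mulrC.
  exists (t * u), s; split=> //; first by rewrite unitrM Ut.
  apply: (mulfI p0); rewrite E big_cons Ht; ring.
- have [|v [t [Uv Ht Eb ss]]] := IH r Uu Hs'.
    by apply: (mulfI q0); rewrite mulrCA [q * r]mulrC -Hr E big_cons; ring.
  exists v, (q :: t); split=> //; last by rewrite /= ss.
  - by move=> x; rewrite inE => /orP[/eqP->|/Ht//]; apply: Hs; apply: mem_head.
  - by rewrite Hr Eb big_cons; ring.
Qed.

Lemma primitive_part f : f != 0 -> exists c g, [/\ c != 0, primitive_poly g & f = c *: g].
Proof.
move=> f0; have [|u [s [Uu Hs E]]] := fR (_ : lead_coef f != 0).
  by rewrite lead_coef_eq0.
have [n] := ubnP (size s); elim: n s f f0 u Uu Hs E => // n IH s f f0 u Uu Hs E lt_n.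
have [Hf|Hf] := classic (primitive_poly f).
  by exists 1, f; split=> //; rewrite ?oner_eq0 ?scale1r.
have [p Hp] := not_all_ex_not _ _ Hf; have [Pp Hp'] := imply_to_and _ _ Hp.
have [g Hg] := NNPP _ Hp'.
have g0 : g != 0 by apply: contraNneq f0; rewrite Hg => ->; rewrite mul0r.
have [|v [t [Uv Ht Eg st]]] := prime_cofactor (b := lead_coef g) Pp Uu Hs.
  by rewrite -E Hg lead_coefM lead_coefC mulrC.
have [|c [h [c0 Ph Eh]]] := IH t g g0 v Uv Ht Eg; first by lia.
have [p0 _ _] := Pp; exists (c * p), h; split=> //; first by rewrite mulf_neq0.
by rewrite Hg Eh mulrC mul_polyC scalerA mulrC.
Qed.

(** Content and primitive part are factored separately. A constant primitive polynomial is a unit;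
    any other is prime unless it splits into two factors of smaller size. *)
Lemma factorial_poly : factorial_dom {poly R}.
Proof.
move=> f; have [n] := ubnP (size f); elim: n f => // n IH f lt_n f0.
have [c [g [c0 Pg Ef]]] := primitive_part f0.
have sg : size g = size f by rewrite Ef size_scale.
have g0 : g != 0 by rewrite -size_poly_gt0 sg size_poly_gt0.
rewrite Ef -mul_polyC; apply: has_prime_decompM.
  have [u [s [Uu Hs ->]]] := fR c0; exists u%:P, (map polyC s); split.
  - have u0 : u != 0 by apply: contraTneq Uu => ->; rewrite unitr0.
    by rewrite poly_unitE size_polyC coefC eqxx Uu u0.
  - by move=> _ /mapP[p /Hs Pp ->]; apply: prime_polyC.
  - by rewrite polyCM rmorph_prod big_map.
have [le_g|lt_g] := leqP (size g) 1.
  apply: prime_decomp_unit; rewrite poly_unitE.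
  have sg1 : size g = 1%N by apply/eqP; rewrite eqn_leq le_g size_poly_gt0.
  rewrite sg1 eqxx /=; have [b Eg] : exists b, g = b%:P by exists g`_0; rewrite [LHS](size1_polyC (eq_leq sg1)).
  have b0 : b != 0 by move: g0; rewrite Eg polyC_eq0.
  rewrite Eg coefC eqxx; have [u [[|p s] [Uu Hs Eb]]] := fR b0.
    by rewrite Eb big_nil mulr1.
  case: (Pg p (Hs p (mem_head _ _))); exists (u * \prod_(q <- s) q)%:P.
  by rewrite Eg Eb big_cons -polyCM; congr _%:P; ring.
have [Hg|Hg] := classic (forall a b, g = a * b -> size a = size g \/ size b = size g).
  by apply: prime_decomp_prime; apply: primitive_prime.
have [a Ha] := not_all_ex_not _ _ Hg; have [b Hb] := not_all_ex_not _ _ Ha.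
have [Eg /not_or_and[nsa nsb]] := imply_to_and _ _ Hb.
have [a0 b0] : a != 0 /\ b != 0 by move: g0; rewrite Eg mulf_eq0 negb_or => /andP.
have := a0; have := b0; rewrite -!size_poly_gt0 => sb sa.
have Hsz := size_mul a0 b0; rewrite -Eg in Hsz.
by rewrite Eg; apply: has_prime_decompM; apply: IH => //; lia.
Qed.
End PolyFactorial.

Lemma mpoly_factorial (K : fieldType) n : factorial_dom {mpoly K[n]}.
Proof.
elim: n => [|n IH].
  apply: (@factorial_iso K _ (@mpolyC 0 K) (@mcoeff 0 K 0%MM)).
  - by move=> c; rewrite /= mcoeffC eqxx mulr1.
  - by move=> p; apply: mpolyKC.
  - exact: field_factorial.
apply: (@factorial_iso {poly {mpoly K[n]}} _ (@of_uni K n) (@muni n K)).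
- exact: of_uniK.
- exact: muniK.
- exact: factorial_poly.
Qed.

Lemma irreducible_mpoly_prime (K : fieldType) n (F : {mpoly K[n]}) :
  irreducible_mpoly F -> prime_elt F.
Proof. by move=> [F0 UF HF]; apply: irreducible_prime => //; apply: mpoly_factorial. Qed.

End UniqueFactorization.

Lemma complete_row_free (K : fieldType) m n (A : 'M[K]_(m, n)) (f : 'I_m -> 'I_n) :
  injective f -> row_free A -> exists2 M : 'M[K]_n, M \in unitmx & forall i, row (f i) M = row i A.
Proof.
move=> injf /eqP rA.
pose U : 'M[K]_(m, n) := \matrix_(i, j) (j == f i)%:R.
pose V : 'M[K]_(n, m) := \matrix_(j, i) (j == f i)%:R.
have UV : U *m V = 1%:M.
  apply/matrixP => i k; rewrite !mxE (bigD1 (f i)) //= !mxE eqxx mul1r.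
  rewrite big1 ?addr0 ?(inj_eq injf) // => j /negPf nj.
  by rewrite !mxE nj mul0r.
have rU : \rank U = m.
  apply/eqP; rewrite eqn_leq rank_leq_row /=.
  by rewrite -{1}(mxrank1 K m) -UV mxrankM_maxl.
have [|M uM HM] := @complete_unitmx _ m n U (V *m A); first by rewrite mulmxA UV mul1mx rA.
exists M => // i; move: HM; rewrite mulmxA UV mul1mx => /(congr1 (row i)) ->.
rewrite row_mul; apply/rowP => j; rewrite !mxE (bigD1 (f i)) //= !mxE eqxx mul1r.
by rewrite big1 ?addr0 // => k /negPf nk; rewrite !mxE nk mul0r.
Qed.

Lemma complete_row (K : fieldType) n (i : 'I_n) (v : 'rV[K]_n) : v != 0 ->
  exists2 M : 'M[K]_n, M \in unitmx & row i M = v.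
Proof.
move=> v0; have [||M uM HM] := @complete_row_free K 1 n v (fun=> i).
- by move=> j l _; rewrite !ord1.
- by rewrite /row_free rank_rV v0.
by exists M; rewrite // (HM ord0); apply/rowP => j; rewrite mxE.
Qed.

Lemma homog_part_lsub (R : comNzRingType) n r (M : 'M[R]_(n, r)) d g :
  homog_part d (lsub M g) = lsub M (homog_part d g).
Proof.
rewrite {1}[g]homog_part_sum rmorph_sum /= raddf_sum /=.
have [lt_d|le_d] := ltnP d (msize g).
  rewrite (bigD1 (Ordinal lt_d)) //= big1 ?addr0 => [|i].
    by rewrite pihomog_dE // lsub_homog // pihomogP.
  rewrite -val_eqE /= => ni; apply: (@pihomog_ne0 _ _ mdeg i) => //.
  by rewrite lsub_homog // pihomogP.
have -> : homog_part d g = 0.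
  rewrite pihomogE big_seq_cond big1 // => m /andP[/msize_mdeg_lt lt_m].
  by move=> /eqP E; rewrite E ltnNge le_d in lt_m.
rewrite rmorph0 big1 // => i _; apply: (@pihomog_ne0 _ _ mdeg i).
  by rewrite neq_ltn (leq_trans (ltn_ord i) le_d).
by rewrite lsub_homog // pihomogP.
Qed.

(** * Nullstellensatz *)

Lemma resultant_map (R S : nzRingType) (f : {rmorphism R -> S}) (p q : {poly R}) :
  f (lead_coef p) != 0 -> f (lead_coef q) != 0 ->
  f (resultant p q) = resultant (map_poly f p) (map_poly f q).
Proof.
move=> nz_fp nz_fq; rewrite /resultant /Sylvester_mx !size_map_poly_id0 //.
rewrite -det_map_mx /= map_col_mx; congr (\det (col_mx _ _));
  by apply: map_lin1_mx => v; rewrite map_poly_rV rmorphM /= map_rVpoly.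
Qed.

Definition is_ideal (R : nzRingType) (I : R -> Prop) : Prop :=
  [/\ I 0, forall f g, I f -> I g -> I (f + g) & forall h f, I f -> I (h * f)].

Section Nullstellensatz.
Variable K : closedFieldType.

(** The value of the top form at the last basis vector is the coefficient of ['X_ord_max ^+ D], and
    by degree no other monomial contains that power of the last variable. *)
Lemma muni_monic n D (g : {mpoly K[n.+1]}) :
  msize g = D.+1 -> (homog_part D g).@[(delta_mx 0 ord_max : 'rV_n.+1) 0] != 0 ->
  exists2 c, c != 0 & size (muni g) = D.+1 /\ lead_coef (muni g) = c%:MP.
Proof.
move=> sg ne; set c := (homog_part D g).@[_] in ne; exists c => //.
have e0 i : (delta_mx 0 ord_max : 'rV[K]_n.+1) 0 (widen_ord (leqnSn n) i) = 0.
  by rewrite mxE eqxx -val_eqE /= ltn_eqF.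
have Hcoef k : (D <= k)%N -> (muni g)`_k = if k == D then c%:MP else 0.
  move=> le_k; rewrite muniE coef_sum.
  have -> : c%:MP_[n] = \sum_(m <- msupp g | mdeg m == D)
      ((g@_m *: 'X_[m]).@[(delta_mx 0 ord_max : 'rV_n.+1) 0])%:MP_[n].
    by rewrite /c pihomogE (raddf_sum (meval _)) (raddf_sum (@mpolyC n K)).
  rewrite [X in if _ then X else _]big_mkcond /=.
  transitivity (\sum_(m <- msupp g) if k == D then
     (if mdeg m == D then (g@_m *: 'X_[m]).@[(delta_mx 0 ord_max : 'rV_n.+1) 0]%:MP_[n] else 0) else 0).
    apply: eq_big_seq => m hm; rewrite !coefZ coefXn.
    have le_m : (mdeg m <= D)%N by rewrite -ltnS -sg msize_mdeg_lt.
    have Em : (mdeg m = \sum_(i < n) m (widen_ord (leqnSn n) i) + m ord_max)%N.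
      by rewrite mdegE big_ord_recr.
    have [Ek|nk] := eqVneq k (m ord_max); last first.
      rewrite !mulr0; case: eqP => // EkD; case: eqP => // EmD.
      rewrite mevalZ mevalX (bigD1 ord_max) //=.
      have [i ni] : exists i : 'I_n, m (widen_ord (leqnSn n) i) != 0.
        apply/existsP; rewrite -negb_forall; apply: contraNN nk => /forallP H.
        by rewrite EkD -EmD Em big1 // => i _; apply/eqP/H.
      rewrite (bigD1 (widen_ord (leqnSn n) i)) /=; last by rewrite -val_eqE /= ltn_eqF.
      rewrite e0 expr0n (negPf ni).
      by rewrite mul0r !mulr0 mpolyC0.
    have EkD : k = D by lia.
    have EmD : mdeg m = D by lia.
    have m0 i : m (widen_ord (leqnSn n) i) = 0%N.
      apply/eqP; have : (\sum_(i < n) m (widen_ord (leqnSn n) i) == 0)%N by lia.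
      by rewrite sum_nat_eq0 => /forallP/(_ i).
    rewrite EkD EmD eqxx mulr1n mulr1.
    have -> : [multinom m (widen_ord (leqnSn n) i) | i < n] = 0%MM.
      by apply/mnmP => i; rewrite mnmE m0 mnm0E.
    rewrite mpolyX0 mevalZ mevalX big_ord_recr /= big1 ?mul1r => [|i _].
      by rewrite mxE !eqxx expr1n mulr1 alg_mpolyC.
    by rewrite m0.
  by case: eqP => // _; rewrite big1.
have s1 : size (muni g) = D.+1.
  apply/eqP; rewrite eqn_leq; apply/andP; split.
    apply/leq_sizeP => j lt_j; rewrite Hcoef ?gtn_eqF // ltnW //.
  rewrite ltnNge; apply/negP => /leq_sizeP/(_ D (leqnn _)).
  by rewrite Hcoef // eqxx => /eqP; rewrite mpolyC_eq0 (negPf ne).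
by split=> //; rewrite lead_coefE s1 Hcoef // eqxx.
Qed.

Lemma monic_coordinates n (f : {mpoly K[n.+1]}) : f != 0 ->
  exists2 M : 'M[K]_n.+1, M \in unitmx &
    exists2 c, c != 0 & size (muni (lsub M f)) = msize f /\ lead_coef (muni (lsub M f)) = c%:MP.
Proof.
move=> f0; set D := (msize f).-1.
have sf : msize f = D.+1 by rewrite /D prednK // lt0n msize_poly_eq0.
have fD0 : homog_part D f != 0.
  have := mlead_supp f0; rewrite mcoeff_msupp => H; apply: contraNneq H => /(congr1 (mcoeff (mlead f))).
  rewrite pihomogE mcoeff0 raddf_sum /= -big_filter => <-.
  rewrite (bigD1_seq (mlead f)) ?filter_uniq ?msupp_uniq //=; last first.
    by rewrite mem_filter mlead_supp // andbT /D -mlead_deg.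
  rewrite mcoeffZ mcoeffX eqxx mulr1 big1 ?addr0 // => m /negPf nm.
  by rewrite mcoeffZ mcoeffX nm mulr0.
(* The factor ['X_ord_max] forces [w] to be nonzero even if the top form is a constant. *)
have [w] : exists w : 'rV_n.+1, (homog_part D f * 'X_ord_max).@[w 0] != 0.
  apply: mpoly_nonzero_row; rewrite mulf_neq0 //.
  by rewrite -msize_poly_eq0 msizeX.
rewrite mevalM mevalXU mulf_eq0 negb_or => /andP[Hw wn].
have w0 : w != 0 by apply: contraNneq wn => ->; rewrite mxE.
have [M uM HM] := complete_row ord_max w0.
have eM : (delta_mx 0 ord_max : 'rV_n.+1) *m M = w.
  by rewrite -rowE HM.
exists M => //; rewrite sf; apply: muni_monic; last first.
  by rewrite homog_part_lsub meval_lsub eM.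
rewrite -sf; have H N (g : {mpoly K[n.+1]}) : (msize (lsub N g) <= msize g)%N.
  rewrite {1}[g]homog_part_sum rmorph_sum /=.
  apply: leq_trans (msize_sum _ _ _) _; apply/bigmax_leqP => i _.
  have [->|n0] := eqVneq (lsub N (homog_part i g)) 0; first by rewrite msize0.
  have /= E := dhomog_mf (lsub_homog N (pihomogP mdeg i g)) (mlead_supp n0).
  by rewrite -(mlead_deg n0) E.
apply/eqP; rewrite eqn_leq H /=.
by rewrite -{1}[f]lsub1 -(mulVmx uM) -lsubA H.
Qed.

(* Arrondo's argument: over a zero [a] of the elimination ideal, the
   specialization of [J] at [a] stays proper because the resultant with a monic
   element of [J] lies in the elimination ideal. *)

Lemma ideal_zero_lift n (J : {mpoly K[n.+1]} -> Prop) (G0 : {poly {mpoly K[n]}})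
    (c : K) (a : 'rV[K]_n) :
  is_ideal J -> ~ J 1 -> J (of_uni G0) -> c != 0 -> lead_coef G0 = c%:MP ->
  (forall h, J (mwiden h) -> h.@[a 0] = 0) ->
  exists v : 'rV_n.+1, forall g, J g -> g.@[v 0] = 0.
Proof.
move=> [J0 JD JM] J1 JG0 c0 lg Ha.
have [ev Eev] : exists ev : {rmorphism {poly {mpoly K[n]}} -> {poly K}},
    ev = map_poly (meval (a 0)) :> (_ -> _) by exists (map_poly (meval (a 0))).
have G00 : G0 != 0 by rewrite -lead_coef_eq0 lg mpolyC_eq0.
have lG0 : (meval (a 0)) (lead_coef G0) != 0 by rewrite lg mevalC.
have evG0 : ev G0 != 0.
  apply: contraNneq lG0; rewrite Eev => /polyP/(_ (size G0).-1).
  by rewrite coef_map coef0 => <-.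
have sz0 : (1 < size G0)%N.
  rewrite ltnNge; apply/negP => sz; case: J1.
  have E : G0 = (c%:MP)%:P by rewrite (size1_polyC sz) -lg {2}(size1_polyC sz) lead_coefC.
  have := JM (c^-1)%:MP _ JG0; by rewrite E of_uniC mwidenC -mpolyCM mulVf.
have JG p : J (of_uni p) -> (size (ev p) != 1)%N.
  move=> Jp; apply/negP => /size_poly1P [e e0 Ee].
  (* The leading coefficient of [p] may vanish at [a], and then the resultant would not commute with
     evaluation. Adding a multiple of [G0] gives [G1] the leading coefficient of [G0], and its
     specialization stays coprime to that of [G0]. *)
  have sG0X : (size p < size (G0 * 'X^(size p))%R)%N.
    rewrite (size_mulXn _ G00) -[X in (X < _)%N]addn0 ltn_add2l.
    by rewrite size_poly_gt0.
  have [G1 EG1] : exists G1, G1 = p + G0 * 'X^(size p) := ex_intro _ _ erefl.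
  have lG1 : lead_coef G1 = lead_coef G0.
    by rewrite EG1 addrC (lead_coefDl sG0X) (lead_coef_Mmonic _ (monicXn _ _)).
  have sz1 : (1 < size G1)%N.
    rewrite EG1 addrC (size_polyDl sG0X) (leq_trans sz0) // (size_mulXn _ G00).
    exact: leq_addl.
  have [[u w] /= _ Eres] := resultant_in_ideal sz0 sz1.
  have : (resultant G0 G1).@[a 0] = 0.
    have JG1 : J (of_uni G1).
      have -> : of_uni G1 = of_uni p + of_uni 'X^(size p) * of_uni G0.
        by rewrite EG1 -rmorphM -rmorphD [_ * G0]mulrC.
      exact: (JD _ _ Jp (JM _ _ JG0)).
    have E1 : of_uni (u * G0 + w * G1) = of_uni u * of_uni G0 + of_uni w * of_uni G1.
      by rewrite raddfD /= !(rmorphM (@of_uni K n)).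
    by apply: Ha; rewrite -of_uniC Eres E1; exact: (JD _ _ (JM _ _ JG0) (JM _ _ JG1)).
  have lG1' : (meval (a 0)) (lead_coef G1) != 0 by rewrite lG1.
  move/eqP; rewrite -[X in X == _]/(meval (a 0) _) (resultant_map lG0 lG1').
  rewrite resultant_eq0 -Eev EG1 rmorphD rmorphM Ee.
  move: (ev G0) (ev 'X^(size p)) => A B Hgcd.
  have : gcdp A (e%:P + A * B) %| e%:P.
    rewrite -(dvdp_addl _ (dvdp_mulr B (dvdp_gcdl A (e%:P + A * B)))).
    exact: dvdp_gcdr.
  by move/dvdp_leq; rewrite polyC_eq0 size_polyC e0 leqNgt Hgcd => /(_ isT).
(* [q] generates the image of [J] in the principal ring [{poly K}]. By [JG] it is not a nonzero
   constant, so it has a root, which is the last coordinate of the point sought. *)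
have [q [[G JG' Eq] q0 qmin]] : exists q, [/\ exists2 G, J (of_uni G) & q = ev G, q != 0
    & forall G, J (of_uni G) -> ev G != 0 -> (size q <= size (ev G))%N].
  have Q0 : exists2 G, J (of_uni G) & ev G0 = ev G := ex_intro2 _ _ G0 JG0 erefl.
  move: (ev G0) evG0 Q0 => q; have [k] := ubnP (size q).
  elim: k q => [q /[!ltn0]//|k IHk q lt_k q0 Qq].
  have [H|/not_all_ex_not [G H]] := classic (forall G, J (of_uni G) -> ev G != 0 ->
    (size q <= size (ev G))%N).
    exact: (ex_intro _ q (And3 Qq q0 H)).
  have [JG' H'] := imply_to_and _ _ H; have [G'0 /negP] := imply_to_and _ _ H'.
  rewrite -ltnNge => lt_q; apply: (IHk (ev G) _ G'0).
    by apply: leq_trans lt_q _.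
  exact: (ex_intro2 _ _ G JG' erefl).
have dvd_q G' : J (of_uni G') -> q %| ev G'.
  move=> Jg'; have [r Er] : exists r, r = ev G' := ex_intro _ _ erefl.
  have [B EB] : exists B, ev B = r %/ q.
    exists (map_poly (@mpolyC n K) (r %/ q)); rewrite Eev.
    by apply/polyP => i; rewrite !coef_map /= mevalC.
  have Eh : ev (G' - B * G) = r %% q.
    have -> : ev (G' - B * G) = ev G' - ev B * ev G.
      by rewrite rmorphB; congr (_ - _); rewrite rmorphM.
    by rewrite -Er EB -Eq {1}(divp_eq r q) addrC addKr.
  have Jh : J (of_uni (G' - B * G)).
    have -> : of_uni (G' - B * G) = of_uni G' + - of_uni B * of_uni G.
      rewrite mulNr -[of_uni B * of_uni G](rmorphM (@of_uni K n)).
      exact: of_uni_is_zmod_morphism.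
    exact: (JD _ _ Jg' (JM _ _ JG')).
  rewrite -Er /dvdp; apply: contraT => r0.
  by have := qmin _ Jh; rewrite Eh r0 leqNgt ltn_modp q0 => /(_ isT).
have [x Hx] : exists x, root q x.
  apply: closed_rootP; rewrite Eq; exact: JG.
pose v : 'rV_n.+1 := \row_i if insub (val i) is Some j then a 0 j else x.
exists v => g Jg; have [G' EG'] : exists G', G' = muni g := ex_intro _ _ erefl.
rewrite meval_muni -EG'.
have -> : v 0 ord_max = x by rewrite mxE insubF //= ltnn.
have -> : map_poly (meval (fun i => v 0 (widen_ord (leqnSn n) i))) G' = ev G'.
  rewrite Eev; apply: eq_map_poly => p; apply: meval_eq => i.
  by rewrite mxE /= insubT //= => H; congr (a 0 _); apply: val_inj.
have JG'' : J (of_uni G') by rewrite EG' muniK.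
by have /dvdpP [r ->] := dvd_q _ JG''; rewrite hornerM (rootP Hx) mulr0.
Qed.

(** By induction on the number of variables: after a linear change a nonzero ideal contains an
    element monic in the last variable, and a common zero of the elimination ideal lifts by
    [ideal_zero_lift]. *)
Lemma nullstellensatz n (I : {mpoly K[n]} -> Prop) :
  is_ideal I -> ~ I 1 -> exists v : 'rV_n, forall f, I f -> f.@[v 0] = 0.
Proof.
elim: n I => [|n IH] I [I0 ID IM] I1.
  exists 0 => f If; rewrite -(mpolyKC f) mevalC; apply/eqP; apply: contra_notT I1 => c0.
  by have := IM (f@_0)^-1%:MP _ If; rewrite -{2}(mpolyKC f) -mpolyCM mulVf.
have [If|] := classic (forall f, I f -> f = 0).
  by exists 0 => f /If ->; rewrite meval0.
move=> /not_all_ex_not [f Hf]; have [If /eqP f0] := imply_to_and _ _ Hf.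
have [M uM [c c0 [sg lg]]] := monic_coordinates f0.
pose J g := I (lsub (invmx M) g).
have Jsub g : I g -> J (lsub M g) by rewrite /J lsubA mulVmx // lsub1.
suff [v Hv] : exists v : 'rV_n.+1, forall g, J g -> g.@[v 0] = 0.
  by exists (v *m M) => g /Jsub/Hv; rewrite meval_lsub.
have J0 : J 0 by rewrite /J rmorph0.
have JD g h : J g -> J h -> J (g + h) by rewrite /J rmorphD; apply: ID.
have JM h g : J g -> J (h * g) by rewrite /J rmorphM; apply: IM.
have J1 : ~ J 1 by rewrite /J rmorph1.
have [||a Ha] := IH (fun h => J (mwiden h)).
- split=> [|g h|h g]; first by rewrite mwiden0.
  + by rewrite mwidenD; apply: JD.
  + by rewrite mwidenM; apply: JM.
- by rewrite mwiden1.
apply: (@ideal_zero_lift n J (muni (lsub M f)) c a) => //.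
by rewrite muniK; apply: Jsub.
Qed.
End Nullstellensatz.

(** * Algebraic dependence modulo an ideal *)

Section Counting.
Variable K : fieldType.

Lemma linear_dependence (A W : finType) (c : A -> W -> K) : (#|W| < #|A|)%N ->
  exists v : A -> K, (exists a, v a != 0) /\ forall w, \sum_a v a * c a w = 0.
Proof.
move=> lt_WA; pose C : 'M[K]_(#|A|, #|W|) := \matrix_(i, j) c (enum_val i) (enum_val j).
have : kermx C != 0.
  by rewrite kermx_eq0 /row_free neq_ltn (leq_ltn_trans (rank_leq_col C)).
case/rowV0Pn => u /sub_kermxP uC u0.
exists (fun a => u 0 (enum_rank a)); split.
  apply: NNPP => H; case/eqP: u0; apply/rowP => i; rewrite mxE.
  by apply/eqP; apply: contra_notT H => Hi; exists (enum_val i); rewrite enum_valK.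
move=> w; have := congr1 (fun B : 'M_(_, _) => B 0 (enum_rank w)) uC.
rewrite !mxE => E; rewrite -[RHS]E (reindex (fun i : 'I_#|A| => enum_val i)) /=; last first.
  by exists enum_rank => x _; rewrite ?enum_valK ?enum_rankK.
by apply: eq_bigr => i _; rewrite enum_valK mxE enum_rankK.
Qed.

Variable r : nat.
Implicit Types (f h : {mpoly K[r]}).

Lemma msizeM_leq f h a b : (msize f <= a.+1)%N -> (msize h <= b.+1)%N ->
  (msize (f * h) <= (a + b).+1)%N.
Proof.
have [->|f0] := eqVneq f 0; first by rewrite mul0r msize0.
have [->|h0] := eqVneq h 0; first by rewrite mulr0 msize0.
rewrite msizeM //; move: f0 h0; rewrite -!msize_poly_eq0.
by move: (msize f) (msize h) => x y; lia.
Qed.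

Lemma msizeX_leq f a n : (msize f <= a.+1)%N -> (msize (f ^+ n) <= (n * a).+1)%N.
Proof.
move=> Hf; elim: n => [|n IH]; first by rewrite expr0 msize1.
by rewrite exprS mulSn; apply: msizeM_leq.
Qed.

Lemma msize_prod_leq (J : finType) (q : J -> {mpoly K[r]}) (a : J -> nat) :
  (forall j, (msize (q j) <= (a j).+1)%N) -> (msize (\prod_j q j) <= (\sum_j a j).+1)%N.
Proof.
move=> H; elim/big_rec2: _ => [|j n p _ Hp]; first by rewrite msize1.
exact: msizeM_leq.
Qed.

Lemma is_ideal_sum (I : {mpoly K[r]} -> Prop) (J : finType) (q : J -> {mpoly K[r]}) :
  is_ideal I -> (forall j, I (q j)) -> I (\sum_j q j).
Proof. by move=> [I0 ID _] H; elim/big_rec: _ => // j p _; apply: ID. Qed.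

Lemma mmap_rmorphE (S : comNzRingType) n (q : 'I_n -> S) (f : {rmorphism K -> S})
    (J : finType) (c : J -> K) (m : J -> 'X_{1..n}) :
  mmap f q (\sum_j c j *: 'X_[m j]) = \sum_j f (c j) * \prod_i q i ^+ m j i.
Proof.
by rewrite raddf_sum; apply: eq_bigr => j _ /=; rewrite mmapZ mmapX.
Qed.

Section Dependence.
Variables (I : {mpoly K[r]} -> Prop) (k : nat) (g : 'I_k -> {mpoly K[r]}).
Variables (M : 'I_r -> nat) (b : 'I_r -> 'I_k -> {mpoly K[r]}).
Hypothesis idI : is_ideal I.
Hypothesis Mb : forall i j, (msize (b i j) <= M i)%N.
Hypothesis MI : forall i, I ('X_i ^+ M i - \sum_j b i j * g j).

(** A monomial of degree at least [N] has an exponent that reaches [M i], so [MI] can rewrite it.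
    [W D] indexes the products of powers at most [D] of the [g j] by monomials of degree below [N],
    and [Sp D] is their span modulo [I]. *)
Let N := (\sum_i M i).+1.
Let W D := ({ffun 'I_k -> 'I_D.+1} * 'X_{1..r < N})%type.
Let u D (w : W D) : {mpoly K[r]} := (\prod_j g j ^+ w.1 j) * 'X_[bmnm w.2].
Let Sp D f := exists c : W D -> K, I (f - \sum_w c w *: u w).

Let SpD D f h : Sp D f -> Sp D h -> Sp D (f + h).
Proof.
move=> [c Hc] [e He]; exists (fun w => c w + e w).
have -> : \sum_w (c w + e w) *: u w = \sum_w c w *: u w + \sum_w e w *: u w.
  by rewrite -big_split; apply: eq_bigr => w _; rewrite scalerDl.
have [_ ID _] := idI; have := ID _ _ Hc He; congr I; ring.
Qed.

Let SpZ D x f : Sp D f -> Sp D (x *: f).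
Proof.
move=> [c Hc]; exists (fun w => x * c w).
have -> : \sum_w (x * c w) *: u w = x *: \sum_w c w *: u w.
  by rewrite scaler_sumr; apply: eq_bigr => w _; rewrite scalerA.
by have [_ _ IM] := idI; rewrite -scalerBr -mul_mpolyC; apply: IM.
Qed.

Let Sp0 D : Sp D 0.
Proof.
exists (fun=> 0); rewrite big1 ?subr0 => [|w _]; first by case: idI.
by rewrite scale0r.
Qed.

Let Sp_sum D (T : Type) (s : seq T) (q : T -> {mpoly K[r]}) :
  (forall j, Sp D (q j)) -> Sp D (\sum_(j <- s) q j).
Proof. by move=> H; elim/big_rec: _ => // j p _; apply: SpD. Qed.

Let SpI D f h : I (f - h) -> Sp D h -> Sp D f.
Proof.
move=> Hfh [c Hc]; exists c; have [_ ID _] := idI.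
by have := ID _ _ Hfh Hc; congr I; ring.
Qed.

(** The [b i j] have degree below [M i], so rewriting ['X_i ^+ M i] by [MI] trades at least one
    degree in the variables for one more factor [g j]. The bound by [D] is preserved while the
    degree in the variables drops. *)
Let Sp_monomial D (ga : 'I_k -> nat) (al : 'X_{1..r}) :
  (forall j, (ga j + mdeg al <= D)%N) -> Sp D ((\prod_j g j ^+ ga j) * 'X_[al]).
Proof.
have [n] := ubnP (mdeg al); elim: n ga al => // n IH ga al lt_n Hle.
have [lt_al|le_al] := ltnP (mdeg al) N.
  have [w Hw] : exists w : W D, u w = (\prod_j g j ^+ ga j) * 'X_[al].
    exists ([ffun j => inord (ga j)], BMultinom lt_al); rewrite /u /=; congr (_ * _).
    apply: eq_bigr => j _; rewrite ffunE inordK // ltnS (leq_trans _ (Hle j)) //.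
    exact: leq_addr.
  exists (fun w' => (w' == w)%:R); rewrite -Hw (bigD1 w) // eqxx scale1r.
  rewrite big1 => [|w' /andP[_ /negPf->]]; last by rewrite scale0r.
  by rewrite [_ (u w) 0]addr0 subrr; case: idI.
have [i le_i] : exists i, (M i <= al i)%N.
  apply: NNPP => H; move: le_al; rewrite leqNgt => /negP; apply.
  rewrite /N ltnS mdegE; apply: leq_sum => i _; apply: ltnW; rewrite ltnNge.
  by apply/negP => Hi; apply: H; exists i.
pose al' := (al - U_(i) *+ M i)%MM.
have Eal : al = (al' + U_(i) *+ M i)%MM.
  rewrite submK //; apply/mnm_lepP => j; rewrite mulmnE mnm1E.
  by case: eqP => [<-|_]; rewrite ?mul1n.
have dal : (mdeg al = mdeg al' + M i)%N by rewrite {1}Eal mdegD mdegMn mdeg1 mul1n.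
set G := \prod_j g j ^+ ga j.
apply: (@SpI _ _ (\sum_j \sum_(m <- msupp (b i j)) (b i j)@_m *: (G * g j * 'X_[al' + m]))).
  have [_ _ IM] := idI; have := IM (G * 'X_[al']) _ (MI i); congr I.
  rewrite mulrBr {1}Eal mpolyXD mpolyXn mulrA; congr (_ - _).
  rewrite mulr_sumr; apply: eq_bigr => j _.
  rewrite [in LHS](mpolyE (b i j)) mulr_suml mulr_sumr; apply: eq_bigr => m _.
  by rewrite mpolyXD -scalerAl -scalerAr; congr (_ *: _); ring.
apply: Sp_sum => j; apply: (big_ind (Sp D)) => [||m _]; [exact: Sp0|exact: SpD|].
have [hm|/memN_msupp_eq0->] := boolP (m \in msupp (b i j)); last first.
  by rewrite scale0r; apply: Sp0.
have lt_m : (mdeg m < M i)%N by apply: leq_trans (msize_mdeg_lt hm) (Mb i j).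
apply: SpZ; have -> : G * g j = \prod_l g l ^+ (ga l + (l == j)).
  rewrite /G (bigD1 j) //= [RHS](bigD1 j) //= eqxx addn1 exprSr -!mulrA; congr (_ * _).
  rewrite mulrC; congr (_ * _); apply: eq_bigr => l /negPf ->.
  by rewrite addn0.
apply: IH => [|l]; first by rewrite mdegD; lia.
by have := Hle l; rewrite mdegD; case: (l == j); lia.
Qed.

Let Sp_size D f : (msize f <= D.+1)%N -> Sp D f.
Proof.
move=> sf; rewrite [f]mpolyE big_seq; apply: (big_ind (Sp D)) => [||m hm].
- exact: Sp0.
- exact: SpD.
apply: SpZ; rewrite -['X_[m]]mul1r; have -> : 1 = \prod_j g j ^+ 0 by rewrite big1.
apply: Sp_monomial => j; rewrite add0n.
by have := leq_trans (msize_mdeg_lt hm) sf.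
Qed.

(* Monomials of degree at most t in each of k+1 elements number (t+1)^(k+1),
   while modulo I they lie in a space of dimension O(t^k). *)
Lemma algebraic_dependence (q : 'I_k.+1 -> {mpoly K[r]}) :
  exists2 Phi : {mpoly K[k.+1]}, Phi != 0 & I (mmap (@mpolyC r K) q Phi).
Proof.
pose E := (\max_i msize (q i))%N.
have qE i : (msize (q i) <= E.+1)%N.
  by apply: leqW; apply: (leq_bigmax (F := fun i => msize (q i))).
pose rho := #|{: 'X_{1..r < N}}|.
(* [D] bounds the degree of a monomial with exponents at most [t] in the [q i], and
   [D.+1 <= (k.+1 * E).+1 * t.+1]. With this [t] there are at most [t * t.+1 ^ k] spanning elements
   for [t.+1 ^ k.+1] monomials. *)
pose t := (rho * (k.+1 * E).+1 ^ k)%N.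
pose D := (k.+1 * E * t)%N.
pose A : finType := {ffun 'I_k.+1 -> 'I_t.+1}.
have cardWA : (#|{: W D}| < #|{: A}|)%N.
  rewrite card_prod !card_ffun !card_ord -/rho [(t.+1 ^ _.+1)%N]expnS.
  apply: (@leq_ltn_trans (t * t.+1 ^ k)%N); last first.
    by rewrite ltn_pmul2r // expn_gt0.
  have le_D : (D.+1 <= (k.+1 * E).+1 * t.+1)%N.
    have H (x y : nat) : ((x * y).+1 <= x.+1 * y.+1)%N by nia.
    exact: H.
  have : (D.+1 ^ k <= ((k.+1 * E).+1 * t.+1) ^ k)%N.
    have [E0|k0] := posnP k; last by rewrite leq_exp2r.
    by rewrite [X in (_ ^ X <= _)%N]E0 [X in (_ <= _ ^ X)%N]E0.
  by rewrite expnMn /t => H; rewrite mulnC -mulnA leq_mul2l H orbT.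
pose Q (a : A) := \prod_i q i ^+ a i.
have HQ a : Sp D (Q a).
  apply: Sp_size; apply: leq_trans (msize_prod_leq (fun i => msizeX_leq (a i) (qE i))) _.
  rewrite ltnS; apply: (@leq_trans (\sum_(i < k.+1) t * E)%N).
    by apply: leq_sum => i _; rewrite leq_mul2r -ltnS ltn_ord orbT.
  by rewrite sum_nat_const card_ord /D; nia.
have [c Hc] : exists c : A -> W D -> K, forall a, I (Q a - \sum_w c a w *: u w).
  exists (fun a => epsilon (inhabits (fun=> 0)) (fun c => I (Q a - \sum_w c w *: u w))).
  move=> a; exact: (epsilon_spec (inhabits (fun=> 0))
    (fun c => I (Q a - \sum_w c w *: u w)) (HQ a)).
have [v [[a0 Ha0] Hv]] := linear_dependence c cardWA.
pose mon (a : A) : 'X_{1..k.+1} := [multinom (a i : nat) | i < k.+1].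
have mon_inj : injective mon.
  move=> a a' /mnmP H; apply/ffunP => i; apply: val_inj.
  by have := H i; rewrite !mnmE.
exists (\sum_a v a *: 'X_[mon a]).
  apply: contraNneq Ha0 => /(congr1 (mcoeff (mon a0))).
  rewrite mcoeff0 raddf_sum /= (bigD1 a0) //= mcoeffZ mcoeffX eqxx mulr1.
  rewrite big1 ?addr0 => [->//|a /negPf na].
  by rewrite mcoeffZ mcoeffX (inj_eq mon_inj) na mulr0.
rewrite mmap_rmorphE.
have -> : \sum_a (v a)%:MP * \prod_i q i ^+ mon a i = \sum_a v a *: (Q a - \sum_w c a w *: u w).
  have E0 : \sum_a v a *: (\sum_w c a w *: u w) = 0.
    under eq_bigr do rewrite scaler_sumr.
    rewrite exchange_big big1 //= => w _.
    under eq_bigr do rewrite scalerA.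
    by rewrite -scaler_suml Hv scale0r.
  under [RHS]eq_bigr do rewrite scalerBr.
  rewrite sumrB E0 subr0; apply: eq_bigr => a _; rewrite mul_mpolyC.
  by congr (_ *: _); apply: eq_bigr => i _; rewrite mnmE.
apply: is_ideal_sum => // a; rewrite -mul_mpolyC.
by have [_ _ IM] := idI; apply: IM.
Qed.
End Dependence.
End Counting.

(** * Closed sets and their dimension *)

Section Closed.
Variables (K : closedFieldType) (r : nat).
Implicit Types (Y Z C D : pset K r) (f g : {mpoly K[r]}).

Lemma closed_neq0 Z x : zariski_closed Z -> Z x -> x != 0.
Proof. by move=> [S [_ HZ]] /HZ []. Qed.

Lemma closed_scale Z x c : zariski_closed Z -> c != 0 -> Z x -> Z (c *: x).
Proof.
move=> [S [HS HZ]] c0 /HZ [x0 Hx]; apply/HZ; split.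
  by rewrite scaler_eq0 negb_or c0.
move=> g Sg; have [d Hg] := HS g Sg.
by rewrite (meval_scale _ _ Hg) Hx // mulr0.
Qed.

Lemma closed_full : zariski_closed (fun x : 'rV[K]_r => x != 0).
Proof. by exists (fun=> False); split=> // x; split=> [->|[]]. Qed.

Lemma closed_cap Z1 Z2 : zariski_closed Z1 -> zariski_closed Z2 ->
  zariski_closed (fun x => Z1 x /\ Z2 x).
Proof.
move=> [S1 [HS1 H1]] [S2 [HS2 H2]]; exists (fun g => S1 g \/ S2 g); split.
  by move=> g [/HS1|/HS2].
move=> x; split=> [[/H1[x0 Hx1] /H2[_ Hx2]]|[x0 H]].
  by split=> // g [/Hx1|/Hx2].
by split; [apply/H1 | apply/H2]; split=> // g Sg; apply: H; [left|right].
Qed.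

Lemma closed_form Z d f : f \is d.-homog -> zariski_closed Z ->
  zariski_closed (fun x => Z x /\ f.@[x 0] = 0).
Proof.
move=> hf cZ; have [S [HS HZ]] := cZ; exists (fun g => S g \/ g = f); split.
  by move=> g [/HS//|->]; exists d.
move=> x; split=> [[/HZ [x0 Hx] fx]|[x0 H]].
  by split=> // g [/Hx//|->].
by split; [apply/HZ; split=> // g Sg; apply: H; left | apply: H; right].
Qed.

Lemma closed_zeros d f : f \is d.-homog -> zariski_closed (zeros f).
Proof.
move=> hf; exists (fun g => g = f); split=> [g ->|x]; first by exists d.
split=> [[x0 fx]|[x0 H]]; first by split=> // g ->.
by split=> //; apply: H.
Qed.

Lemma form_outside Z x : zariski_closed Z -> x != 0 -> ~ Z x ->
  exists d f, [/\ f \is d.-homog, f.@[x 0] != 0 & forall z, Z z -> f.@[z 0] = 0].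
Proof.
move=> [S [HS HZ]] x0 nZ; apply: NNPP => H; apply: nZ; apply/HZ; split=> // g Sg.
have [d hg] := HS g Sg; apply/eqP; apply: contra_notT H => gx; exists d, g; split=> //.
by move=> z /HZ [_]; apply.
Qed.

(** A strictly decreasing sequence of closed sets yields polynomials, each vanishing on the next set
    but not at some point of the current one. At that point all the earlier polynomials vanish, so
    none is a combination of its predecessors, against [mpoly_noetherian]. *)
Lemma closed_noetherian_ind (P : pset K r -> Prop) :
  (forall Y, zariski_closed Y ->
     (forall Z, zariski_closed Z -> psubset Z Y -> ~ psubset Y Z -> P Z) -> P Y) ->
  forall Y, zariski_closed Y -> P Y.
Proof.
move=> IH Y0 cY0; apply: NNPP => nP0.
pose bad Y := zariski_closed Y /\ ~ P Y.
have step Y : bad Y -> exists Z, [/\ bad Z, psubset Z Y & ~ psubset Y Z].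
  move=> [cY nP]; apply: NNPP => H; apply: nP; apply: IH => // Z cZ sZY nYZ.
  by apply: NNPP => nPZ; apply: H; exists Z.
pose next Y := epsilon (inhabits Y) (fun Z => [/\ bad Z, psubset Z Y & ~ psubset Y Z]).
have nextP Y : bad Y -> [/\ bad (next Y), psubset (next Y) Y & ~ psubset Y (next Y)].
  by move=> bY; exact: (epsilon_spec (inhabits Y) _ (step Y bY)).
pose s n := iter n next Y0.
have bs n : bad (s n) by elim: n => // n /nextP [].
have sle m n : (m <= n)%N -> psubset (s n) (s m).
  elim: n => [|n IHn]; first by rewrite leqn0 => /eqP-> x.
  rewrite leq_eqVlt => /orP[/eqP-> x //|le_m] x sx; apply: IHn => //.
  by have [_ H _] := nextP _ (bs n); apply: H.
have wit n : exists fy : {mpoly K[r]} * 'rV[K]_r,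
    [/\ s n fy.2, fy.1.@[fy.2 0] != 0 & forall z, s n.+1 z -> fy.1.@[z 0] = 0].
  have [_ _ /not_all_ex_not [y Hy]] := nextP _ (bs n).
  have [sy nsy] := imply_to_and _ _ Hy.
  have y0 : y != 0 by apply: closed_neq0 sy; case: (bs n).
  have [d [f [_ fy Hf]]] := form_outside (proj1 (bs n.+1)) y0 nsy.
  by exists (f, y).
pose w n := epsilon (inhabits (0, 0)) (fun fy : {mpoly K[r]} * 'rV[K]_r =>
    [/\ s n fy.2, fy.1.@[fy.2 0] != 0 & forall z, s n.+1 z -> fy.1.@[z 0] = 0]).
have wP n := epsilon_spec (inhabits (0, 0)) _ (wit n).
have [n [c Hc]] := mpoly_noetherian (fun n => (w n).1).
have [sn /negP + _] := wP n; apply.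
rewrite -/(w n) Hc raddf_sum /= big1 // => i _; rewrite mevalM.
have [_ _ H] := wP i; rewrite -/(w i) in H *.
by rewrite H ?mulr0 //; apply: (sle i.+1 n).
Qed.

Lemma irreducible_components Y : zariski_closed Y ->
  exists m (C : nat -> pset K r), (forall i, (i < m)%N -> irreducible_closed (C i)) /\
    forall x, Y x <-> exists i, (i < m)%N /\ C i x.
Proof.
elim/closed_noetherian_ind => {}Y cY IH.
have [ne|em] := classic (exists x, Y x); last first.
  by exists 0, (fun=> Y); split=> // x; split=> [Yx|[i []//]]; case: em; exists x.
have [irr|nirr] := classic (irreducible_closed Y).
  exists 1, (fun=> Y); split=> // x; split=> [Yx|[i []//]]; by exists 0.
have : exists Z1 Z2, [/\ zariski_closed Z1, zariski_closed Z2,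
    forall x, Y x -> Z1 x \/ Z2 x, ~ psubset Y Z1 & ~ psubset Y Z2].
  apply: NNPP => H; apply: nirr; split=> // Z1 Z2 c1 c2 HY.
  by apply: NNPP => /not_or_and [n1 n2]; apply: H; exists Z1, Z2.
move=> [Z1 [Z2 [c1 c2 HY n1 n2]]].
have [||m1 [C1 [i1 E1]]] := IH (fun x => Y x /\ Z1 x) (closed_cap cY c1).
- by move=> x [].
- by move=> H; apply: n1 => x /H [].
have [||m2 [C2 [i2 E2]]] := IH (fun x => Y x /\ Z2 x) (closed_cap cY c2).
- by move=> x [].
- by move=> H; apply: n2 => x /H [].
exists (m1 + m2)%N, (fun i => if (i < m1)%N then C1 i else C2 (i - m1)%N); split.
  move=> i lt_i; case: ltnP => [lt1|le1]; first exact: i1.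
  by apply: i2; rewrite ltn_subLR.
move=> x; split=> [Yx|[i [lt_i]]].
  have [Z1x|Z2x] := HY x Yx.
    have [i [lt_i Ci]] := (E1 x).1 (conj Yx Z1x); exists i.
    by rewrite lt_i (leq_trans lt_i (leq_addr _ _)).
  have [i [lt_i Ci]] := (E2 x).1 (conj Yx Z2x); exists (m1 + i)%N.
  have -> : (m1 + i < m1)%N = false by lia.
  by rewrite addKn ltn_add2l.
case: ltnP => [lt1|le1] Hx; first by have [] := (E1 x).2 (ex_intro _ i (conj lt1 Hx)).
have lt2 : (i - m1 < m2)%N by rewrite ltn_subLR.
by have [] := (E2 x).2 (ex_intro _ (i - m1)%N (conj lt2 Hx)).
Qed.

Lemma closed_cup Z1 Z2 : zariski_closed Z1 -> zariski_closed Z2 ->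
  zariski_closed (fun x => Z1 x \/ Z2 x).
Proof.
move=> c1 c2; have [S1 [HS1 H1]] := c1; have [S2 [HS2 H2]] := c2.
exists (fun g => exists g1 g2, [/\ S1 g1, S2 g2 & g = g1 * g2]); split.
  move=> g [g1 [g2 [/HS1 [d1 h1] /HS2 [d2 h2] ->]]]; exists (d1 + d2)%N.
  exact: dhomogM.
move=> x; split=> [Hx|[x0 Hx]].
  split; first by case: Hx; [apply: (closed_neq0 c1)|apply: (closed_neq0 c2)].
  move=> g [g1 [g2 [s1 s2 ->]]]; rewrite mevalM.
  case: Hx => [/H1|/H2] [_ Hx]; first by rewrite (Hx g1) ?mul0r.
  by rewrite (Hx g2) ?mulr0.
have [Z1x|nZ1] := classic (Z1 x); [by left | right; apply/H2; split=> // g2 s2].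
apply: NNPP => /eqP g2x; apply: nZ1; apply/H1; split=> // g1 s1.
have := Hx (g1 * g2); rewrite mevalM => H.
have /eqP := H (ex_intro _ g1 (ex_intro _ g2 (And3 s1 s2 erefl))).
by rewrite mulf_eq0 (negPf g2x) orbF => /eqP.
Qed.

Lemma closed_empty : zariski_closed (fun _ : 'rV[K]_r => False).
Proof.
exists (fun g => g = 1); split=> [g ->|x]; first by exists 0; apply: dhomog1.
by split=> // [[_ /(_ 1 erefl)/eqP]]; rewrite meval1 oner_eq0.
Qed.

Lemma irreducible_cover C m (D : nat -> pset K r) : irreducible_closed C ->
  (forall i, (i < m)%N -> zariski_closed (D i)) ->
  (forall x, C x -> exists i, (i < m)%N /\ D i x) ->
  exists i, (i < m)%N /\ psubset C (D i).
Proof.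
move=> [cC [x0 Cx0] HC] cD cov.
have cU k : (k <= m)%N -> zariski_closed (fun x => exists i, (i < k)%N /\ D i x).
  elim: k => [|k IH] le_k.
    have [S [HS HZ]] := closed_empty; exists S; split=> // x; rewrite -HZ.
    by split=> // [[i []]].
  have [S [HS HZ]] := closed_cup (IH (ltnW le_k)) (cD k le_k).
  exists S; split=> // x; rewrite -HZ; split=> [[i [lt_i Di]]|[[i [lt_i Di]]|Dk]].
  - move: lt_i Di; rewrite ltnS leq_eqVlt => /orP[/eqP->|lt_i Di]; first by right.
    by left; exists i.
  - by exists i; split=> //; apply: leqW.
  - by exists k.
have : forall k, (k <= m)%N -> psubset C (fun x => exists i, (i < k)%N /\ D i x) ->
    exists i, (i < k)%N /\ psubset C (D i).
  elim=> [|k IH] le_k H; first by have [i []] := H x0 Cx0.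
  have [|Hk|Hk] := HC _ _ (cU k (ltnW le_k)) (cD k le_k).
  - move=> x /H [i [+ Di]]; rewrite ltnS leq_eqVlt => /orP[/eqP Ei|lt_i].
      by right; rewrite -Ei.
    by left; exists i.
  - have [i [lt_i Hi]] := IH (ltnW le_k) Hk; by exists i; split=> //; apply: leqW.
  - by exists k.
by apply.
Qed.
End Closed.

(** * Dimension as the number of forms needed to have no common zero *)

Section KillNumber.
Variables (K : closedFieldType) (r : nat).
Implicit Types (Y Z C D : pset K r) (f : {mpoly K[r]}).

(** With a common degree, linear combinations of the [g j] are again forms, and scaling [x]
    multiplies the vector of their values by a single scalar. *)
Definition killed_by k (del : nat) (g : 'I_k -> {mpoly K[r]}) Y : Prop :=
  [/\ (0 < del)%N, forall j, g j \is del.-homog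
    & forall x, Y x -> ~ forall j, (g j).@[x 0] = 0].

(* For Y closed, the least such k is dim Y + 1. *)
Definition killed k Y : Prop := exists del (g : 'I_k -> {mpoly K[r]}), killed_by del g Y.

Lemma killed_sub k Y Z : psubset Z Y -> killed k Y -> killed k Z.
Proof. by move=> sZY [del [g [d0 hg Hg]]]; exists del, g; split=> // x /sZY/Hg. Qed.

Lemma killed0 Y : killed 0 Y <-> forall x, ~ Y x.
Proof.
split=> [[del [g [_ _ H]]] x /H nH|H]; first by apply: nH => -[].
by exists 1%N, (fun=> 0); split=> // [j|x /H//]; apply: dhomog0.
Qed.

Lemma killed_cut k Y e f : (0 < e)%N -> f \is e.-homog ->
  killed k (fun x => Y x /\ f.@[x 0] = 0) -> killed k.+1 Y.
Proof.
move=> e0 hf [del [g [d0 hg Hg]]].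
exists (del * e)%N, (fun j => if unlift ord0 j is Some i then g i ^+ e else f ^+ del); split.
- by rewrite muln_gt0 d0.
- move=> j; case: unliftP => [i _|_]; first exact: dhomogMn.
  by rewrite mulnC; apply: dhomogMn.
- move=> x Yx H; have fx : f.@[x 0] = 0.
    have := H ord0; rewrite unlift_none rmorphXn /= => /eqP.
    by rewrite expf_eq0 d0 => /eqP.
  apply: (Hg x) => // i; have := H (lift ord0 i); rewrite liftK rmorphXn /= => /eqP.
  by rewrite expf_eq0 e0 => /eqP.
Qed.

(** The Nullstellensatz on the slice [x_i = 1] of the cone over [Y] writes 1 as a combination of the
    [g j], and powers of ['X_i] make this homogeneous. The coordinate ring of [Y] is thus finite
    over the [g j], in the form that [algebraic_dependence] takes. *)
Lemma killed_power k del (g : 'I_k -> {mpoly K[r]}) Y : zariski_closed Y ->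
  killed_by del g Y -> forall i : 'I_r, exists M (b : 'I_k -> {mpoly K[r]}),
   (forall j, (msize (b j) <= M)%N) /\
   forall x, Y x -> ('X_i ^+ M - \sum_j b j * g j).@[x 0] = 0.
Proof.
move=> cY [d0 hg Hg] i.
pose I f := exists (b : 'I_k -> {mpoly K[r]}) e, forall x, Y x ->
  f.@[x 0] = \sum_j (b j).@[x 0] * (g j).@[x 0] + e.@[x 0] * (x 0 i - 1).
have I_mem f : (forall x, Y x -> f.@[x 0] = 0) -> I f.
  move=> Hf; exists (fun=> 0), 0 => x /Hf ->.
  by rewrite big1 ?meval0 ?mul0r ?addr0 // => j _; rewrite mul0r.
have idI : is_ideal I.
  split; first by apply: I_mem => x _; rewrite meval0.
    move=> f h [b [e Hf]] [b' [e' Hh]]; exists (fun j => b j + b' j), (e + e') => x Yx.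
    rewrite !mevalD Hf // Hh // mulrDl addrACA -big_split; congr (_ + _).
    by apply: eq_bigr => j _; rewrite mevalD mulrDl.
  move=> h f [b [e Hf]]; exists (fun j => h * b j), (h * e) => x Yx.
  rewrite !mevalM Hf // mulrDr mulr_sumr mulrA; congr (_ + _).
  by apply: eq_bigr => j _; rewrite mevalM mulrA.
have [b [e Hbe]] : I 1.
  apply: NNPP => /(nullstellensatz idI) [v Hv].
  have vi : v 0 i = 1.
    have : I ('X_i - 1).
      exists (fun=> 0), 1 => x _; rewrite mevalB meval1 mevalXU big1 ?add0r ?mul1r // => j _.
      by rewrite meval0 mul0r.
    by move/Hv; rewrite mevalB meval1 mevalXU => /eqP; rewrite subr_eq0 => /eqP.
  have Yv : Y v.
    apply: NNPP; have v0 : v != 0.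
      by apply: contraTneq isT => v0; move: vi; rewrite v0 mxE => /eqP; rewrite eq_sym oner_eq0.
    move=> /(form_outside cY v0) [d' [f [_ fv Hf]]].
    by rewrite Hv ?eqxx // in fv; apply: I_mem.
  apply: (Hg v Yv) => j; apply: Hv; exists (fun l => (l == j)%:R), 0 => x _.
  rewrite (bigD1 j) //= eqxx meval1 mul1r meval0 mul0r addr0 big1 ?addr0 // => l /negPf->.
  by rewrite meval0 mul0r.
pose B := (\max_j msize (b j))%N.
(* Every homogeneous part of [b j] is padded by a positive power of ['X_i] up to degree [M - del],
   which is below [M] since [del] is positive. Where [x_i = 0] both sides of the relation vanish. *)
pose M := (del + B).+1.
pose b' j := \sum_(d < B) homog_part d (b j) * 'X_i ^+ (M - del - d).
exists M, b'; split=> [j|x Yx].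
  apply: leq_trans (msize_sum _ _ _) _; apply/bigmax_leqP => d _.
  have hX : ('X_i : {mpoly K[r]}) ^+ (M - del - d) \is (M - del - d).-homog.
    by have := @dhomogMn r K mdeg 1 'X_i (M - del - d); rewrite mul1n; apply; rewrite dhomogX /= mdeg1.
  have hh := dhomogM (pihomogP mdeg d (b j)) hX.
  have [->|n0] := eqVneq (homog_part d (b j) * 'X_i ^+ (M - del - d)) 0; first by rewrite msize0.
  have /= E := dhomog_mf hh (mlead_supp n0).
  rewrite -(mlead_deg n0) E; have := ltn_ord d; rewrite /M; lia.
rewrite mevalB rmorphXn /= mevalXU; apply/eqP; rewrite subr_eq0; apply/eqP.
have Eb j : (b' j).@[x 0] = \sum_(d < B) (homog_part d (b j)).@[x 0] * x 0 i ^+ (M - del - d).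
  by rewrite raddf_sum /=; apply: eq_bigr => d _; rewrite mevalM rmorphXn /= mevalXU.
rewrite raddf_sum /=; under eq_bigr do rewrite mevalM Eb.
have [xi|xi] := eqVneq (x 0 i) 0.
  rewrite xi expr0n /= big1 // => j _; rewrite big1 ?mul0r // => d _.
  by rewrite expr0n; have := ltn_ord d; case: eqP; rewrite ?mulr0 // /M; lia.
pose y := (x 0 i)^-1 *: x.
have Yy : Y y by apply: closed_scale cY _ Yx; rewrite invr_eq0.
have yi : y 0 i = 1 by rewrite mxE mulVf.
have := Hbe y Yy; rewrite meval1 yi subrr mulr0 addr0 => E1.
rewrite -[LHS]mulr1 E1 mulr_sumr; apply: eq_bigr => j _.
have -> : (g j).@[x 0] = x 0 i ^+ del * (g j).@[y 0].
  by rewrite (meval_scale _ _ (hg j)) exprVn mulVKf // expf_neq0.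
have -> : (b j).@[y 0] = \sum_(d < B) (homog_part d (b j)).@[x 0] * (x 0 i) ^- d.
  have -> : b j = \sum_(d < B) homog_part d (b j).
    by apply: (@pihomog_partitionE _ _ mdeg); rewrite /B (leq_bigmax (F := fun j => msize (b j))).
  rewrite raddf_sum /=; apply: eq_bigr => d _.
  have -> : homog_part d (\sum_(d0 < B) homog_part d0 (b j)) = homog_part d (b j).
    by congr (homog_part d _); symmetry; apply: (@pihomog_partitionE _ _ mdeg); rewrite /B (leq_bigmax (F := fun j => msize (b j))).
  by rewrite (meval_scale _ _ (pihomogP mdeg d _)) exprVn mulrC.
rewrite mulrA [RHS]mulrA; congr (_ * _).
rewrite mulr_sumr mulr_suml; apply: eq_bigr => d _.
have lt_d := ltn_ord d.
have {1}-> : M = (del + (M - del - d) + d)%N by rewrite /M; lia.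
have : x 0 i ^+ d != 0 by rewrite expf_neq0.
rewrite !exprD; move: (x 0 i ^+ del) (x 0 i ^+ (M - del - d)) (x 0 i ^+ d) (_.@[_]) => u v w y' w0.
by field.
Qed.

Lemma meval_mmap (n : nat) (q : 'I_n -> {mpoly K[r]}) Phi (x : 'rV[K]_r) :
  (mmap (@mpolyC r K) q Phi).@[x 0] = Phi.@[fun i => (q i).@[x 0]].
Proof.
apply: (@eq_mpoly_rmorph K n K (meval (x 0) \o mmap (@mpolyC r K) q)
  (meval (fun i => (q i).@[x 0]))) => /= [c|i]; first by rewrite mmapC !mevalC.
by rewrite mmapX mmap1U mevalXU.
Qed.

(** The coordinate ring of [Y] is finite over the subring of [k] killing forms, so its transcendence
    degree is at most [k]. *)
Lemma killed_dependence k Y (q : 'I_k.+1 -> {mpoly K[r]}) : zariski_closed Y -> killed k Y ->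
  exists2 Phi : {mpoly K[k.+1]}, Phi != 0 &
    forall x, Y x -> Phi.@[fun i => (q i).@[x 0]] = 0.
Proof.
move=> cY [del [g Hg]]; pose I f := forall x, Y x -> f.@[x 0] = 0.
have idI : is_ideal I.
  split=> [x _|f h Hf Hh x Yx|h f Hf x Yx]; first by rewrite meval0.
    by rewrite mevalD Hf // Hh // addr0.
  by rewrite mevalM Hf // mulr0.
pose Q i Mb := (forall j, (msize (Mb.2 j) <= Mb.1)%N) /\ I ('X_i ^+ Mb.1 - \sum_j Mb.2 j * g j).
have HQ i : exists Mb, Q i Mb.
  by have [M [b Hb]] := killed_power cY Hg i; exists (M, b).
pose Mb i := epsilon (inhabits (0, fun=> 0)) (Q i).
have HMb i : Q i (Mb i) := epsilon_spec _ _ (HQ i).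
have [Phi Phi0 HPhi] := algebraic_dependence idI (fun i => proj1 (HMb i)) (fun i => proj2 (HMb i)) q.
by exists Phi => // x Yx; rewrite -meval_mmap; apply: HPhi.
Qed.

(** Otherwise [k.+1] of the variables would be algebraically dependent on the whole space. *)
Lemma not_killed_full k : killed k (fun x : 'rV[K]_r => x != 0) -> (r <= k)%N.
Proof.
move=> Hk; rewrite leqNgt; apply/negP => lt_kr.
pose iota (i : 'I_k.+1) : 'I_r := widen_ord lt_kr i.
have [Phi Phi0 HPhi] := killed_dependence (fun i => 'X_(iota i)) (closed_full K r) Hk.
have [|v] := @mpoly_nonzero K _ (Phi * 'X_ord0).
  by rewrite mulf_neq0 // -msize_poly_eq0 msizeX.
rewrite mevalM mevalXU mulf_eq0 negb_or => /andP[/eqP vPhi v0]; apply: vPhi.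
pose x : 'rV[K]_r := \row_j if insub (val j) is Some i then v i else 0.
have Ex i : ('X_(iota i) : {mpoly K[r]}).@[x 0] = v i.
  by rewrite mevalXU mxE /= insubT //= => H; congr (v _); apply: val_inj.
rewrite -(HPhi x); first by apply: meval_eq => i; rewrite Ex.
apply: contraNneq v0 => x0; by rewrite -Ex x0 mevalXU mxE.
Qed.

Lemma linear_form_nonzero (s : seq 'rV[K]_r) : (forall x, x \in s -> x != 0) ->
  exists2 f : {mpoly K[r]}, f \is 1.-homog & forall x, x \in s -> f.@[x 0] != 0.
Proof.
move=> s0; pose T : {mpoly K[r]} := \prod_(x <- s) \sum_j x 0 j *: 'X_j.
have T0 : T != 0.
  rewrite prodf_seq_neq0; apply/allP => x /s0 /= x0.
  have [j xj] : exists j, x 0 j != 0.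
    apply: NNPP => H; case/eqP: x0; apply/rowP => j; rewrite mxE.
    by have [//|Hj] := eqVneq (x 0 j) 0; case: H; exists j.
  apply: contraNneq xj => /(congr1 (mcoeff U_(j)%MM)).
  rewrite mcoeff0 raddf_sum /= (bigD1 j) //= mcoeffZ mcoeffXU eqxx mulr1 big1 ?addr0 => [->//|i /negPf ni].
  by rewrite mcoeffZ mcoeffXU ni mulr0.
have [v Hv] := mpoly_nonzero_row T0.
exists (\sum_j v 0 j *: 'X_j).
  by apply: rpred_sum => j _; apply: dhomogZ; rewrite dhomogX /= mdeg1.
move=> x xs; move: Hv; rewrite /T rmorph_prod /= prodf_seq_neq0 => /allP/(_ x xs) /=.
congr (_ != 0); rewrite !raddf_sum /=; apply: eq_bigr => j _.
by rewrite !mevalZ !mevalXU mulrC.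
Qed.

(** Scaling [z] by a [del]-th root of [c], which [K] contains, multiplies the vector of values by
    [c]. The relation thus holds along a punctured line and splits into homogeneous parts. *)
Lemma relation_homog_part k del (g : 'I_k -> {mpoly K[r]}) (p : {mpoly K[k]}) Z d :
  zariski_closed Z -> (0 < del)%N -> (forall j, g j \is del.-homog) ->
  (forall z, Z z -> p.@[(\row_j (g j).@[z 0]) 0] = 0) ->
  forall z, Z z -> (homog_part d p).@[(\row_j (g j).@[z 0]) 0] = 0.
Proof.
move=> cZ d0 hg pZ z Zz; apply: meval_homog_part => c c0.
have [e' He'] : exists e', e' ^+ del = c.
  have [|e' /rootP] := @closed_rootP K ('X^del - c%:P) _.
    by rewrite size_XnsubC // eqSS -lt0n.
  by rewrite hornerD hornerXn hornerN hornerC => /eqP; rewrite subr_eq0 => /eqP; exists e'.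
have e'0 : e' != 0 by apply: contraNneq c0 => e'0; rewrite -He' e'0 expr0n gtn_eqF.
rewrite -(pZ _ (closed_scale cZ e'0 Zz)); congr (meval _ _); congr (fun_of_matrix _ 0).
by apply/rowP => j; rewrite !mxE (meval_scale _ _ (hg j)) He'.
Qed.

(* A nonzero relation a(g_0, .., g_k) = 0 on Z confines Z, by a linear change of
   the g_j making a monic in the last one, to the locus where k combinations of
   the g_j already cut out nothing. *)
Lemma killed_relation k del (g : 'I_k.+1 -> {mpoly K[r]}) (p : {mpoly K[k.+1]}) Z :
  zariski_closed Z -> killed_by del g Z -> p != 0 ->
  (forall z, Z z -> p.@[(\row_j (g j).@[z 0]) 0] = 0) -> killed k Z.
Proof.
move=> cZ [d0 hg Hg] p0 pZ.
pose gv (x : 'rV[K]_r) : 'rV[K]_k.+1 := \row_j (g j).@[x 0].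
have [d ad] := homog_part_neq0 p0; set a := homog_part d p in ad.
have ha : a \is d.-homog by apply: pihomogP.
have aZ z : Z z -> a.@[(gv z) 0] = 0 by exact: (@relation_homog_part _ _ _ _ _ d cZ d0 hg pZ).
have [|c] := @mpoly_nonzero_row K _ (a * 'X_ord_max).
  by rewrite mulf_neq0 // -msize_poly_eq0 msizeX.
rewrite mevalM mevalXU mulf_eq0 negb_or => /andP[ac cn].
have c0 : c != 0 by apply: contraNneq cn => ->; rewrite mxE.
have [M uM HM] := complete_row ord_max c0.
(* Where all the [g'] vanish, the vector of the [g i] is a multiple [l *: c], at which [a] is
   [l ^+ d] times its nonzero value at [c]; hence [l = 0] and all the [g i] vanish. *)
pose g' (j : 'I_k) := \sum_i (invmx M) i (widen_ord (leqnSn k) j) *: g i.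
exists del, g'; split=> // [j|z Zz Hz].
  by apply: rpred_sum => i _; apply: dhomogZ.
pose l := (gv z *m invmx M) 0 ord_max.
have Egv : gv z = l *: c.
  rewrite -[gv z](mulmxKV uM).
  have -> : gv z *m invmx M = l *: delta_mx 0 ord_max.
    apply/rowP => j; elim/ordS_ind: j => [j|]; last by rewrite [RHS]mxE [X in _ = _ * X]mxE !eqxx mulr1.
    rewrite [RHS]mxE [X in _ = _ * X]mxE [_ == ord_max](_ : _ = false) ?andbF ?mulr0; last first.
      by rewrite -val_eqE /= ltn_eqF.
    rewrite -(Hz j) raddf_sum /= mxE; apply: eq_bigr => i _; rewrite mevalZ mulrC.
    by rewrite [gv z 0 i]mxE.
  by rewrite -scalemxAl -rowE HM.
have l0 : l = 0.
  have := aZ z Zz; rewrite Egv (meval_scale _ _ ha) => /eqP.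
  by rewrite mulf_eq0 (negPf ac) orbF expf_eq0 => /andP[_ /eqP].
apply: (Hg z Zz) => j; have := congr1 (fun v : 'rV_k.+1 => v 0 j) Egv.
by rewrite l0 scale0r !mxE.
Qed.

(** A form [s] vanishing on [Z] but not on [Y] and the killing forms of [Y] satisfy a relation on
    [Y]. As [Y] is irreducible, powers of [s] can be divided out; setting [s = 0] on [Z] then leaves
    a nonzero relation between the killing forms alone. *)
Lemma killed_proper k Y Z : irreducible_closed Y -> zariski_closed Z -> psubset Z Y ->
  ~ psubset Y Z -> killed k.+1 Y -> killed k Z.
Proof.
move=> [cY _ HY] cZ sZY /not_all_ex_not [y Hy] kY.
have [Yy nZy] := imply_to_and _ _ Hy.
have [e [s [hs sy sZ]]] := form_outside cZ (closed_neq0 cY Yy) nZy.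
have [del [g [d0 hg Hg]]] := kY.
pose q (i : 'I_k.+2) := if unlift ord_max i is Some j then g j else s.
have [Phi Phi0 HPhi] := killed_dependence q cY kY.
have [m [p Hp Ep]] := multiplicity_XsubC (muni Phi) 0.
have Phi'0 : muni Phi != 0 by rewrite muni_eq0.
rewrite subr0 in Ep.
have p0 : p`_0 != 0 by move: Hp; rewrite Phi'0 /root -horner_coef0.
pose ev (x : 'rV[K]_r) := meval (fun j => (g j).@[x 0]) : {rmorphism {mpoly K[k.+1]} -> K}.
have Eq (x : 'rV[K]_r) : Phi.@[fun i => (q i).@[x 0]] = (map_poly (ev x) p).[s.@[x 0]] * s.@[x 0] ^+ m.
  rewrite meval_muni /q unlift_none Ep rmorphM /= map_polyXn hornerM hornerXn.
  congr (_.[_] * _); apply: eq_map_poly => u; apply: meval_eq => j.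
  have -> : widen_ord (leqnSn k.+1) j = lift ord_max j.
    by apply: val_inj; rewrite /= /bump leqNgt ltn_ord add0n.
  by rewrite liftK.
pose h := (map_poly (mmap (@mpolyC r K) g) p).[s].
have Eh (x : 'rV[K]_r) : h.@[x 0] = (map_poly (ev x) p).[s.@[x 0]].
  rewrite /h -[LHS]/(meval (x 0) _) -horner_map; congr (_.[_]).
  by rewrite -map_poly_comp; apply: eq_map_poly => u; apply: meval_mmap.
(* [h * s ^+ m] vanishes on [Y] while [s] does not, but [h] need not be homogeneous: irreducibility
   is applied to each of its homogeneous parts. *)
have hY (x : 'rV[K]_r) : Y x -> h.@[x 0] = 0.
  suff H x' : Y x' -> forall d, (homog_part d h).@[x' 0] = 0.
    by move=> Yx; rewrite [h]homog_part_sum raddf_sum big1 // => d _; apply: H.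
  move=> Yx' d.
  have [|H|H] := HY _ _ (closed_form hs cY) (closed_form (pihomogP mdeg d h) cY).
  - move=> z Yz; have [sz|sz] := eqVneq s.@[z 0] 0; [by left|right; split=> //].
    apply: meval_homog_part => c c0; rewrite Eh.
    have := HPhi _ (closed_scale cY c0 Yz); rewrite Eq => /eqP.
    rewrite mulf_eq0 expf_eq0 => /orP[/eqP //|/andP[_]].
    by rewrite (meval_scale _ _ hs) mulf_eq0 expf_eq0 (negPf c0) andbF (negPf sz).
  - by have [_ E] := H y Yy; rewrite E eqxx in sy.
  - by have [_] := H x' Yx'.
apply: (@killed_relation k del g p`_0 Z) => //.
  by split=> // x /sZY; apply: Hg.
move=> z Zz; have := hY z (sZY z Zz); rewrite Eh sZ // horner_coef0 coef_map /= => <-.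
by apply: meval_eq => j; rewrite mxE.
Qed.

(** Forms that kill the components separately do not merge directly. A linear form missing a point
    of each component makes every irreducible subset of the section proper in some component, where
    [killed_proper] saves one form; the induction on [k] then applies to the section. *)
Lemma killed_irreducible k Y : zariski_closed Y ->
  (forall C, irreducible_closed C -> psubset C Y -> killed k C) -> killed k Y.
Proof.
elim: k Y => [|k IH] Y cY H.
  apply/killed0 => x Yx; have [m [C [HC EY]]] := irreducible_components cY.
  have [i [lt_i Cx]] := (EY x).1 Yx.
  have sC : psubset (C i) Y by move=> z Cz; apply/EY; exists i.
  by have /killed0/(_ x) := H _ (HC i lt_i) sC.
have [m [C [HC EY]]] := irreducible_components cY.
pose pt i := epsilon (inhabits 0) (C i).
have ptP i : (i < m)%N -> C i (pt i).
  by move=> /HC [_ [x Cx] _]; exact: (epsilon_spec _ _ (ex_intro _ x Cx)).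
have [|f hf fpt] := @linear_form_nonzero [seq pt i | i <- iota 0 m].
  move=> x /mapP[i]; rewrite mem_iota add0n /= => lt_i ->.
  by have [cC _ _] := HC i lt_i; apply: closed_neq0 cC (ptP i lt_i).
apply: (killed_cut (ltn0Sn 0) hf); apply: IH => [|D irrD sD].
  exact: closed_form hf cY.
have [||i [lt_i Hi]] := @irreducible_cover K r D m C irrD.
- by move=> i /HC [].
- by move=> x /sD [/EY].
apply: (killed_proper (HC i lt_i)) => //; first by case: irrD.
- move=> Hsub; have [_ /eqP] := sD _ (Hsub _ (ptP i lt_i)); apply/negP/fpt.
  by apply/mapP; exists i => //; rewrite mem_iota.
- by apply: H => [|z Cz]; [apply: HC | apply/EY; exists i].
Qed.

(* The points of [s] are chosen one on each irreducible component of [Y]. *)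
Lemma killed_section Y : zariski_closed Y -> exists s : seq 'rV[K]_r,
  (forall x, x \in s -> Y x) /\ forall k d f, f \is d.-homog ->
     (forall x, x \in s -> f.@[x 0] != 0) -> killed k.+1 Y ->
     killed k (fun x => Y x /\ f.@[x 0] = 0).
Proof.
move=> cY; have [m [C [HC EY]]] := irreducible_components cY.
pose pt i := epsilon (inhabits 0) (C i).
have ptP i : (i < m)%N -> C i (pt i).
  by move=> /HC [_ [x Cx] _]; exact: (epsilon_spec _ _ (ex_intro _ x Cx)).
exists [seq pt i | i <- iota 0 m]; split.
  move=> x /mapP[i]; rewrite mem_iota add0n /= => lt_i ->.
  by apply/EY; exists i; split=> //; apply: ptP.
move=> k d f hf fpt kY; apply: killed_irreducible; first exact: closed_form hf cY.
move=> D irrD sD.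
have [||i [lt_i Hi]] := @irreducible_cover K r D m C irrD.
- by move=> i /HC [].
- by move=> x /sD [/EY].
apply: (killed_proper (HC i lt_i)) => //; first by case: irrD.
- move=> Hsub; have [_ /eqP] := sD _ (Hsub _ (ptP i lt_i)); apply/negP/fpt.
  by apply/mapP; exists i => //; rewrite mem_iota.
- by apply: killed_sub kY => z Cz; apply/EY; exists i.
Qed.

Lemma chain_killed Y m k : irreducible_chain Y m -> killed k Y -> (m < k)%N.
Proof.
move=> [C [HC HS]] kY.
suff H i : (i <= m)%N -> exists2 j, (j + i <= k)%N & killed j (C (m - i)%N).
  have [j le_j kj] := H m (leqnn _); rewrite subnn in kj.
  have [[_ [x Cx] _] _] := HC 0 (leq0n _).
  case: j kj le_j => [/killed0/(_ x)//|j _]; by rewrite addSn; apply: leq_ltn_trans; rewrite leq_addl.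
elim: i => [_|i IH lt_i].
  exists k; first by rewrite addn0.
  by rewrite subn0; apply: killed_sub kY; case: (HC m (leqnn _)).
have [j le_j kj] := IH (ltnW lt_i).
have Em : (m - i = (m - i.+1).+1)%N by lia.
have [irr1 _] := HC (m - i)%N (leq_subr _ _); have [irr2 _] := HC (m - i.+1)%N (leq_subr _ _).
have [|sub nsub] := HS (m - i.+1)%N; first by lia.
rewrite -Em in sub nsub; case: j kj le_j => [/killed0 H|j kj le_j].
  by have [_ [x Cx] _] := irr1; have := H x.
exists j; first by lia.
by apply: killed_proper irr1 _ sub nsub kj; case: irr2.
Qed.

(** An irreducible [D] in [Y] that is not [killed k.+1] goes on top. Its section by a linear form
    nonzero at a point of [D] is not [killed k], and carries the rest of the chain. *)
Lemma unkilled_chain k Y : zariski_closed Y -> ~ killed k Y -> irreducible_chain Y k.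
Proof.
elim: k Y => [|k IH] Y cY nk.
  have [D irrD sD] : exists2 D, irreducible_closed D & psubset D Y.
    apply: NNPP => H; apply: nk; apply: killed_irreducible => // C irrC sC.
    by case: H; exists C.
  by exists (fun=> D); split=> [i _|i]; rewrite ?ltn0.
have [D [irrD sD nD]] : exists D, [/\ irreducible_closed D, psubset D Y & ~ killed k.+1 D].
  apply: NNPP => H; apply: nk; apply: killed_irreducible => // C irrC sC.
  by apply: NNPP => nC; apply: H; exists C.
have [cD [x Dx] _] := irrD.
have [|f hf fx] := @linear_form_nonzero [:: x].
  by move=> z; rewrite inE => /eqP->; apply: (closed_neq0 cD).
have [|C [HC HS]] := IH _ (closed_form hf cD).
  by move=> H; apply: nD; exact: (killed_cut (ltn0Sn 0) hf H).
exists (fun i => if (i <= k)%N then C i else D); split=> [i le_i|i lt_i].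
  case: ifP => le_ik; last by split.
  by have [irrC sC] := HC i le_ik; split=> // z /sC [/sD].
rewrite -ltnS lt_i; case: ltnP => [lt_ik|le_ik]; first exact: HS.
have -> : i = k by lia.
have [_ sC] := HC k (leqnn _); split=> [z /sC []//|H].
by have [_ /eqP] := sC _ (H x Dx); apply/negP/fx; rewrite mem_head.
Qed.

Lemma has_dim_killed Y m : zariski_closed Y ->
  has_dim Y m%:Z <-> killed m.+1 Y /\ ~ killed m Y.
Proof.
move=> cY; split.
  case=> [[]//|[m' [[->] chm Hm]]]; split; last first.
    by move=> /(chain_killed chm); rewrite ltnn.
  by apply: NNPP => /(unkilled_chain cY)/Hm; rewrite ltnn.
move=> [k1 nk]; right; exists m; split=> // [|m' /chain_killed/(_ k1)].
  exact: unkilled_chain.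
by rewrite ltnS.
Qed.

Lemma has_dimN1 Y : has_dim Y (-1) <-> forall x, ~ Y x.
Proof.
split=> [[[]//|[m []//]]|H]; by left.
Qed.
End KillNumber.

(** * Sections of a prime hypersurface *)

Section CompleteIntersection.
Variable K : closedFieldType.

Lemma no_pure_power n d (A : {mpoly K[n.+1]}) : A \is d.-homog -> A@_(U_(ord_max) *+ d) = 0 ->
  exists2 b : 'I_n -> {mpoly K[n.+1]}, (forall j, (msize (b j) <= d)%N) &
    A = \sum_j b j * 'X_(widen_ord (leqnSn n) j).
Proof.
move=> hA A0; pose wd := widen_ord (leqnSn n).
have pk (m : 'X_{1..n.+1}) : m \in msupp A -> exists j, m (wd j) != 0.
  move=> hm; apply: NNPP => H.
  have m0 j : m (wd j) = 0%N.
    by apply/eqP; have [//|Hj] := eqVneq (m (wd j)) 0; case: H; exists j.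
  have Em : m = (U_(ord_max) *+ d)%MM.
    have /= := dhomog_mf hA hm; rewrite mdegE big_ord_recr /= big1 => [|j _]; last exact: m0.
    rewrite add0n => Em; apply/mnmP; elim/ordS_ind => [j|]; rewrite mulmnE mnm1E.
      by rewrite m0 -val_eqE /= gtn_eqF.
    by rewrite eqxx mul1n.
  by move: hm; rewrite mcoeff_msupp Em A0 eqxx.
pose pj (m : 'X_{1..n.+1}) : 'I_n -> bool := fun j => [pick j | m (wd j) != 0] == Some j.
exists (fun j => \sum_(m <- msupp A | pj m j) A@_m *: 'X_[m - U_(wd j)]).
  move=> j; apply: leq_trans (msize_sum _ _ _) _; apply/bigmax_leqP_seq => m hm.
  rewrite /pj; case: pickP => // i mi /eqP [<-].
  apply: leq_trans (msizeZ_le _ _) _; rewrite msizeX.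
  have /= <- := dhomog_mf hA hm.
  have {2}-> : m = (m - U_(wd i) + U_(wd i))%MM by rewrite submK // lep1mP.
  by rewrite mdegD mdeg1 addn1.
under eq_bigr do rewrite mulr_suml big_mkcond.
rewrite exchange_big /= {1}[A]mpolyE; apply: eq_big_seq => m hm.
have [j mj] := pk m hm; rewrite /pj; case: pickP => [i mi|/(_ j)]; last by rewrite mj.
rewrite (bigD1 i) //= eqxx big1 ?addr0 => [|l /negPf nl]; last first.
  by case: eqP => // [[El]]; rewrite El eqxx in nl.
by rewrite -scalerAl -mpolyXD submK // lep1mP.
Qed.

Lemma divides_msize n (A B : {mpoly K[n]}) : B != 0 -> divides A B -> (msize A <= msize B)%N.
Proof.
move=> B0 [q E]; rewrite E in B0 *.
have [q0 A0] : q != 0 /\ A != 0 by move: B0; rewrite mulf_eq0 negb_or => /andP.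
rewrite msizeM //; move: q0; rewrite -msize_poly_eq0.
by move: (msize q) (msize A) => x y; lia.
Qed.

Lemma homog_msizeE n d (A : {mpoly K[n]}) : A != 0 -> A \is d.-homog -> msize A = d.+1.
Proof.
by move=> A0 hA; rewrite -(mlead_deg A0); have /= -> := dhomog_mf hA (mlead_supp A0).
Qed.

Lemma killed_lsub n r k (M : 'M[K]_(n, r)) (Y : pset K r) (Z : pset K n) :
  (forall u, Z u -> Y (u *m M)) -> killed k Y -> killed k Z.
Proof.
move=> ZY [del [g [d0 hg Hg]]]; exists del, (fun j => lsub M (g j)); split=> //.
  by move=> j; apply: lsub_homog.
by move=> u /ZY/Hg H Hu; apply: H => j; rewrite -meval_lsub.
Qed.

(** The dependence is taken modulo the ideal of [A], where primality cancels powers of [B]. With the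
    last basis vector off [A = 0], the [k.+1] other variables and [B] are dependent modulo [A]; at
    [B = 0] this leaves a relation between the variables, and [killed_relation] saves one of
    them. *)
Lemma killed_prime_section k d e (A B : {mpoly K[k.+2]}) :
  A \is d.-homog -> prime_elt A -> B \is e.-homog -> ~ divides A B ->
  killed k (fun x => zeros A x /\ B.@[x 0] = 0).
Proof.
move=> hA [A0 UA PA] hB nAB.
have [|c] := @mpoly_nonzero_row K _ (A * 'X_ord_max).
  by rewrite mulf_neq0 // -msize_poly_eq0 msizeX.
rewrite mevalM mevalXU mulf_eq0 negb_or => /andP[Ac cn].
have c0 : c != 0 by apply: contraNneq cn => ->; rewrite mxE.
have [M uM HM] := complete_row ord_max c0.
pose l (j : 'I_k.+1) : {mpoly K[k.+2]} := lsub (invmx M) 'X_(widen_ord (leqnSn _) j).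
have hl j : l j \is 1.-homog by apply: lsub_homog; rewrite dhomogX /= mdeg1.
have lsubK (g : {mpoly K[k.+2]}) : lsub (invmx M) (lsub M g) = g.
  by rewrite lsubA mulVmx // lsub1.
have lsubKV (g : {mpoly K[k.+2]}) : lsub M (lsub (invmx M) g) = g.
  by rewrite lsubA mulmxV // lsub1.
pose A' := lsub M A.
pose I f := divides A' f.
have idI : is_ideal I.
  split; first by exists 0; rewrite mul0r.
    by move=> f h [q ->] [q' ->]; exists (q + q'); rewrite mulrDl.
  by move=> h f [q ->]; exists (h * q); rewrite mulrA.
have hA' : A' \is d.-homog by apply: lsub_homog.
have eM : (delta_mx 0 ord_max : 'rV_k.+2) *m M = c.
  by rewrite -rowE HM.
pose a := A'@_(U_(ord_max) *+ d).
pose Xm : {mpoly K[k.+2]} := 'X_[U_(ord_max) *+ d].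
have hXm : Xm \is d.-homog by rewrite dhomogX /= mdegMn mdeg1 mul1n.
have [||b bs Eb] := @no_pure_power k.+1 d (A' - a *: Xm).
- by rewrite rpredB // dhomogZ.
- by rewrite mcoeffB mcoeffZ mcoeffX eqxx mulr1 subrr.
have a0 : a != 0.
  apply: contraNneq Ac => a0; rewrite -eM -meval_lsub -/A'.
  move: Eb; rewrite a0 scale0r subr0 => ->.
  rewrite raddf_sum big1 //= => j _; rewrite mevalM mevalXU mxE.
  rewrite [_ == ord_max](_ : _ = false) ?andbF ?mulr0 //.
  by rewrite -val_eqE /= ltn_eqF.
pose X' (j : 'I_k.+1) : {mpoly K[k.+2]} := 'X_(widen_ord (leqnSn _) j).
(* Modulo [A'] a power of the last variable lies in the ideal of the others, because the coefficient
   [a] is invertible; for the other variables the relation is trivial. *)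
have main (i : 'I_k.+2) : exists Mb : nat * ('I_k.+1 -> {mpoly K[k.+2]}),
    (forall j, (msize (Mb.2 j) <= Mb.1)%N) /\ I ('X_i ^+ Mb.1 - \sum_j Mb.2 j * X' j).
  elim/ordS_ind: i => [i|].
    exists (1%N, fun j => (j == i)%:R) => /=; split=> [j|].
      by case: (j == i); rewrite ?msize1 ?msize0.
    rewrite (bigD1 i) //= eqxx mul1r big1 ?addr0 => [|j /negPf->]; last by rewrite mul0r.
    by rewrite subrr; case: idI.
  exists (d, fun j => - a^-1 *: b j); split=> [j|] /=.
    by rewrite scaleNr msizeN; apply: leq_trans (msizeZ_le _ _) (bs j).
  exists a^-1%:MP; rewrite mul_mpolyC.
  have -> : \sum_j (- a^-1 *: b j) * X' j = - a^-1 *: (A' - a *: Xm).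
    by rewrite Eb scaler_sumr; apply: eq_bigr => j _; rewrite scalerAl.
  rewrite mpolyXn -/Xm scaleNr opprK scalerBr scalerA mulVf // scale1r.
  by rewrite addrC subrK.
pose Q i Mb := (forall j : 'I_k.+1, (msize (Mb.2 j) <= Mb.1)%N) /\
  I ('X_i ^+ Mb.1 - \sum_j Mb.2 j * X' j).
pose Mb i := epsilon (inhabits (0, fun=> 0)) (Q i).
have HMb i : Q i (Mb i) := epsilon_spec _ _ (main i).
pose B' := lsub M B.
pose q (i : 'I_k.+2) := if unlift ord_max i is Some j then X' j else B'.
have [Phi Phi0 HPhi] := algebraic_dependence idI (fun i => proj1 (HMb i)) (fun i => proj2 (HMb i)) q.
have PA' f h : I (f * h) -> ~ I f -> I h.
  move=> [q' Eq'] nf; have [|[u Eu]|[u Eu]] := PA (lsub (invmx M) f) (lsub (invmx M) h).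
  - by exists (lsub (invmx M) q'); rewrite -rmorphM Eq' rmorphM /= lsubK.
  - by case: nf; exists (lsub M u); rewrite -rmorphM -Eu /= lsubKV.
  - by exists (lsub M u); rewrite -rmorphM -Eu /= lsubKV.
have nB' : ~ I B'.
  by move=> [u Eu]; apply: nAB; exists (lsub (invmx M) u); rewrite -[LHS]lsubK -/B' Eu rmorphM /= lsubK.
have Phi'0 : muni Phi != 0 by rewrite muni_eq0.
have [m [p Hp Ep]] := multiplicity_XsubC (muni Phi) 0.
rewrite subr0 in Ep.
have p0 : p`_0 != 0 by move: Hp; rewrite Phi'0 /root -horner_coef0.
pose ev := mmap (@mpolyC k.+2 K) X' : {rmorphism {mpoly K[k.+1]} -> {mpoly K[k.+2]}}.
have EPhi : mmap (@mpolyC k.+2 K) q Phi = (map_poly ev p).[B'] * B' ^+ m.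
  transitivity ((map_poly ev (muni Phi)).[B']).
    apply: (@eq_mpoly_rmorph K k.+2 _ (mmap (@mpolyC k.+2 K) q)
      (horner_eval B' \o (map_poly ev \o @muni k.+1 K))) => /= [x|].
      by rewrite mmapC muniC map_polyC /horner_eval hornerC /= /ev /= mmapC.
    elim/ordS_ind => [i|]; rewrite mmapX mmap1U /q /horner_eval.
      have -> : widen_ord (leqnSn k.+1) i = lift ord_max i.
        by apply: val_inj; rewrite /= /bump leqNgt ltn_ord add0n.
      rewrite liftK; have <- : widen_ord (leqnSn k.+1) i = lift ord_max i.
        by apply: val_inj; rewrite /= /bump leqNgt ltn_ord add0n.
      by rewrite muni_widen map_polyC hornerC /= /ev /= mmapX mmap1U.
    by rewrite unlift_none muni_max map_polyX hornerX.
  by rewrite Ep rmorphM /= map_polyXn hornerM hornerXn.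
have Ip : I (map_poly ev p).[B'].
  move: HPhi; rewrite EPhi; elim: (m) => [|m' IH]; first by rewrite mulr1.
  by rewrite exprS mulrCA => /PA' /(_ nB'); apply: IH.
apply: (@killed_lsub _ _ _ (invmx M) (fun x => zeros A' x /\ B'.@[x 0] = 0)).
  move=> u [[u0 Au] Bu]; split; last by rewrite meval_lsub mulmxKV.
  split; last by rewrite meval_lsub mulmxKV.
  by apply: contraNneq u0 => E; rewrite -(mulmxKV uM u) E mul0mx.
have cZ : zariski_closed (fun x => zeros A' x /\ B'.@[x 0] = 0).
  apply: (@closed_form _ _ _ e); last exact: closed_zeros hA'.
  exact: lsub_homog.
apply: (@killed_relation K k.+2 k 1 X' p`_0 _ cZ _ p0).
  split; [by [] | move=> j | move=> x [[x0 Ax] _] Hx]; first by rewrite dhomogX /= mdeg1.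
  have Ex : x = x 0 ord_max *: delta_mx 0 ord_max.
    apply/rowP; elim/ordS_ind => [j|]; rewrite [RHS]mxE [X in _ = _ * X]mxE.
      rewrite [_ == ord_max](_ : _ = false) ?andbF ?mulr0; last first.
        by rewrite -val_eqE /= ltn_eqF.
      by have := Hx j; rewrite mevalXU.
    by rewrite !eqxx mulr1.
  have := meval_scale (x 0 ord_max) (delta_mx 0 ord_max) hA'.
  rewrite -Ex Ax meval_lsub eM => /esym/eqP.
  rewrite mulf_eq0 (negPf Ac) orbF expf_eq0 => /andP[_ /eqP xm].
  by rewrite Ex xm scale0r eqxx in x0.
move=> z [[z0 Az] Bz]; have [u Eu] := Ip.
have : (map_poly ev p).[B'].@[z 0] = 0 by rewrite Eu mevalM Az mulr0.
rewrite -[LHS]/(meval (z 0) _) -horner_map -map_poly_comp /= Bz horner_coef0 coef_map /=.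
by rewrite meval_mmap => <-; apply: meval_eq => j; rewrite mxE.
Qed.
End CompleteIntersection.

(** * The general hyperplane section *)

Section GeneralSection.
Variable K : closedFieldType.

Lemma killed_prime_section_dim r d e (A B : {mpoly K[r]}) : (2 <= r)%N ->
  A \is d.-homog -> prime_elt A -> B \is e.-homog -> ~ divides A B ->
  killed (r - 2) (fun x => zeros A x /\ B.@[x 0] = 0).
Proof.
case: r A B => [|[|r]] // A B _; have -> : (r.+2 - 2 = r)%N by rewrite subSS subn1.
exact: killed_prime_section.
Qed.

Lemma mderiv_homog r d (F : {mpoly K[r]}) i : F \is d.+1.-homog -> F^`M(i) \is d.-homog.
Proof.
move=> hF; apply/dhomogP => m; rewrite mcoeff_msupp mcoeff_mderiv => H /=.
have hm : (m + U_(i))%MM \in msupp F.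
  by rewrite mcoeff_msupp; apply: contraNneq H => ->; rewrite mul0rn.
by have /= := dhomog_mf hF hm; rewrite mdegD mdeg1 addn1 => -[].
Qed.

Lemma closed_Sing r d (F : {mpoly K[r]}) : F \is d.+1.-homog -> zariski_closed (Sing F).
Proof.
move=> hF; exists (fun g => g = F \/ exists i, g = F^`M(i)); split.
  by move=> g [->|[i ->]]; [exists d.+1 | exists d; apply: mderiv_homog].
move=> x; split=> [[[x0 Fx] Hx]|[x0 H]].
  by split=> // g [->//|[i ->]].
by split=> [|i]; [split=> //; apply: H; left | apply: H; right; exists i].
Qed.

(** The first polar of [F] at [P]. It vanishes at [x] exactly when [P] lies in the tangent space at
    [x], and in a chart centred at [P] it becomes the derivative of the chart polynomial. *)
Definition polar r (F : {mpoly K[r]}) (P : 'rV[K]_r) : {mpoly K[r]} :=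
  \sum_i P 0 i *: F^`M(i).

Lemma meval_polar r (F : {mpoly K[r]}) (P x : 'rV[K]_r) :
  (polar F P).@[x 0] = \sum_i (F^`M(i)).@[x 0] * P 0 i.
Proof. by rewrite raddf_sum; apply: eq_bigr => i _; rewrite /= mevalZ mulrC. Qed.

Lemma polar_homog r d (F : {mpoly K[r]}) P : F \is d.+1.-homog -> polar F P \is d.-homog.
Proof. by move=> hF; apply: rpred_sum => i _; apply/dhomogZ/mderiv_homog. Qed.

Lemma lsub_polar n r (A : 'M[K]_(n, r)) (F : {mpoly K[r]}) (Q : 'rV[K]_n) :
  polar (lsub A F) Q = lsub A (polar F (Q *m A)).
Proof.
rewrite /polar raddf_sum /=; under eq_bigr do rewrite mderiv_lsub scaler_sumr.
rewrite exchange_big; apply: eq_bigr => j _ /=; rewrite linearZ /= mxE scaler_suml.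
by apply: eq_bigr => i _; rewrite scalerA.
Qed.

Lemma divides_polar r d (F : {mpoly K[r]}) P : F \is d.+1.-homog -> F != 0 ->
  polar F P != 0 -> ~ divides F (polar F P).
Proof.
move=> hF F0 P0 /(divides_msize P0).
by rewrite (homog_msizeE F0 hF) (homog_msizeE P0 (polar_homog P hF)) ltnn.
Qed.

(* If [A] and [B] are not constant, they vanish together on a set of codimension
   at most two, where the hypersurface [A * B = 0] is singular. *)
Lemma irreducible_of_Sing r d (G : {mpoly K[r]}) : G != 0 -> G \is d.+1.-homog ->
  (exists j, (j.+2 < r)%N /\ killed j (Sing G)) -> irreducible_mpoly G.
Proof.
move=> G0 hG [j [lt_j kG]]; split=> //.
  apply: contraTN isT => /andP[/eqP EG _]; move: hG G0; rewrite EG => /dhomogP H.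
  by rewrite mpolyC_eq0 => c0; have := H 0%MM; rewrite msuppC (negPf c0) inE eqxx => /(_ isT); rewrite /= mdeg0.
move=> f g Efg; apply: NNPP => /not_or_and [/negP Uf /negP Ug].
have [[f0 g0] hfg] : (f != 0 /\ g != 0) /\ f * g \is d.+1.-homog.
  by rewrite -Efg; split=> //; move: G0; rewrite Efg mulf_eq0 negb_or => /andP.
have [a ha] := homog_factor (mulf_neq0 f0 g0) hfg.
have hgf : g * f \is d.+1.-homog by rewrite mulrC.
have [b hb] := homog_factor (mulf_neq0 g0 f0) hgf.
have pos (h : {mpoly K[r]}) e : h != 0 -> h \isn't a GRing.unit -> h \is e.-homog -> (0 < e)%N.
  move=> h0 Uh he; rewrite lt0n; apply: contra Uh => /eqP e0; rewrite e0 in he.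
  have sh : (msize h <= 1)%N by rewrite (homog_msizeE h0 he).
  move: h0; rewrite (msize1_polyC sh) mpolyC_eq0 => c0.
  by apply: rmorph_unit; rewrite unitfE.
have : killed j.+2 (fun x : 'rV[K]_r => x != 0).
  apply: (killed_cut (pos _ _ f0 Uf ha) ha); apply: (killed_cut (pos _ _ g0 Ug hb) hb).
  apply: killed_sub kG => x [[x0 fx] gx]; split.
    by split=> //; rewrite Efg mevalM fx mul0r.
  by move=> i; rewrite Efg mderivM mevalD !mevalM fx gx mulr0 mul0r addr0.
by move/not_killed_full; rewrite leqNgt lt_j.
Qed.

Variables (n d : nat) (F : {mpoly K[n.+2]}) (P : 'rV[K]_n.+2).
Hypotheses (n_ge2 : (2 <= n)%N) (d_ge4 : (4 <= d)%N) (hypX : hypersurface d F).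
Hypotheses (P0 : P != 0) (smP : ~ Sing F P) (polP : polar F P != 0).

Let hF : F \is d.-1.+1.-homog.
Proof. by case: hypX => hF _; rewrite prednK //; lia. Qed.

Let d1 : (0 < d.-1)%N. Proof. by lia. Qed.
Let n1 : (0 < n.-1)%N. Proof. by lia. Qed.
Let n2 : (2 <= n.+1)%N. Proof. by lia. Qed.
Let ltS j : (j < n.-1)%N -> (j.+2 < n.+1)%N. Proof. by lia. Qed.
Let ltZ j : j%:Z <= n%:Z - 2 -> (j < n.-1)%N. Proof. by lia. Qed.
Let nn : (n.+1 <= (n.+1 - 2).+1)%N = false. Proof. by lia. Qed.

(** The hyperplanes through [P] are the [y *m N]; conditions on [h] are pulled back to polynomials
    in [y], where a product of nonzero ones is nonzero. *)
Let N := kermx P^T.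

Let image_through y : on_hyperplane (y *m N) P.
Proof. by rewrite /on_hyperplane; apply: trmx_inj; rewrite trmx_mul trmxK -mulmxA mulmx_ker mulmx0 trmx0. Qed.

Let through_image h : on_hyperplane h P -> exists y, h = y *m N.
Proof.
rewrite /on_hyperplane => H; apply/submxP/sub_kermxP.
by apply: trmx_inj; rewrite trmx_mul trmxK H trmx0.
Qed.

Let dot (v w : 'rV[K]_n.+2) : K := (v *m w^T) 0 0.

Let dotE v w : dot v w = \sum_i v 0 i * w 0 i.
Proof. by rewrite /dot mxE; apply: eq_bigr => i _; rewrite mxE. Qed.

Let on_dot h v : on_hyperplane h v <-> dot v h = 0.
Proof.
rewrite /on_hyperplane /dot; split=> [->|H]; first by rewrite mxE.
by apply/matrixP => i j; rewrite !ord1 H mxE.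
Qed.

Let linform (z : 'rV[K]_n.+2) : {mpoly K[n.+2]} := \sum_j z 0 j *: 'X_j.

Let linform_homog z : linform z \is 1.-homog.
Proof. by apply: rpred_sum => j _; apply: dhomogZ; rewrite dhomogX /= mdeg1. Qed.

Let meval_linform z (h : 'rV[K]_n.+2) : (linform z).@[h 0] = dot z h.
Proof. by rewrite raddf_sum dotE; apply: eq_bigr => j _; rewrite /= mevalZ mevalXU. Qed.

Let nonvanish (f g : {mpoly K[n.+2]}) :
  (exists2 h, on_hyperplane h P & f.@[h 0] != 0) ->
  (exists2 h, on_hyperplane h P & g.@[h 0] != 0) ->
  exists2 h, on_hyperplane h P & (f * g).@[h 0] != 0.
Proof.
move=> [h /through_image [y ->] Hy] [h' /through_image [y' ->] Hy'].
have nz (e : {mpoly K[n.+2]}) (u : 'rV[K]_n.+2) : e.@[(u *m N) 0] != 0 -> lsub N e != 0.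
  by move=> Hu; apply: contraNneq Hu => E; rewrite -meval_lsub E meval0.
have [|u Hu] := @mpoly_nonzero_row K _ (lsub N f * lsub N g).
  exact: mulf_neq0 (nz _ _ Hy) (nz _ _ Hy').
by exists (u *m N); [apply: image_through | rewrite -meval_lsub rmorphM].
Qed.

(** The [hh i] pass through [P], and a point lying on all of them is proportional to [P], with ratio
    read at a nonzero coordinate [P 0 p]. *)
Let avoid_point z : (forall c, z != c *: P) -> exists2 h, on_hyperplane h P & dot z h != 0.
Proof.
move=> nz; have /rV0Pn [p Pp] := P0.
pose hh i : 'rV[K]_n.+2 := P 0 p *: delta_mx 0 i - P 0 i *: delta_mx 0 p.
have dot_hh v i : dot v (hh i) = P 0 p * v 0 i - P 0 i * v 0 p.
  have dd j : dot v (delta_mx 0 j) = v 0 j.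
    rewrite dotE (bigD1 j) //= mxE !eqxx mulr1 big1 ?addr0 // => l /negPf nl.
    by rewrite mxE nl andbF mulr0.
  have {}dd j c : dot v (c *: delta_mx 0 j) = c * v 0 j.
    by rewrite -dd !dotE mulr_sumr; apply: eq_bigr => l _; rewrite mxE mulrCA.
  rewrite -!dd !dotE -sumrB; apply: eq_bigr => l _.
  by rewrite [hh i 0 l]mxE [X in _ * (_ + X)]mxE mulrDr mulrN.
have [i zi] : exists i, dot z (hh i) != 0.
  apply: NNPP => H; have := nz (z 0 p / P 0 p); case/eqP; apply/rowP => i; rewrite mxE.
  have [|Hi] := eqVneq (dot z (hh i)) 0; last by case: H; exists i.
  rewrite dot_hh => /eqP; rewrite subr_eq0 => /eqP E.
  by apply: (mulfI Pp); rewrite E mulrA [P 0 p * _]mulrC divfK // mulrC.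
exists (hh i) => //; apply/on_dot; by rewrite dot_hh mulrC subrr.
Qed.

Let hpol : polar F P \is d.-1.-homog. Proof. exact: polar_homog. Qed.

Let primeF : prime_elt F. Proof. by case: hypX => _ /irreducible_mpoly_prime. Qed.

Let F0 : F != 0. Proof. by case: primeF. Qed.

(* The tangent hyperplanes through [P] at smooth points are the images under the
   Gauss map of the points of [F = polar F P = 0], a set of dimension n - 1; the
   hyperplanes through [P] form a space of dimension n. *)
Let avoid_tangents : exists m (T : {mpoly K[n.+2]}), [/\ T \is m.-homog,
  exists2 h, on_hyperplane h P & T.@[h 0] != 0
  & forall x c, zeros F x -> (polar F P).@[x 0] = 0 ->
     T.@[(c *: \row_j (F^`M(j)).@[x 0]) 0] = 0 \/ c = 0].
Proof.
(* In a basis starting with [P], the gradient at a point of [polar F P = 0] is given by its [n.+1]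
   components along [W]. These are forms on a set that is [killed n], so they satisfy a relation,
   which [T] expresses in terms of the hyperplane. *)
have [M uM HM] := complete_row ord0 P0.
pose W := row' ord0 M.
have kW : killed n (fun x => zeros F x /\ (polar F P).@[x 0] = 0).
  exact: killed_prime_section hF primeF hpol (divides_polar hF F0 polP).
have cW : zariski_closed (fun x => zeros F x /\ (polar F P).@[x 0] = 0).
  exact: closed_form hpol (closed_zeros hF).
pose q i := polar F (row i W).
have hq i : q i \is d.-1.-homog by apply: polar_homog.
have [Phi Phi0 HPhi] := killed_dependence q cW kW.
have [m Hm] := homog_part_neq0 Phi0.
have HT : forall x, zeros F x /\ (polar F P).@[x 0] = 0 ->
    (homog_part m Phi).@[(\row_j (q j).@[x 0]) 0] = 0.
  apply: (@relation_homog_part K n.+2 n.+1 d.-1 q Phi _ m cW d1 hq) => x Wx.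
  by rewrite -[RHS](HPhi x Wx); apply: meval_eq => i; rewrite mxE.
have hm : homog_part m Phi \is m.-homog by apply: pihomogP.
exists m, (lsub W^T (homog_part m Phi)); split.
- exact: lsub_homog.
- have [c Hc] := mpoly_nonzero_row Hm.
  pose h := (row_mx (0 : 'rV_1) c : 'rV[K]_(1 + n.+1)) *m (invmx M)^T.
  have hM : h *m M^T = row_mx (0 : 'rV_1) c.
    by rewrite -mulmxA -trmx_mul mulmxV // trmx1 mulmx1.
  have hP i : (h *m M^T) 0 i = dot h (row i M).
    by rewrite /dot !mxE; apply: eq_bigr => j _; rewrite !mxE.
  exists h.
    apply/on_dot; have := hP ord0; rewrite hM HM => E.
    have -> : dot P h = dot h P by rewrite !dotE; apply: eq_bigr => i _; rewrite mulrC.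
    by rewrite -E mxE; case: splitP => // j _; rewrite mxE.
  rewrite meval_lsub; have -> : h *m W^T = c; last exact: Hc.
  apply/rowP => i; have := hP (lift ord0 i); rewrite hM [LHS]mxE.
  case: splitP => [j|j] /=; rewrite /bump leq0n add1n => Ej.
    by rewrite (ord1 j) in Ej.
  have -> : j = i by apply: val_inj; move: Ej; rewrite add1n => -[].
  by move=> ->; rewrite dotE mxE; apply: eq_bigr => l _; rewrite !mxE.
- move=> x c Fx Px; have [->|c0] := eqVneq c 0; first by right.
  left; rewrite (meval_scale _ _ (lsub_homog _ hm)) meval_lsub.
  have -> : (\row_j (F^`M(j)).@[x 0]) *m W^T = \row_j (q j).@[x 0].
    apply/rowP => i; rewrite !mxE meval_polar; apply: eq_bigr => j _.
    by rewrite !mxE.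
  by rewrite HT // mulr0.
Qed.

(** This will keep the polar of the section nonzero. A hyperplane through [P] and a point [v] off
    the polar exists because there are more than two coordinates. *)
Let avoid_polar : exists T : {mpoly K[n.+2]}, [/\ T \is d.-1.-homog,
  exists2 h, on_hyperplane h P & T.@[h 0] != 0
  & forall h : 'rV[K]_n.+2, T.@[h 0] != 0 -> exists2 x, on_hyperplane h x & (polar F P).@[x 0] != 0].
Proof.
have [v Hv] := mpoly_nonzero_row polP.
have [h0 [h00 hP hv]] : exists h0 : 'rV[K]_n.+2, [/\ h0 != 0, on_hyperplane h0 P & on_hyperplane h0 v].
  have : kermx (col_mx P v)^T != 0.
    rewrite kermx_eq0 /row_free mxrank_tr neq_ltn; apply/orP; left.
    by apply: leq_ltn_trans (rank_leq_row _) _; rewrite !ltnS ltnW.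
  case/rowV0Pn => h0 /sub_kermxP Hh h00; exists h0; split=> //.
    apply: trmx_inj; rewrite trmx_mul trmxK trmx0; move: Hh.
    by rewrite tr_col_mx mul_mx_row -[RHS]row_mx0 => /eq_row_mx [].
  apply: trmx_inj; rewrite trmx_mul trmxK trmx0; move: Hh.
  by rewrite tr_col_mx mul_mx_row -[RHS]row_mx0 => /eq_row_mx [].
have /rV0Pn [j hj] := h00.
pose w : 'rV[K]_n.+2 := (h0 0 j)^-1 *: delta_mx 0 j.
have hw : h0 *m w^T = 1%:M.
  apply/matrixP => i l; rewrite !ord1 mxE (bigD1 j) //= !mxE !eqxx mulr1 divff //.
  rewrite big1 ?addr0 // => k /negPf nk; by rewrite !mxE nk andbF mulr0 mulr0.
(* [h *m B] is the point (h.w) v - (h.v) w of the hyperplane [h]. *)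
pose B := w^T *m v - v^T *m w.
exists (lsub B (polar F P)); split; first exact: lsub_homog.
  exists h0 => //; rewrite meval_lsub.
  have -> : h0 *m B = v; last exact: Hv.
  have hv' : h0 *m v^T = 0 by apply: trmx_inj; rewrite trmx_mul trmxK hv trmx0.
  by rewrite mulmxBr !mulmxA hw mul1mx hv' mul0mx subr0.
move=> h Hh; exists (h *m B); last by rewrite -meval_lsub.
have c11 (x y : 'M[K]_1) : x *m y = y *m x.
  by apply/matrixP => a b; rewrite !ord1 !mxE !big_ord1 mulrC.
have E (x y : 'rV[K]_n.+2) : x *m y^T = y *m x^T.
  by apply: trmx_inj; rewrite trmx_mul trmxK; apply/matrixP => a b; rewrite !ord1 [RHS]mxE.
rewrite /on_hyperplane /B mulmxBr mulmxBl -!mulmxA [v *m _]E [w *m _]E.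
by rewrite [h *m (w^T *m _)]mulmxA [h *m (v^T *m _)]mulmxA c11 subrr.
Qed.

(** The vectors orthogonal to the rows of [A] form a line. For the gradient of [F] this means that a
    point of the section is singular only where [h] is tangent or [F] is singular. *)
Let chart_orth h (A : 'M[K]_(n.+1, n.+2)) (v : 'rV[K]_n.+2) : h != 0 ->
  row_free A -> (A == kermx h^T)%MS -> v *m A^T = 0 -> exists l, v = l *: h.
Proof.
move=> h0 /eqP rA /andP[/sub_kermxP Ah _] vA.
have hK : (h <= kermx A^T)%MS by apply/sub_kermxP/trmx_inj; rewrite trmx_mul trmxK Ah trmx0.
apply/sub_rVP; apply: submx_trans (_ : (kermx A^T <= h)%MS); first exact/sub_kermxP.
by rewrite -(mxrank_leqif_sup hK) mxrank_ker mxrank_tr rA rank_rV h0 subSnn.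
Qed.

Theorem general_section (s t : int) :
  has_dim (Sing F) s ->
  (0 <= s <= n%:Z - 2 /\ t = s - 1) \/ (s = -1 /\ t = -1) ->
  generally (hyperplanes_through P) (fun h =>
    forall A Q, hyperplane_chart h P A Q -> star d t (section_eq F A) Q).
Proof.
move=> dimS s_t.
have cS : zariski_closed (Sing F) := closed_Sing hF.
have [pts [Spts Hpts]] := killed_section cS.
have [m [T1 [hT1 nT1 HT1]]] := avoid_tangents.
have [T3 [hT3 nT3 HT3]] := avoid_polar.
pose T2 := \prod_(z <- pts) linform z.
have hT2 : T2 \is (size pts).-homog.
  rewrite /T2; elim: (pts) => [|z l IH]; first by rewrite big_nil dhomog1.
  by rewrite big_cons; exact: (dhomogM (linform_homog z) IH).
have nT2 : exists2 h, on_hyperplane h P & T2.@[h 0] != 0.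
  rewrite /T2; elim: (pts) Spts => [|z l IH] Sl.
    by exists 0; [rewrite /on_hyperplane trmx0 mulmx0 | rewrite big_nil meval1 oner_eq0].
  rewrite big_cons; apply: nonvanish; last first.
    by apply: IH => x xl; apply: Sl; rewrite inE xl orbT.
  have [|h hh zh] := @avoid_point z; last by exists h => //; rewrite meval_linform.
  move=> c; have Sz := Sl z (mem_head _ _); apply: contra_notN smP => /eqP Ez.
  have c0 : c != 0.
    have := closed_neq0 cS Sz; rewrite Ez; apply: contraNneq => ->; by rewrite scale0r.
  have -> : P = c^-1 *: z by rewrite Ez scalerA mulVf // scale1r.
  by apply: closed_scale Sz => //; rewrite invr_eq0.
(* Where [T1] is nonzero, [h] is tangent at no smooth point; [T2] makes it miss a chosen point of
   each component of [Sing F], so that the dimension drops; [T3] keeps the polar nonzero on [h]. The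
   positive degree of [T3] gives [h != 0]. *)
pose T := T1 * (T2 * T3).
have hT : T \is (m + (size pts + d.-1)).-homog by do !apply: dhomogM.
have nT : exists2 h, on_hyperplane h P & T.@[h 0] != 0 by do !apply: nonvanish.
exists (zeros T); split; first exact: closed_zeros hT.
  have [h hP hTh] := nT; exists h; split; last by move=> [_ /eqP]; rewrite (negPf hTh).
  split=> //; apply: contraNneq hTh => ->.
  by rewrite (meval_homog0 _ hT) // !addn_gt0 d1 !orbT.
move=> h [h0 hP] nTh A Q [rA eA QA].
have : T.@[h 0] != 0 by apply/eqP => Th; apply: nTh.
rewrite mevalM mulf_eq0 negb_or => /andP[T1h]; rewrite mevalM mulf_eq0 negb_or => /andP[T2h T3h].
rewrite -[section_eq F A]/(lsub A F); set G := lsub A F.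
have hG : G \is d.-1.+1.-homog by apply: lsub_homog.
have inj_A (u : 'rV_n.+1) : (u *m A == 0) = (u == 0) by rewrite mulmx_free_eq0.
have AhT : A *m h^T = 0 by apply/sub_kermxP; case/andP: eA.
have onA (u : 'rV_n.+1) : on_hyperplane h (u *m A) by rewrite /on_hyperplane -mulmxA AhT mulmx0.
have SingG u : Sing G u <-> Sing F (u *m A).
  pose gr := \row_j (F^`M(j)).@[(u *m A) 0].
  have grG i : (G^`M(i)).@[u 0] = (gr *m A^T) 0 i.
    rewrite mderiv_lsub raddf_sum mxE; apply: eq_bigr => j _.
    by rewrite /= mevalZ meval_lsub !mxE mulrC.
  split=> [[[u0 Gu] Hu]|[[uA Fu] Hu]]; last first.
    split; first by split; rewrite -?inj_A // meval_lsub.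
    by move=> i; rewrite grG mxE big1 // => j _; rewrite [gr _ _]mxE Hu mul0r.
  have uA : u *m A != 0 by rewrite inj_A.
  have Fu : zeros F (u *m A) by split=> //; rewrite -meval_lsub.
  (* The gradient of [F] is [l *: h]. As [h] passes through [P], the polar vanishes there, and a
     nonzero [l] would make [h] one of the tangent hyperplanes excluded by [T1]. *)
  split=> //; have [|l El] := @chart_orth h A gr h0 rA eA.
    by apply/rowP => i; rewrite -grG Hu mxE.
  have Pu : (polar F P).@[(u *m A) 0] = 0.
    have -> : (polar F P).@[(u *m A) 0] = dot gr P.
      by rewrite meval_polar dotE; apply: eq_bigr => j _; rewrite !mxE.
    move/on_dot: hP => hP; rewrite El dotE.
    have -> : \sum_i (l *: h) 0 i * P 0 i = l * dot P h; last by rewrite hP mulr0.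
    by rewrite dotE mulr_sumr; apply: eq_bigr => i _; rewrite mxE -mulrA [h 0 i * _]mulrC.
  have l0 : l = 0.
    have [//|ln0] := eqVneq l 0.
    have [Z|/eqP] := HT1 (u *m A) l^-1 Fu Pu; last by rewrite invr_eq0 (negPf ln0).
    by move: Z; rewrite -/gr El scalerA mulVf // scale1r => /eqP; rewrite (negPf T1h).
  by move=> i; have := congr1 (fun v : 'rV_n.+2 => v 0 i) El; rewrite l0 scale0r !mxE.
have cSG : zariski_closed (Sing G) := closed_Sing hG.
have down k : killed k.+1 (Sing F) -> killed k (Sing G).
  move=> kS; have hpts z : z \in pts -> (linform h).@[z 0] != 0.
    move=> zp; move: T2h; rewrite /T2 rmorph_prod /= prodf_seq_neq0 => /allP/(_ z zp) H.
    have : (linform z).@[h 0] != 0 := H.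
    rewrite (meval_linform z h) (meval_linform h z) !dotE; congr (_ != 0).
    by apply: eq_bigr => i _; rewrite mulrC.
  apply: (killed_lsub (M := A) _ (Hpts k 1%N (linform h) (linform_homog h) hpts kS)) => u /SingG Su.
  split=> //; rewrite (meval_linform h (u *m A)).
  by have /on_dot <- := onA u; rewrite !dotE; apply: eq_bigr => i _; rewrite mulrC.
have up k : killed k (Sing G) -> killed k.+1 (Sing F).
  move=> kS; apply: (killed_cut (ltn0Sn 0) (linform_homog h)).
  apply: (killed_lsub _ kS (M := pinvmx A)) => v [Sv].
  rewrite (meval_linform h v) => hv; apply/SingG; rewrite mulmxKpV // (eqmxP eA).
  apply/sub_kermxP; apply/on_dot; rewrite -hv !dotE.
  by apply: eq_bigr => i _; rewrite mulrC.
have [dimG [j [lt_j kG]]] : has_dim (Sing G) t /\ exists j, (j < n.-1)%N /\ killed j (Sing G).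
  case: s_t dimS => [[/andP[s0 s_le] ->]|[-> ->]]; last first.
    move=> /has_dimN1 H; have SG u : ~ Sing G u by move=> /SingG/H.
    split; first by apply/has_dimN1.
    by exists 0%N; split; [exact: n1 | apply/killed0].
  case: s s0 s_le => // k _ k_le /(has_dim_killed k cS) [k1 nk]; split; last first.
    by exists k; split; [exact: ltZ | apply: down].
  case: k k1 nk k_le => [|k] k1 nk k_le.
    by rewrite sub0r; apply/has_dimN1; apply/killed0; apply: down.
  have -> : k.+1%:Z - 1 = k%:Z by rewrite -addn1 PoszD addrK.
  by apply/(has_dim_killed k cSG); split; [apply: down | move=> /up].
have G0 : G != 0.
  apply: contraTneq lt_j => G0; rewrite -leqNgt.
  apply: (@leq_trans n.+1); first by rewrite (leq_trans (leq_pred n)).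
  apply: (@not_killed_full K); apply: killed_sub kG => x x0.
  split; first by split=> //; rewrite G0 meval0.
  by move=> i; rewrite G0 mderiv0 meval0.
have irrG : irreducible_mpoly G.
  by apply: irreducible_of_Sing hG _ => //; exists j; split=> //; apply: ltS.
have hypG : hypersurface d G by split=> //; case: hypX => hFd _; apply: lsub_homog.
split=> //.
have primeG : prime_elt G := irreducible_mpoly_prime irrG.
have polG : polar G Q = lsub A (polar F P) by rewrite /G lsub_polar QA.
have polG0 : polar G Q != 0.
  have [x hx Px] := HT3 h T3h; apply: contraNneq Px => E.
  have /submxP [u Eu] : (x <= A)%MS by rewrite (eqmxP eA); apply/sub_kermxP.
  by rewrite Eu -meval_lsub -polG E meval0.
have hpG : polar G Q \is d.-1.-homog by apply: polar_homog.
exists (zeros (polar G Q)); split; first exact: closed_zeros hpG.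
  apply: NNPP => H.
  (* Were every zero of [G] a zero of its polar, [G = 0] would be killed by [n.+1 - 2] forms, and
     together with [G] these would kill the whole space, which takes [n.+1]. *)
  have : killed (n.+1 - 2).+1 (fun x : 'rV[K]_n.+1 => x != 0).
    apply: (killed_cut (ltn0Sn d.-1) hG).
    apply: killed_sub (killed_prime_section_dim n2 hG primeG hpG (divides_polar hG G0 polG0)).
    move=> x [x0 Gx]; split; first by split.
    apply: NNPP => Px; apply: H; exists x; split; first by split.
    by move=> [_].
  by move/not_killed_full; rewrite nn.
move=> x [x0 _] nx; rewrite /in_tangent_space -meval_polar => E; exact: nx.
Qed.
End GeneralSection.

(** * Models of function fields *)

Section Models.

Definition evp (S L : comNzRingType) (j : {rmorphism S -> L}) (al : L) : {poly S} -> L :=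
  horner_eval al \o map_poly j.

HB.instance Definition _ (S L : comNzRingType) (j : {rmorphism S -> L}) (al : L) :=
  GRing.RMorphism.copy (evp j al) (horner_eval al \o map_poly j).

Lemma evpC (S L : comNzRingType) (j : {rmorphism S -> L}) al c : evp j al c%:P = j c.
Proof. by rewrite /evp /= map_polyC /horner_eval hornerC. Qed.

Lemma evpX (S L : comNzRingType) (j : {rmorphism S -> L}) al : evp j al 'X = al.
Proof. by rewrite /evp /= map_polyX /horner_eval hornerX. Qed.

Definition emb (S : comNzRingType) (k : fieldType) (L : fieldExtType k)
  (psi : {rmorphism S -> k}) : S -> L := in_alg L \o psi.

HB.instance Definition _ (S : comNzRingType) (k : fieldType) (L : fieldExtType k)
  (psi : {rmorphism S -> k}) := GRing.RMorphism.copy (emb L psi) (in_alg L \o psi).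

(* [k] is the fraction field of [S] and [L = k(al)], with [S[al] = S[T]/(f)]. *)
Definition model (S : idomainType) (f : {poly S}) (k : fieldType) (L : fieldExtType k)
    (psi : {rmorphism S -> k}) (al : L) : Prop :=
  [/\ injective psi,
      forall z, exists a b, psi b != 0 /\ z = psi a / psi b,
      forall g, evp (emb L psi) al g = 0 <-> divides f g
    & <<1; al>>%VS = fullv].

Lemma clear_denominators (S : idomainType) (k : fieldType) (psi : {rmorphism S -> k}) (q : {poly k}) :
  (forall z, exists a b, psi b != 0 /\ z = psi a / psi b) ->
  exists b g, b != 0 /\ psi b *: q = map_poly psi g.
Proof.
move=> frac; elim/poly_ind: q => [|q c [b [g [b0 E]]]].
  by exists 1, 0; rewrite oner_eq0 scaler0 rmorph0.
have [x [y [y0 ->]]] := frac c.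
exists (y * b), (y%:P * g * 'X + (b * x)%:P); split.
  by rewrite mulf_neq0 //; apply: contraNneq y0 => ->; rewrite rmorph0.
have -> : map_poly psi (y%:P * g * 'X + (b * x)%:P) =
    (psi y)%:P * (psi b *: q) * 'X + (psi b * psi x)%:P.
  by rewrite E -rmorphM -!map_polyC -(map_polyX psi) -!rmorphM -rmorphD.
rewrite rmorphM /= -!mul_polyC !polyCM mulrDr; congr (_ + _); first by ring.
rewrite -!polyCM; congr _%:P; by field.
Qed.

Section OneModel.
Variables (S : idomainType) (f : {poly S}) (k : fieldType) (L : fieldExtType k).
Variables (psi : {rmorphism S -> k}) (al : L).
Hypothesis mod : model f psi al.

Let j := emb L psi.

Lemma emb_inj : injective (emb L psi).
Proof.
case: mod => inj _ _ _; apply: inj_comp inj; exact: fmorph_inj.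
Qed.

Lemma emb_eq0 a : (emb L psi a == 0) = (a == 0).
Proof. by rewrite -(rmorph0 (emb L psi)) (inj_eq emb_inj). Qed.

Lemma model_elem (z : L) : exists b g, b != 0 /\ emb L psi b * z = evp (emb L psi) al g.
Proof.
case: (mod) => _ frac _ gen; have /Fadjoin1_polyP [q ->] : z \in <<1; al>>%VS by rewrite gen memvf.
have [b [g [b0 E]]] := clear_denominators q frac.
exists b, g; split=> //; rewrite /evp /= /horner_eval /emb map_poly_comp -E.
by rewrite linearZ /= hornerZ.
Qed.

Lemma model_neq0 : f != 0.
Proof.
case: (mod) => inj frac ker _; apply/eqP => f0.
have /polyOver1P [q Eq] := minPolyOver 1 al.
have [b [g [b0 E]]] := clear_denominators q frac.
have : evp (emb L psi) al g = 0.
  rewrite /evp /= /horner_eval /emb map_poly_comp -E linearZ /= hornerZ -Eq.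
  by rewrite minPolyxx mulr0.
move/ker => [r Er]; move: E; rewrite Er f0 mulr0 rmorph0 => /eqP.
rewrite scaler_eq0 -(rmorph0 psi) (inj_eq inj) (negPf b0) => /eqP q0.
by have := monic_neq0 (monic_minPoly 1 al); rewrite Eq q0 rmorph0 eqxx.
Qed.

Lemma model_root : evp (emb L psi) al f = 0.
Proof. by case: (mod) => _ _ ker _; apply/ker; exists 1; rewrite mul1r. Qed.

Lemma map_emb_polyOver (g : {poly S}) : map_poly (emb L psi) g \is a polyOver 1%VS.
Proof. by rewrite /emb map_poly_comp; apply/polyOver1P; exists (map_poly psi g). Qed.

Lemma size_map_emb (g : {poly S}) : size (map_poly (emb L psi) g) = size g.
Proof. exact: size_map_inj_poly emb_inj (rmorph0 _) _. Qed.

Lemma lead_coef_map_emb (g : {poly S}) :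
  lead_coef (map_poly (emb L psi) g) = emb L psi (lead_coef g).
Proof. exact: lead_coef_map_inj emb_inj (rmorph0 _) _. Qed.

(** Clearing denominators in the minimal polynomial gives an element of the kernel, hence a multiple
    of [f]. So [f] has no larger degree than the minimal polynomial, which divides it. *)
Lemma model_minPoly :
  map_poly (emb L psi) f = emb L psi (lead_coef f) *: minPoly 1 al.
Proof.
have f0 := model_neq0; case: (mod) => inj frac ker _.
have m_dvd : minPoly 1 al %| map_poly (emb L psi) f.
  by apply: minPoly_dvdp (map_emb_polyOver f) _; apply/rootP/model_root.
have fL0 : map_poly (emb L psi) f != 0 by rewrite -size_poly_eq0 size_map_emb size_poly_eq0.
have le1 := dvdp_leq fL0 m_dvd.
have le2 : (size (map_poly (emb L psi) f) <= size (minPoly 1 al))%N.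
  have /polyOver1P [q Eq] := minPolyOver 1 al.
  have [b [g [b0 E]]] := clear_denominators q frac.
  have /ker [r Er] : evp (emb L psi) al g = 0.
    rewrite /evp /= /horner_eval /emb map_poly_comp -E linearZ /= hornerZ -Eq.
    by rewrite minPolyxx mulr0.
  have pb0 : psi b != 0 by rewrite -(rmorph0 psi) (inj_eq inj).
  have sg : size g = size (minPoly 1 al).
    rewrite Eq size_map_poly -(size_scale q pb0) E.
    by rewrite (size_map_inj_poly inj (rmorph0 _)).
  have r0 : r != 0.
    apply: contraNneq b0 => r0; have : size g == 0%N by rewrite Er r0 mul0r size_poly0.
    by rewrite sg size_minPoly.
  rewrite size_map_emb -sg Er size_mul //; move: r0; rewrite -size_poly_gt0.
  by move: (size r) (size f) => [|x] y; rewrite ?addSn ?leq_addl.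
have : minPoly 1 al %= map_poly (emb L psi) f.
  by rewrite -(dvdp_size_eqp m_dvd) eqn_leq le1 le2.
rewrite eqp_sym => /eqpfP; rewrite lead_coef_map_emb (monicP (monic_minPoly 1 al)).
by rewrite divr1.
Qed.
End OneModel.
End Models.

(** * Specialization of Galois groups *)

Lemma model_gal_roots (S : idomainType) (f : {poly S}) (k : fieldType)
    (L : splittingFieldType k) (psi : {rmorphism S -> k}) (al : L) :
  model f psi al -> galois 1 {:L} ->
  minPoly 1 al = \prod_(s in 'Gal({:L} / 1)%g) ('X - (s al)%:P) /\
  (size f).-1 = #|'Gal({:L} / 1)%g|.
Proof.
move=> mod galL; have [_ _ _ gen] := mod.
have [r [sr ur Em]] := galois_factors (sub1v _) galL al (memvf al).
have cardG : (size (minPoly 1 al)).-1 = #|'Gal({:L} / 1)%g|.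
  by rewrite size_minPoly /= adjoin_degreeE gen galois_dim.
have sm : size (minPoly 1 al) = size f.
  have l0 : emb L psi (lead_coef f) != 0.
    by rewrite (emb_eq0 mod) lead_coef_eq0 (model_neq0 mod).
  by rewrite -(size_scale _ l0) -(model_minPoly mod) (size_map_emb mod).
split; last by rewrite -sm.
have ur' : uniq r by apply: map_uniq ur.
have eqr : r =i 'Gal({:L} / 1)%g.
  apply/subset_cardP => //; rewrite (card_uniqP ur') -cardG Em.
  by rewrite size_prod_XsubC size_map.
rewrite Em big_map -big_filter filter_predT big_uniq //=.
by apply: eq_bigl => s; rewrite eqr.
Qed.

Lemma model_galois (S : idomainType) (f : {poly S}) (k : fieldType)
    (L : splittingFieldType k) (psi : {rmorphism S -> k}) (al : L) :
  model f psi al -> f^`() != 0 -> galois 1 {:L}.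
Proof.
move=> mod sep; have l0 : emb L psi (lead_coef f) != 0.
  by rewrite (emb_eq0 mod) lead_coef_eq0 (model_neq0 mod).
have sep_al : separable_element 1 al.
  rewrite separable_nz_der; apply: contraNneq sep => E.
  rewrite -size_poly_eq0 -(size_map_emb mod) -deriv_map.
  by rewrite (model_minPoly mod) derivZ E scaler0 size_poly0.
have [_ _ _ gen] := mod.
rewrite /galois sub1v normalFieldf andbT -gen.
by apply/separableP => y; apply: (adjoin_separableP sep_al).
Qed.

Section Place.
Variables (S S' : idomainType) (red : {rmorphism S -> S'}) (f : {poly S}).
Variables (k k' : fieldType) (L : fieldExtType k) (L' : fieldExtType k').
Variables (psi : {rmorphism S -> k}) (psi' : {rmorphism S' -> k'}) (al : L) (al' : L').
Hypotheses (mod : model f psi al) (mod' : model (map_poly red f) psi' al').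

Let ev : {rmorphism {poly S} -> L} := evp (emb L psi) al.
Let ev' : {rmorphism {poly S} -> L'} := evp (emb L' psi') al' \o map_poly red.

Lemma place_ker g : ev g = 0 -> ev' g = 0.
Proof.
have [_ _ ker _] := mod; have [_ _ ker' _] := mod'.
by move=> /ker [q ->]; apply/ker'; exists (map_poly red q); rewrite rmorphM.
Qed.

(* [z] lies in the local ring of [S[al]] at the kernel of [al |-> al'], with
   residue [z']. *)
Definition place (z : L) (z' : L') : Prop :=
  exists g q, [/\ ev' q != 0, z * ev q = ev g & z' * ev' q = ev' g].

Let ev_neq0 q : ev' q != 0 -> ev q != 0.
Proof. by apply: contraNneq => /place_ker/eqP. Qed.

(** By cross-multiplication this reduces to [place_ker]: what vanishes at [al] vanishes at [al'].
    Uniqueness lets the relation serve as a residue map. *)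
Lemma place_inj z z1 z2 : place z z1 -> place z z2 -> z1 = z2.
Proof.
move=> [g1 [q1 [n1 E1 E1']]] [g2 [q2 [n2 E2 E2']]].
apply: (mulIf (mulf_neq0 n1 n2)); rewrite mulrA E1' [ev' q1 * _]mulrC mulrA E2'.
apply/eqP; rewrite -subr_eq0 -!rmorphM -rmorphB; apply/eqP/place_ker.
rewrite rmorphB !rmorphM -E1 -E2; ring.
Qed.

Lemma place_ev g : place (ev g) (ev' g).
Proof. by exists g, 1; rewrite !rmorph1 !mulr1 oner_eq0. Qed.

Lemma place_add z1 z1' z2 z2' : place z1 z1' -> place z2 z2' -> place (z1 + z2) (z1' + z2').
Proof.
move=> [g1 [q1 [n1 E1 E1']]] [g2 [q2 [n2 E2 E2']]].
exists (g1 * q2 + g2 * q1), (q1 * q2).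
by rewrite rmorphM mulf_neq0 // !rmorphD !rmorphM -E1 -E2 -E1' -E2'; split=> //; ring.
Qed.

Lemma place_mul z1 z1' z2 z2' : place z1 z1' -> place z2 z2' -> place (z1 * z2) (z1' * z2').
Proof.
move=> [g1 [q1 [n1 E1 E1']]] [g2 [q2 [n2 E2 E2']]].
exists (g1 * g2), (q1 * q2).
by rewrite rmorphM mulf_neq0 // !rmorphM -E1 -E2 -E1' -E2'; split=> //; ring.
Qed.

Lemma place_inv z z' : z' != 0 -> place z z' -> place z^-1 z'^-1.
Proof.
move=> z'0 [g [q [n E E']]].
have g'0 : ev' g != 0 by rewrite -E' mulf_neq0.
have g0 := ev_neq0 g'0.
have z0 : z != 0 by apply: contraNneq g0 => z0; rewrite -E z0 mul0r.
exists q, g; split=> //; first by rewrite -E mulKf.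
by rewrite -E' mulKf.
Qed.

Lemma place_emb a : place (emb L psi a) (emb L' psi' (red a)).
Proof.
have := place_ev a%:P; rewrite /ev /ev' /=; congr place; first exact: evpC.
by rewrite -[RHS](evpC _ al'); congr evp; apply: map_polyC.
Qed.

Lemma place_gen : place al al'.
Proof.
have := place_ev 'X; rewrite /ev /ev' /=; congr place; first exact: evpX.
by rewrite map_polyX evpX.
Qed.

Lemma place0 : place 0 0.
Proof. by have := place_ev 0; rewrite !rmorph0. Qed.

Lemma place1 : place 1 1.
Proof. by have := place_ev 1; rewrite !rmorph1. Qed.

Lemma place_opp z z' : place z z' -> place (- z) (- z').
Proof.
move=> Hz; rewrite -mulN1r -[- z']mulN1r; apply: place_mul => //.
by have := place_ev (- 1); rewrite !rmorphN !rmorph1.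
Qed.

Lemma place_sum (I : Type) (r : seq I) (P : pred I) (F : I -> L) (F' : I -> L') :
  (forall i, P i -> place (F i) (F' i)) ->
  place (\sum_(i <- r | P i) F i) (\sum_(i <- r | P i) F' i).
Proof. by move=> H; elim/big_ind2: _ => //; [apply: place0 | move=> *; apply: place_add]. Qed.

Lemma place_exp z z' n : place z z' -> place (z ^+ n) (z' ^+ n).
Proof.
move=> Hz; elim: n => [|n IH]; first by rewrite !expr0; apply: place1.
by rewrite !exprS; apply: place_mul.
Qed.

Lemma place_evp z z' g : place z z' ->
  place (evp (emb L psi) z g) (evp (emb L' psi') z' (map_poly red g)).
Proof.
move=> Hz; elim/poly_ind: g => [|g c IH]; first by rewrite !rmorph0; apply: place0.
rewrite !rmorphD !rmorphM /= map_polyX map_polyC !evpX !evpC.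
by apply: place_add; [apply: place_mul | apply: place_emb].
Qed.

Definition place_poly (p : {poly L}) (p' : {poly L'}) : Prop :=
  forall i, place p`_i p'`_i.

Lemma place_polyM p p' q q' : place_poly p p' -> place_poly q q' ->
  place_poly (p * q) (p' * q').
Proof.
by move=> Hp Hq i; rewrite !coefM; apply: place_sum => l _; apply: place_mul.
Qed.

Lemma place_polyC c c' : place c c' -> place_poly c%:P c'%:P.
Proof. by move=> Hc i; rewrite !coefC; case: (i == 0)%N => //; apply: place0. Qed.

Lemma place_poly_lin a a' b b' : place a a' -> place b b' ->
  place_poly (a *: 'X - b%:P) (a' *: 'X - b'%:P).
Proof.
move=> Ha Hb i; rewrite !coefB !coefZ !coefX !coefC; apply: place_add.
  by case: (i == 1)%N; rewrite ?mulr1 ?mulr0 //; apply: place0.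
by apply: place_opp; case: (i == 0)%N => //; apply: place0.
Qed.

Lemma place_poly_XsubC b b' : place b b' -> place_poly ('X - b%:P) ('X - b'%:P).
Proof.
by move=> Hb; have := place_poly_lin place1 Hb; rewrite !scale1r.
Qed.

Lemma place_poly_prod (I : Type) (r : seq I) (P : pred I) (F : I -> {poly L}) F' :
  (forall i, P i -> place_poly (F i) (F' i)) ->
  place_poly (\prod_(i <- r | P i) F i) (\prod_(i <- r | P i) F' i).
Proof.
by move=> H; elim/big_ind2: _ => //; [apply: place_polyC; apply: place1 | move=> *; apply: place_polyM].
Qed.

Lemma place_poly_inj p p1 p2 : place_poly p p1 -> place_poly p p2 -> p1 = p2.
Proof. by move=> H1 H2; apply/polyP => i; apply: place_inj (H1 i) (H2 i). Qed.

Lemma place_poly_map g :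
  place_poly (map_poly (emb L psi) g) (map_poly (emb L' psi') (map_poly red g)).
Proof. by move=> i; rewrite !coef_map; apply: place_emb. Qed.
End Place.

Lemma gal_evp (S : idomainType) (k : fieldType) (L : splittingFieldType k)
    (psi : {rmorphism S -> k}) s (z : L) g : s \in 'Gal({:L} / 1)%g -> s (evp (emb L psi) z g) = evp (emb L psi) (s z) g.
Proof.
move=> sG; elim/poly_ind: g => [|g c IH]; first by rewrite !rmorph0.
rewrite !rmorphD !rmorphM /= !evpX !evpC IH; congr (_ + _).
apply: (fixed_gal (sub1v _) sG); rewrite /emb /=.
by rewrite rpredZ // rpred1.
Qed.

Section Specialization.
Variables (S S' : idomainType) (red : {rmorphism S -> S'}) (f : {poly S}).
Variables (k k' : fieldType) (L : splittingFieldType k).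
Variables (psi : {rmorphism S -> k}) (psi' : {rmorphism S' -> k'}) (al : L).
Hypothesis mod : model f psi al.
Hypothesis galL : galois 1 {:L}.
Local Notation G := 'Gal({:L} / 1)%g.

Lemma model_split : map_poly (emb L psi) f =
  (emb L psi (lead_coef f))%:P * \prod_(s in G) ('X - (s al)%:P).
Proof.
by rewrite (model_minPoly mod) (proj1 (model_gal_roots mod galL)) mul_polyC.
Qed.

Section Roots.
Variables (L' : fieldExtType k') (al' : L').
Hypothesis mod' : model (map_poly red f) psi' al'.
Variable c : gal_of {:L} -> L'.
Hypothesis Hc : forall s, s \in G -> place red psi psi' al al' (s al) (c s).

(** Both sides are, coefficient by coefficient, residues of the split form of [f]. *)
Lemma specialization_split : map_poly (emb L' psi') (map_poly red f) =
  (emb L' psi' (red (lead_coef f)))%:P * \prod_(s in G) ('X - (c s)%:P).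
Proof.
apply: (place_poly_inj mod mod' (place_poly_map red psi psi' al al' f)).
rewrite model_split; apply: place_polyM; first by apply/place_polyC/place_emb.
by apply: place_poly_prod => s sG; apply/place_poly_XsubC/Hc.
Qed.

Lemma specialization_splitting_axiom : splitting_field_axiom L'.
Proof.
have f'0 := model_neq0 mod'.
exists (map_poly (emb L' psi') (map_poly red f)); first exact: map_emb_polyOver.
exists [seq c s | s in G].
  rewrite specialization_split mul_polyC big_image /=.
  have l0 : emb L' psi' (red (lead_coef f)) != 0.
    apply: contraNneq f'0 => E; rewrite -size_poly_eq0 -(size_map_emb mod').
    by rewrite specialization_split E mul0r size_poly0.
  by apply: eqp_scale.
have [_ _ _ gen'] := mod'.
apply/eqP; rewrite eqEsubv subvf /= -gen'; apply/FadjoinP; split; first exact: sub1v.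
apply: seqv_sub_adjoin.
have l0 : emb L' psi' (red (lead_coef f)) != 0.
  apply: contraNneq f'0 => E; rewrite -size_poly_eq0 -(size_map_emb mod').
  by rewrite specialization_split E mul0r size_poly0.
have := model_root mod'; rewrite /evp /= /horner_eval specialization_split.
rewrite mul_polyC hornerZ => /eqP; rewrite mulf_eq0 (negPf l0) /=.
have -> : \prod_(s in G) ('X - (c s)%:P) = \prod_(z <- [seq c s | s in G]) ('X - z%:P).
  by rewrite big_image.
by rewrite -[_ == 0]/(root _ al') root_prod_XsubC.
Qed.
End Roots.

Section Isomorphism.
Variables (L' : splittingFieldType k') (al' : L').
Hypothesis mod' : model (map_poly red f) psi' al'.
Hypothesis sep' : (map_poly red f)^`() != 0.
Hypothesis size' : size (map_poly red f) = size f.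
Variable c : gal_of {:L} -> L'.
Hypothesis Hc : forall s, s \in G -> place red psi psi' al al' (s al) (c s).
Local Notation G' := 'Gal({:L'} / 1)%g.

(** The [c s] list the roots of the reduction of [f] with multiplicity, and this reduction is
    separable. *)
Lemma specialization_uniq : {in G &, injective c}.
Proof.
have galL' := model_galois mod' sep'.
have l0 : emb L' psi' (lead_coef (map_poly red f)) != 0.
  by rewrite (emb_eq0 mod') lead_coef_eq0 (model_neq0 mod').
have lE : red (lead_coef f) = lead_coef (map_poly red f).
  by rewrite !lead_coefE size' coef_map.
have := specialization_split mod' Hc; rewrite lE (model_minPoly mod') mul_polyC.
move/(scalerI l0); rewrite (proj1 (model_gal_roots mod' galL')) => E.
have : uniq [seq c s | s in G].
  rewrite -separable_prod_XsubC big_image /= -E.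
  have -> : \prod_(s in G') ('X - (s al')%:P) = minPoly 1 al'.
    by rewrite (proj1 (model_gal_roots mod' galL')).
  have /and3P[_ /separableP sep _] := galL'.
  exact: sep (memvf al').
by move/dinjectiveP.
Qed.

(** The automorphism induced by [s] on the residue field, found as the one sending [al'] to the
    residue of [s al]; by [thP] the default value is never taken on the group. *)
Let th s : gal_of {:L'} := odflt 1%g [pick t in G' | t al' == c s].

Let thP s : s \in G -> th s \in G' /\ th s al' = c s.
Proof.
move=> sG; rewrite /th; case: pickP => [t /andP[tG /eqP]//|H].
have l0 : emb L' psi' (lead_coef (map_poly red f)) != 0.
  by rewrite (emb_eq0 mod') lead_coef_eq0 (model_neq0 mod').
have rt : root (minPoly 1 al') (c s).
  have lE : red (lead_coef f) = lead_coef (map_poly red f).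
    by rewrite !lead_coefE size' coef_map.
  have := specialization_split mod' Hc; rewrite lE (model_minPoly mod') mul_polyC.
  move/(scalerI l0) ->.
  have -> : \prod_(s in G) ('X - (c s)%:P) = \prod_(z <- [seq c s | s in G]) ('X - z%:P).
    by rewrite big_image.
  by rewrite root_prod_XsubC; apply/imageP; exists s.
have [t tG Et] := normalField_root_minPoly (sub1v _) (normalFieldf 1) (memvf al') rt.
by have := H t; rewrite /= tG Et eqxx.
Qed.

(** Write [z] as [g(al) / q(al)]. The denominator of [s z] is [q(s al)], whose residue is the image
    under [th s] of the residue of [q(al)], hence nonzero: [s] preserves the local ring and acts on
    residues by [th s]. *)
Lemma place_gal s z z' : s \in G -> place red psi psi' al al' z z' ->
  place red psi psi' al al' (s z) (th s z').
Proof.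
move=> sG [g [q [n E E']]]; have [tG Et] := thP sG.
have gev p : th s (evp (emb L' psi') al' p) = evp (emb L' psi') (c s) p.
  by rewrite (gal_evp _ _ _ tG) Et.
have n' : evp (emb L' psi') (c s) (map_poly red q) != 0.
  by rewrite -gev fmorph_eq0.
have Hs p := place_evp p (Hc sG).
have -> : s z = evp (emb L psi) (s al) g * (evp (emb L psi) (s al) q)^-1.
  have q0 : evp (emb L psi) (s al) q != 0.
    rewrite -(gal_evp _ _ _ sG) fmorph_eq0; apply: contraNneq n.
    by move/(place_ker mod mod')/eqP.
  by apply: (mulIf q0); rewrite mulfVK // -!(gal_evp _ _ _ sG) -rmorphM E.
have -> : th s z' = evp (emb L' psi') (c s) (map_poly red g) * (evp (emb L' psi') (c s) (map_poly red q))^-1.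
  by apply: (mulIf n'); rewrite mulfVK // -!gev -rmorphM; congr (th s _).
by apply: place_mul; [exact: Hs | apply: (place_inv mod mod') => //; exact: Hs].
Qed.

Let th_inj t t' : t \in G' -> t' \in G' -> t al' = t' al' -> t = t'.
Proof.
move=> tG tG' E; apply/eqP/gal_eqP => y _; have [_ _ _ gen'] := mod'.
have /Fadjoin1_polyP [q ->] : y \in <<1; al'>>%VS by rewrite gen' memvf.
have H (u : gal_of {:L'}) : u \in G' -> u (map_poly (in_alg L') q).[al'] = (map_poly (in_alg L') q).[u al'].
  move=> uG; rewrite -horner_map; congr (_.[_]); rewrite -map_poly_comp; apply: eq_map_poly => x /=.
  by apply: (fixed_gal (sub1v _) uG); rewrite rpredZ // rpred1.
by rewrite !H // E.
Qed.

Let thM : {in G &, {morph th : s t / (s * t)%g}}.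
Proof.
move=> s t sG tG; have stG := groupM sG tG.
have [sG' Es] := thP sG; have [tG' Et] := thP tG; have [stG' Est] := thP stG.
have [_ _ _ gen'] := mod'.
apply: th_inj; rewrite ?groupM // galM ?memvf // Es Est.
(* The product [s * t] of the group applies [s] first, so both sides are residues of [t (s al)]. *)
apply: (place_inj mod mod' (Hc stG)); rewrite galM ?memvf //.
by apply: place_gal tG (Hc sG).
Qed.

Theorem specialization_isog : (G \isog G')%g.
Proof.
have galL' := model_galois mod' sep'.
apply: (isom_isog (Morphism thM)) => //; apply/isomP.
have injth : ('injm (Morphism thM))%g.
  apply/injmP => s t sG tG /= E; apply: specialization_uniq => //.
  by rewrite -(proj2 (thP sG)) -(proj2 (thP tG)) E.
split=> //; apply/eqP; rewrite eqEcard card_injm // -(proj2 (model_gal_roots mod' galL')).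
rewrite -(proj2 (model_gal_roots mod galL)) size' leqnn andbT.
by apply/subsetP => _ /morphimP[s _ sG ->]; have [] := thP sG.
Qed.
End Isomorphism.
End Specialization.

(** * The valuation attached to a prime element of the base *)

Section Reduction.
Variables (S S' : idomainType) (red : {rmorphism S -> S'}) (X : S) (f : {poly S}).

Definition prime_reduction : Prop :=
  [/\ X != 0, red X = 0, forall a', exists a, red a = a',
      forall a, red a = 0 -> exists b, a = X * b
    & forall a, a != 0 -> exists m a', a = X ^+ m * a' /\ red a' != 0].

Hypothesis Xred : prime_reduction.

Lemma reduction_lift (q' : {poly S'}) : exists q, map_poly red q = q'.
Proof.
case: Xred => _ _ surj _ _; elim/poly_ind: q' => [|q' c' [q Eq]]; first by exists 0; rewrite rmorph0.
have [c Ec] := surj c'; exists (q * 'X + c%:P).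
by rewrite rmorphD rmorphM /= map_polyX map_polyC /= Eq Ec.
Qed.

Lemma reduction_ker (q : {poly S}) : map_poly red q = 0 -> exists q1, q = X%:P * q1.
Proof.
case: Xred => _ _ _ ker _; elim/poly_ind: q => [|q c IH]; first by exists 0; rewrite mulr0.
rewrite rmorphD rmorphM /= map_polyX map_polyC /= => E.
have Ec : red c = 0.
  by have := congr1 (fun p : {poly S'} => p`_0) E; rewrite coefD coefMX coefC eqxx coef0 add0r.
have Eq : map_poly red q = 0.
  apply/polyP => i; have := congr1 (fun p : {poly S'} => p`_i.+1) E.
  by rewrite coefD coefMX coefC !coef0 addr0.
have [q1 ->] := IH Eq; have [b ->] := ker c Ec.
by exists (q1 * 'X + b%:P); rewrite polyCM; ring.
Qed.

Section Order.
Variables (k k' : fieldType) (L : fieldExtType k) (L' : fieldExtType k').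
Variables (psi : {rmorphism S -> k}) (psi' : {rmorphism S' -> k'}) (al : L) (al' : L').
Hypotheses (mod : model f psi al) (mod' : model (map_poly red f) psi' al').
Local Notation pl := (place red psi psi' al al').
Local Notation jX := (emb L psi X).

Lemma jX_neq0 : jX != 0.
Proof. by case: Xred => X0 _ _ _ _; rewrite (emb_eq0 mod). Qed.

Lemma place_X : pl jX 0.
Proof.
by case: Xred => _ rX _ _ _; have := place_emb red psi psi' al al' X; rewrite rX rmorph0.
Qed.

Lemma place_Xn n : (0 < n)%N -> pl (jX ^+ n) 0.
Proof.
by move=> n0; have := place_exp n place_X; rewrite expr0n gtn_eqF.
Qed.

(** The kernel of the residue map on [S[T]] is generated by [X] and [f], so an element with residue
    zero is divisible by [X]. If this never stopped, multiplying by an inverse [B(al) / b] would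
    make [b] divisible beyond its own order at [X]. *)
Lemma order_evp g : evp (emb L psi) al g != 0 ->
  exists m u u', [/\ pl u u', u' != 0 & evp (emb L psi) al g = jX ^+ m * u].
Proof.
move=> g0; apply: NNPP => Hno.
have step m : exists gm, evp (emb L psi) al g = jX ^+ m * evp (emb L psi) al gm.
  elim: m => [|m [gm IH]]; first by exists g; rewrite expr0 mul1r.
  have E' : evp (emb L' psi') al' (map_poly red gm) = 0.
    apply/eqP; apply: contra_notT Hno => gm0.
    exists m, (evp (emb L psi) al gm), (evp (emb L' psi') al' (map_poly red gm)).
    by split=> //; apply: place_ev.
  have [_ _ ker' _] := mod'; have /ker' [q' Eq'] := E'.
  have [q Eq] := reduction_lift q'.
  have [|g1 Eg1] := @reduction_ker (gm - q * f).
    by rewrite rmorphB rmorphM /= Eq' Eq subrr.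
  exists g1; rewrite IH exprSr -mulrA; congr (_ * _).
  have -> : gm = X%:P * g1 + q * f by rewrite -Eg1 subrK.
  by rewrite rmorphD !rmorphM /= evpC (model_root mod) mulr0 addr0.
have [b [B [b0 EB]]] := model_elem mod (evp (emb L psi) al g)^-1.
have [_ _ _ _ adic] := Xred; have [m [b' [Eb rb']]] := adic b b0.
have [gm Egm] := step m.+1.
have E : emb L psi b' = jX * evp (emb L psi) al (B * gm).
  apply: (mulfI (expf_neq0 m jX_neq0)); rewrite -rmorphXn -rmorphM -Eb.
  rewrite -[LHS](divfK g0) EB {1}Egm rmorphM exprS rmorphXn; ring.
have [_ H0] := (place_emb red psi psi' al al' b', mod).
have H1 : pl (emb L psi b') 0.
  by rewrite E -(mul0r (evp (emb L' psi') al' (map_poly red (B * gm)))); apply: place_mul (place_ev _ _ _ _ _ _); apply: place_X.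
have := place_inj mod mod' (place_emb red psi psi' al al' b') H1.
by move/eqP; rewrite (emb_eq0 mod') (negPf rb').
Qed.

(** Numerator and denominator both have an order at [X]. Comparing the two decides between an
    element with a residue and one with a pole of order [l], which [X ^+ l] turns into a unit. *)
Lemma order_dichotomy z : (exists z', pl z z') \/
  exists l u u', [/\ (0 < l)%N, pl u u', u' != 0 & z * jX ^+ l = u].
Proof.
have [->|z0] := eqVneq z 0; first by left; exists 0; apply: place0.
have [b [g [b0 Eg]]] := model_elem mod z.
have eb0 : emb L psi b != 0 by rewrite (emb_eq0 mod).
have [|n [u [u' [plu u'0 Eu]]]] := @order_evp g; first by rewrite -Eg mulf_neq0.
have [_ _ _ _ adic] := Xred; have [m [b' [Eb rb']]] := adic b b0.
have b'0 : emb L psi b' != 0.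
  by rewrite (emb_eq0 mod); apply: contraNneq rb' => ->; rewrite rmorph0.
have b'0' : emb L' psi' (red b') != 0 by rewrite (emb_eq0 mod').
pose v := u * (emb L psi b')^-1; pose v' := u' * (emb L' psi' (red b'))^-1.
have plv : pl v v' by apply: place_mul => //; apply: (place_inv mod mod') => //; apply: place_emb.
have v'0 : v' != 0 by rewrite mulf_neq0 // invr_eq0.
have Ez : z * jX ^+ m = jX ^+ n * v.
  apply: (mulIf b'0); rewrite -mulrA -rmorphXn -rmorphM -Eb mulrC Eg Eu.
  by rewrite mulrA mulfVK.
have [le_mn|lt_nm] := leqP m n.
  left; exists (0 ^+ (n - m) * v').
  have -> : z = jX ^+ (n - m) * v.
    apply: (mulIf (expf_neq0 m jX_neq0)); rewrite Ez -{1}(subnK le_mn) exprD; ring.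
  by apply: place_mul => //; apply: place_exp place_X.
right; exists (m - n)%N, v, v'; split=> //; first by rewrite subn_gt0.
apply: (mulIf (expf_neq0 n jX_neq0)); rewrite -mulrA -exprD subnK ?Ez 1?ltnW //.
by rewrite mulrC.
Qed.

(** If [y] had a pole of order [l], the residue of [f(y) = 0] times [X ^+ (l * D)] would be that of
    the top term alone, a product of nonzero factors. *)
Lemma place_integral y : red (lead_coef f) != 0 -> evp (emb L psi) y f = 0 ->
  exists y', pl y y'.
Proof.
move=> lf Ey; have [//|[l [u [u' [l0 plu u'0 Eu]]]]] := order_dichotomy y.
have f0 : (0 < size f)%N by rewrite size_poly_gt0 (model_neq0 mod).
pose D := (size f).-1.
have sf : size f = D.+1 by rewrite prednK.
have : pl 0 (emb L' psi' (red (lead_coef f)) * u' ^+ D).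
  have -> : 0 = \sum_(i < D.+1) (emb L psi f`_i * u ^+ i) * jX ^+ (l * (D - i)).
    transitivity (evp (emb L psi) y f * jX ^+ (l * D)); first by rewrite Ey mul0r.
    rewrite /evp /= /horner_eval horner_coef.
    rewrite (size_map_emb mod) sf mulr_suml; apply: eq_bigr => i _; rewrite coef_map -Eu.
    rewrite exprMn -exprM -!mulrA -exprD; congr (_ * (_ * _ ^+ _)).
    by rewrite -mulnDr subnKC // -ltnS.
  have -> : emb L' psi' (red (lead_coef f)) * u' ^+ D =
     \sum_(i < D.+1) (emb L' psi' (red f`_i) * u' ^+ i) * 0 ^+ (l * (D - i)).
    rewrite (bigD1 ord_max) //= subnn muln0 expr0 mulr1 big1 ?addr0 => [|i ni].
      by rewrite lead_coefE sf.
    have lt_i : (i < D)%N.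
      by rewrite ltn_neqAle -ltnS ltn_ord andbT; apply: contraNneq ni => E; apply/eqP/val_inj.
    by rewrite expr0n muln_eq0 (gtn_eqF l0) subn_eq0 leqNgt lt_i mulr0.
  apply: place_sum => i _; apply: place_mul; last by apply: place_exp place_X.
  by apply: place_mul; [apply: place_emb | apply: place_exp].
move/(place_inj mod mod' (place0 red psi psi' al al'))/esym/eqP.
by rewrite mulf_eq0 expf_eq0 (negPf u'0) andbF orbF (emb_eq0 mod') (negPf lf).
Qed.

Lemma place_base z z' : z \in 1%VS -> pl z z' -> z' \in 1%VS.
Proof.
move=> /vlineP [x ->] plz; have [_ frac _ _] := mod; have [a [b [b0 Ex]]] := frac x.
have bS0 : b != 0 by apply: contraNneq b0 => ->; rewrite rmorph0.
have in1 c : emb L' psi' c \in 1%VS by rewrite /emb /= rpredZ // rpred1.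
have [a0|a0] := eqVneq a 0.
  have -> : z' = 0; last by rewrite rpred0.
  apply: (place_inj mod mod' plz); rewrite Ex a0 rmorph0 mul0r scale0r; exact: place0.
have [_ _ _ _ adic] := Xred; have [i [a1 [Ea ra]]] := adic a a0.
have [l [b1 [Eb rb]]] := adic b bS0.
have eb1 : emb L psi b1 != 0.
  by rewrite (emb_eq0 mod); apply: contraNneq rb => ->; rewrite rmorph0.
have Ez : x%:A * (jX ^+ l * emb L psi b1) = jX ^+ i * emb L psi a1.
  rewrite -!rmorphXn -!rmorphM -Ea -Eb Ex /emb /= -scalerAl mul1r scalerA.
  by rewrite divfK.
have [le_li|lt_il] := leqP l i.
  have plq : pl x%:A (0 ^+ (i - l) * emb L' psi' (red a1) * (emb L' psi' (red b1))^-1).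
    have -> : x%:A = jX ^+ (i - l) * emb L psi a1 * (emb L psi b1)^-1.
      apply: (mulIf (mulf_neq0 (expf_neq0 l jX_neq0) eb1)); rewrite Ez -{1}(subnK le_li) exprD.
      by field.
    apply: place_mul; first by apply: place_mul; [apply: place_exp place_X | apply: place_emb].
    by apply: (place_inv mod mod'); [rewrite (emb_eq0 mod') | apply: place_emb].
  rewrite (place_inj mod mod' plz plq) rpredM ?rpredV ?rpredM //.
  case: (i - l)%N => [|m]; first by rewrite expr0 rpred1.
  by rewrite expr0n rpred0.
have E : x%:A * jX ^+ (l - i) * emb L psi b1 = emb L psi a1.
  apply: (mulfI (expf_neq0 i jX_neq0)); rewrite -Ez -{2}(subnK (ltnW lt_il)) exprD; ring.
have : pl (emb L psi a1) 0.
  rewrite -E -(mul0r (emb L' psi' (red b1))); apply: place_mul; last exact: place_emb.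
  by rewrite -(mulr0 z'); apply: place_mul => //; apply: place_Xn; rewrite subn_gt0.
move/(place_inj mod mod' (place_emb red psi psi' al al' a1))/eqP.
by rewrite (emb_eq0 mod') (negPf ra).
Qed.
End Order.
End Reduction.

(** * Residues and poles of the conjugates *)

Section Conjugates.
Variables (S S' : idomainType) (red : {rmorphism S -> S'}) (f : {poly S}).
Variables (k k' : fieldType) (L : splittingFieldType k) (L' : fieldExtType k').
Variables (psi : {rmorphism S -> k}) (psi' : {rmorphism S' -> k'}) (al : L) (al' : L').
Hypotheses (mod : model f psi al) (mod' : model (map_poly red f) psi' al').
Hypothesis galL : galois 1 {:L}.
Local Notation G := 'Gal({:L} / 1)%g.
Local Notation pl := (place red psi psi' al al').

Lemma conjugate_root s : s \in G -> evp (emb L psi) (s al) f = 0.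
Proof. by move=> sG; rewrite -(gal_evp _ _ _ sG) (model_root mod) rmorph0. Qed.

Lemma choose_residues : (forall s, s \in G -> exists y, pl (s al) y) ->
  exists c : gal_of {:L} -> L', forall s, s \in G -> pl (s al) (c s).
Proof.
move=> H; exists (fun s => epsilon (inhabits 0) (pl (s al))) => s sG.
exact: (epsilon_spec _ _ (H s sG)).
Qed.

Variable X : S.
Hypothesis Xred : prime_reduction red X.
Local Notation jX := (emb L psi X).

Lemma residues_unit_lead : red (lead_coef f) != 0 ->
  exists c : gal_of {:L} -> L', forall s, s \in G -> pl (s al) (c s).
Proof.
move=> lf; apply: choose_residues => s sG.
exact: (place_integral Xred mod mod' lf (conjugate_root sG)).
Qed.

Variable a : S.
Hypotheses (lead_f : lead_coef f = X * a) (ra : red a != 0).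

(* Gauss's lemma for the product of the [T - s al] leaves exactly one conjugate
   with a pole; it is simple and its residue generates the residue field over
   the base, because every other conjugate term of the traces below vanishes. *)
Lemma ramified_degree : (map_poly red f)^`() != 0 -> (size f).-1 = 2%N.
Proof.
move=> sep'; have jX0 := jX_neq0 Xred mod.
have f'0 := model_neq0 mod'.
(* [lP s] records the pole order of [s al] and the residue of ['X - (s al)%:P] multiplied by that
   power of [X]: a monic linear factor if there is no pole, a nonzero constant otherwise. *)
pose fits s (lP : nat * {poly L'}) :=
  [/\ place_poly red psi psi' al al' (jX ^+ lP.1 *: ('X - (s al)%:P)) lP.2, lP.2 != 0,
     lP.1 = 0%N -> exists2 c, pl (s al) c & lP.2 = 'X - c%:P
   & (0 < lP.1)%N -> exists u u', [/\ pl u u', u' != 0, s al * jX ^+ lP.1 = u & lP.2 = (- u')%:P]].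
have data s : exists lP, s \in G -> fits s lP.
  have [[c Hc]|[l [u [u' [l0 plu u'0 Eu]]]]] := order_dichotomy Xred mod mod' (s al).
    exists (0%N, 'X - c%:P) => sG; split=> //=.
    - by rewrite expr0 scale1r; apply: place_poly_XsubC.
    - by rewrite polyXsubC_eq0.
    - by move=> _; exists c.
  exists (l, (- u')%:P) => sG; split=> //=.
  - rewrite scalerBr -!mul_polyC -polyCM [_ * s al]mulrC Eu.
    have := place_poly_lin (place_Xn Xred psi psi' al al' l0) plu.
    by rewrite scale0r sub0r mul_polyC polyCN.
  - by rewrite polyC_eq0 oppr_eq0.
  - by move=> E; rewrite E in l0.
  - by move=> _; exists u, u'.
pose lP s := epsilon (inhabits (0%N, 0)) (fun lP => s \in G -> fits s lP).
have lPP s : s \in G -> fits s (lP s) := epsilon_spec (inhabits (0%N, 0)) _ (data s).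
pose N := (\sum_(s in G) (lP s).1)%N.
pose Q := \prod_(s in G) (lP s).2.
have Q0 : Q != 0 by apply/prodf_neq0 => s sG; have [] := lPP s sG.
have plQ : place_poly red psi psi' al al' (\prod_(s in G) (jX ^+ (lP s).1 *: ('X - (s al)%:P))) Q.
  by apply: place_poly_prod => s sG; have [] := lPP s sG.
have EP : jX ^+ N *: map_poly (emb L psi) f = (jX * emb L psi a)%:P *
    \prod_(s in G) (jX ^+ (lP s).1 *: ('X - (s al)%:P)).
  rewrite (model_split mod galL) lead_f rmorphM scaler_prod -prodrXr.
  by rewrite -!mul_polyC mulrCA.
have a'0 : emb L' psi' (red a) != 0 by rewrite (emb_eq0 mod').
have plf := place_poly_map red psi psi' al al' f.
have mf0 : map_poly (emb L' psi') (map_poly red f) != 0.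
  by rewrite -size_poly_eq0 (size_map_emb mod') size_poly_eq0.
have plaQ := place_polyM (place_polyC (place_emb red psi psi' al al' a)) plQ.
(* The leading coefficient of [f] carries exactly one [X]. In [EP], total pole order 0 would make
   the reduction of [f] zero, and order at least 2 would make zero a product of nonzero residues. *)
have N1 : N = 1%N.
  have [N0|N2] : N = 0%N \/ N = 1%N \/ (1 < N)%N by move: (N) => [|[|?]]; auto.
    case/eqP: mf0; apply: (place_poly_inj mod mod' plf).
    move: EP; rewrite N0 expr0 scale1r polyCM -mulrA => ->.
    have := place_polyM (place_polyC (place_X Xred psi psi' al al')) plaQ.
    by rewrite polyC0 mul0r.
  case: N2 => // N2.
  have EP' : (jX ^+ N.-1)%:P * map_poly (emb L psi) f =
      (emb L psi a)%:P * \prod_(s in G) (jX ^+ (lP s).1 *: ('X - (s al)%:P)).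
    have jXP : jX%:P != 0 by rewrite polyC_eq0.
    apply: (mulfI jXP); rewrite !mulrA -!polyCM -EP -mul_polyC -exprS prednK //.
    exact: ltnW.
  have N0' : (0 < N.-1)%N by rewrite -subn1 subn_gt0.
  have := place_polyM (place_polyC (place_Xn Xred psi psi' al al' N0')) plf.
  rewrite EP' polyC0 mul0r => H.
  have := place_poly_inj mod mod' H plaQ => /esym/eqP.
  by rewrite mulf_eq0 polyC_eq0 (negPf a'0) (negPf Q0).
have [s0 s0G l0] : exists2 s0, s0 \in G & (lP s0).1 != 0%N.
  apply: NNPP => H; have : N = 0%N; last by rewrite N1.
  rewrite /N big1 // => s sG; have [//|ls] := eqVneq (lP s).1 0%N.
  by case: H; exists s.
have [ls0 lG] : (lP s0).1 = 1%N /\ forall s, s \in G -> s != s0 -> (lP s).1 = 0%N.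
  move: N1; rewrite /N (bigD1 s0) //= => E.
  have Es : (lP s0).1 = 1%N by move: l0 E; case: (lP s0).1 => [|[|l]].
  split=> // s sG ns; move: E; rewrite Es add1n => -[/eqP].
  by rewrite sum_nat_eq0 => /forallP/(_ s); rewrite sG ns => /eqP.
have plG s : s \in G -> s != s0 -> exists2 c, pl (s al) c & (lP s).2 = 'X - c%:P.
  by move=> sG ns; have [_ _ H _] := lPP s sG; apply: H; apply: lG.
have [u [u' [plu u'0 Eu Eu']]] : exists u u', [/\ pl u u', u' != 0, s0 al * jX = u & (lP s0).2 = (- u')%:P].
  by have [_ _ _ H] := lPP s0 s0G; have := H; rewrite -/(lP s0) ls0 expr1; apply.
have s01 : s0 != 1%g.
  apply: contraNneq u'0 => E; apply/eqP; apply: (place_inj mod mod' plu).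
  rewrite -Eu E gal_id -(mulr0 al'); apply: place_mul; first exact: place_gen.
  exact: (place_X Xred).
have Ef' : map_poly (emb L' psi') (map_poly red f) = (emb L' psi' (red a))%:P * Q.
  apply: (place_poly_inj mod mod' plf); have -> : map_poly (emb L psi) f =
      (emb L psi a)%:P * \prod_(s in G) (jX ^+ (lP s).1 *: ('X - (s al)%:P)); last exact: plaQ.
  have jXP : jX%:P != 0 by rewrite polyC_eq0.
  by apply: (mulfI jXP); rewrite mulrA -polyCM -EP N1 expr1 mul_polyC.
have sizeQ : size (map_poly red f) = #|G|.
  rewrite -(size_map_emb mod') Ef' mul_polyC size_scale // /Q (bigD1 s0) //= Eu'.
  rewrite mul_polyC size_scale ?oppr_eq0 //.
  pose c s := epsilon (inhabits 0) (fun c => (lP s).2 = 'X - c%:P).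
  rewrite (eq_bigr (fun s => 'X - (c s)%:P)); last first.
    move=> s /andP[sG ns]; have [x _ Ex] := plG s sG ns.
    exact: (epsilon_spec _ (fun c => (lP s).2 = 'X - c%:P) (ex_intro _ x Ex)).
  rewrite (eq_bigl (mem (G :\ s0))); last by move=> s; rewrite inE in_setD1 andbC.
  have -> : \prod_(s in G :\ s0) ('X - (c s)%:P) =
      \prod_(z <- [seq c s | s in G :\ s0]) ('X - z%:P) by rewrite big_image.
  by rewrite size_prod_XsubC size_map -cardE [RHS](cardsD1 s0) s0G.
have Gtrace z : (\sum_(s in G) s z) \in 1%VS by apply: (mem_galTrace galL (memvf z)).
have s0s s : s \in G -> s != 1%g -> (s0 * s)%g \in G /\ (s0 * s)%g != s0.
  by move=> sG ns; split; [rewrite groupM | rewrite -[X in _ != X]mulg1 (inj_eq (mulgI s0))].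
(* [s u] is [X] times the image of [al] under [s0 * s], a conjugate without pole unless [s] is the
   identity. *)
have place_su s : s \in G -> s != 1%g -> exists y y', s u = jX * y /\ pl y y'.
  move=> sG ns; have [ssG nss] := s0s s sG ns; have [y' Hy _] := plG _ ssG nss.
  exists ((s0 * s)%g al), y'; split=> //; rewrite -Eu rmorphM /= galM ?memvf // mulrC.
  by congr (_ * _); apply: (fixed_gal (sub1v _) sG); rewrite /emb /= rpredZ // rpred1.
have G1 : (1%g : gal_of {:L}) \in G by apply: group1.
have tr1 : pl (\sum_(s in G) s u) u'.
  rewrite (bigD1 1%g) //= gal_id -[X in pl _ X]addr0; apply: place_add => //.
  have -> : 0 = \sum_(s in G | s != 1%g) (0 : L') by rewrite big1.
  apply: place_sum => s /andP[sG ns]; have [y [y' [-> Hy]]] := place_su s sG ns.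
  by rewrite -(mul0r y'); apply: place_mul => //; exact: (place_X Xred).
(* The exponent 2 is what the term [s = s0] needs: there [s al] has a simple pole, which uses up one
   [X] of the square of [s u] and leaves another. *)
have tr2 : pl (\sum_(s in G) s (u ^+ 2 * al)) (u' ^+ 2 * al').
  rewrite (bigD1 1%g) //= gal_id -[X in pl _ X]addr0; apply: place_add.
    by apply: place_mul; [apply: place_exp | apply: place_gen].
  have -> : 0 = \sum_(s in G | s != 1%g) (0 : L') by rewrite big1.
  apply: place_sum => s /andP[sG ns]; have [y [y' [Ey Hy]]] := place_su s sG ns.
  rewrite rmorphM rmorphXn /= Ey.
  have plX := place_X Xred psi psi' al al'.
  have [Es|ns0] := eqVneq s s0.
    have -> : (jX * y) ^+ 2 * s al = jX * (y ^+ 2 * u) by rewrite Es -Eu; ring.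
    by rewrite -(mul0r (y' ^+ 2 * u')); apply: place_mul => //; apply: place_mul => //; apply: place_exp.
  have [x Hx _] := plG s sG ns0.
  have -> : (jX * y) ^+ 2 * s al = jX * (jX * y ^+ 2 * s al) by ring.
  rewrite -(mul0r (0 * y' ^+ 2 * x)); apply: place_mul => //; apply: place_mul => //.
  by apply: place_mul => //; apply: place_exp.
have u'1 : u' \in 1%VS := place_base Xred mod mod' (Gtrace u) tr1.
have al'1 : al' \in 1%VS.
  have := place_base Xred mod mod' (Gtrace (u ^+ 2 * al)) tr2.
  move=> H; have -> : al' = (u' ^+ 2)^-1 * (u' ^+ 2 * al') by rewrite mulKf // expf_neq0.
  by rewrite rpredM // rpredV rpredX.
(* As [al'] lies in the base, the reduction of [f] has degree one. By [sizeQ] this degree is one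
   less than the order of the group, which is the degree of [f]. *)
have := size_minPoly 1 al'; have -> : adjoin_degree 1 al' = 1%N.
  by apply/eqP; rewrite adjoin_deg_eq1.
have l0' : emb L' psi' (lead_coef (map_poly red f)) != 0.
  by rewrite (emb_eq0 mod') lead_coef_eq0.
rewrite -(size_scale _ l0') -(model_minPoly mod') (size_map_emb mod') sizeQ.
by rewrite -(proj2 (model_gal_roots mod galL)).
Qed.
End Conjugates.

(** * Affine charts *)

Section Dehomogenization.
Variables (K : closedFieldType) (r : nat) (A : idomainType).
Variables (D : {rmorphism {mpoly K[r]} -> A}) (j : 'I_r).

(* [D] identifies [A] with the coordinate ring of the chart [x_j = 1]; its
   K-points are used to recognize a form by its values. *)
Definition dehomogenization : Prop :=
  [/\ D 'X_j = 1, forall a, exists p, D p = a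
    & forall v : 'rV[K]_r, v 0 j = 1 -> exists e : {rmorphism A -> K}, forall p, e (D p) = p.@[v 0]].

Hypothesis dehomD : dehomogenization.

Lemma homogXn M : ('X_j : {mpoly K[r]}) ^+ M \is M.-homog.
Proof.
by rewrite mpolyXn; rewrite dhomogX /= mdegMn mdeg1 mul1n.
Qed.

Lemma dehom_lift a : exists M0, forall M, (M0 <= M)%N ->
  exists2 p, p \is M.-homog & D p = a.
Proof.
case: dehomD => Dj surj _; have [p <-] := surj a.
exists (msize p) => M le_M.
exists (\sum_(i < msize p) homog_part i p * 'X_j ^+ (M - i)).
  apply: rpred_sum => i _; have le_i : (i <= M)%N by apply: leq_trans le_M; apply: ltnW.
  have := dhomogM (pihomogP _ i p) (homogXn (M - i)); by rewrite subnKC.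
rewrite [in RHS](homog_part_sum p) !rmorph_sum; apply: eq_bigr => i _.
by rewrite rmorphM rmorphXn /= Dj expr1n mulr1.
Qed.

Lemma dehom_eq0 M p : p \is M.-homog -> D p = 0 -> p = 0.
Proof.
case: dehomD => _ _ pts hp Dp; have : 'X_j * p = 0; last first.
  by move/eqP; rewrite mulf_eq0 -msize_poly_eq0 msizeX => /eqP.
apply: mpoly_eval_inj => v; rewrite mevalM mevalXU meval0.
have [->|vj] := eqVneq (v 0 j) 0; first by rewrite mul0r.
have [|e He] := pts ((v 0 j)^-1 *: v); first by rewrite mxE mulVf.
have := He p; rewrite Dp rmorph0 (meval_scale _ _ hp) => /esym/eqP.
by rewrite mulf_eq0 expf_eq0 invr_eq0 (negPf vj) andbF => /eqP->; rewrite mulr0.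
Qed.

Variables (d : nat) (G : {mpoly K[r]}).
Hypotheses (hG : G \is d.-homog) (prG : prime_elt G) (nXG : ~ divides G 'X_j).

Lemma prime_dvd_exp a i : divides G (a ^+ i) -> divides G a.
Proof.
case: prG => _ UG PG; elim: i => [|i IH]; last by rewrite exprS => /PG [].
rewrite expr0 => -[q E]; case/negP: UG; apply/unitrP; exists q.
by rewrite [G * q]mulrC -E.
Qed.

(** A quotient in the chart lifts after multiplication by a power of ['X_j]; the prime [G] does not
    divide that power, which can therefore be dropped. *)
Lemma dehom_divides M g : g \is M.-homog -> divides (D G) (D g) -> divides G g.
Proof.
case: (prG) (dehomD) => _ _ PG [Dj _ _] hg [q E]; have [M0 HM] := dehom_lift q.
have [Q hQ DQ] := HM _ (leq_addr M M0); pose w := (M0 + d)%N.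
have hX : ('X_j : {mpoly K[r]}) ^+ w \is w.-homog.
  exact: homogXn.
have EX : 'X_j ^+ w * g = Q * G.
  apply/eqP; rewrite -subr_eq0; apply/eqP; apply: (@dehom_eq0 (w + M)).
    apply: rpredB; first exact: dhomogM.
    by have := dhomogM hQ hG; rewrite /w -addnA [(M + d)%N]addnC addnA.
  by rewrite rmorphB !rmorphM rmorphXn /= Dj expr1n mul1r E DQ subrr.
have /PG [/prime_dvd_exp //|//] : divides G ('X_j ^+ w * g) by exists Q.
Qed.

Lemma dehom_prime : prime_elt (D G).
Proof.
case: (prG) (dehomD) => G0 UG PG [Dj _ _]; split.
- by apply: contraNneq G0 => /(dehom_eq0 hG)->.
- apply/negP => /unitrP [u [Eu _]]; case/negP: UG.
  have [] : divides G 1; last by move=> q E; apply/unitrP; exists q; rewrite [G * q]mulrC -E.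
  apply: (@dehom_divides 0); first exact: dhomog1.
  by exists u; rewrite rmorph1 Eu.
move=> a b dvd; have [Ma Ha] := dehom_lift a; have [Mb Hb] := dehom_lift b.
have [a' ha Ea] := Ha _ (leqnn _); have [b' hb Eb] := Hb _ (leqnn _).
have /PG : divides G (a' * b').
  by apply: (dehom_divides (dhomogM ha hb)); rewrite rmorphM /= Ea Eb.
by rewrite -Ea -Eb => -[] [q ->]; [left | right]; exists (D q); rewrite rmorphM.
Qed.
End Dehomogenization.

Section Charts.
Variable K : closedFieldType.

Definition chart m (p : {mpoly K[m.+1]}) : {mpoly K[m]} :=
  mmap (@mpolyC m K) (fun i => oapp (fun j => 'X_j) 1 (unlift ord0 i)) p.

HB.instance Definition _ m := GRing.RMorphism.copy (@chart m)
  (mmap (@mpolyC m K) (fun i => oapp (fun j => 'X_j) 1 (unlift ord0 i))).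

(* The chart [x_1 = 1] of P^{m+1}, where projection from [(1 : 0 : ... : 0)]
   forgets the variable of the polynomial ring. *)
Definition cone_chart m (p : {mpoly K[m.+2]}) : {poly {mpoly K[m]}} :=
  mmap (polyC \o @mpolyC m K) (fun i => oapp (fun j => (chart 'X_j)%:P) 'X (unlift ord0 i)) p.

HB.instance Definition _ m := GRing.RMorphism.copy (@cone_chart m)
  (mmap (polyC \o @mpolyC m K) (fun i => oapp (fun j => (chart 'X_j)%:P) 'X (unlift ord0 i))).

Arguments chart {m} p : simpl never.
Arguments cone_chart {m} p : simpl never.

Lemma chartC m c : chart (c%:MP : {mpoly K[m.+1]}) = c%:MP.
Proof. by rewrite /chart mmapC. Qed.

Lemma chartX0 m : chart ('X_ord0 : {mpoly K[m.+1]}) = 1.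
Proof. by rewrite /chart mmapX mmap1U unlift_none. Qed.

Lemma chartXS m j : chart ('X_(lift ord0 j) : {mpoly K[m.+1]}) = 'X_j.
Proof. by rewrite /chart mmapX mmap1U liftK. Qed.

Lemma cone_chartC m c : cone_chart (c%:MP : {mpoly K[m.+2]}) = c%:MP%:P.
Proof. by rewrite /cone_chart mmapC. Qed.

Lemma cone_chartX0 m : cone_chart ('X_ord0 : {mpoly K[m.+2]}) = 'X.
Proof. by rewrite /cone_chart mmapX mmap1U unlift_none. Qed.

Lemma cone_chartXS m j : cone_chart ('X_(lift ord0 j) : {mpoly K[m.+2]}) = (chart 'X_j)%:P.
Proof. by rewrite /cone_chart mmapX mmap1U liftK. Qed.

Lemma ord0_ind m (Q : 'I_m.+1 -> Prop) : Q ord0 -> (forall j, Q (lift ord0 j)) -> forall i, Q i.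
Proof. by move=> Q0 QS i; case: (unliftP ord0 i) => [j ->|->]. Qed.

Lemma chart_dehom m : dehomogenization (@chart m) ord0.
Proof.
split; first exact: chartX0.
  elim/mpoly_ring_ind=> [c|i|a b [p <-] [q <-]|a b [p <-] [q <-]].
  - by exists c%:MP; rewrite /= chartC.
  - by exists 'X_(lift ord0 i); rewrite /= chartXS.
  - by exists (p + q); rewrite rmorphD.
  - by exists (p * q); rewrite rmorphM.
move=> v v0; exists (meval (fun i => v 0 (lift ord0 i))).
apply: (@eq_mpoly_rmorph K m.+1 K (meval (fun i => v 0 (lift ord0 i)) \o @chart m) (meval (v 0))) => /= [c|].
  by rewrite chartC !mevalC.
apply: ord0_ind => [|i]; first by rewrite chartX0 mevalXU v0 rmorph1.
by rewrite chartXS !mevalXU.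
Qed.

Lemma cone_chart_dehom m :
  @dehomogenization K m.+2 {poly {mpoly K[m]}} (@cone_chart m) (lift ord0 ord0).
Proof.
split; first by rewrite /= cone_chartXS chartX0.
  have surjC c : exists p, cone_chart p = (c : {mpoly K[m]})%:P.
    elim/mpoly_ring_ind: c=> [c|i|a b [p Ep] [q Eq]|a b [p Ep] [q Eq]].
    - by exists c%:MP; rewrite /= cone_chartC.
    - by exists 'X_(lift ord0 (lift ord0 i)); rewrite /= cone_chartXS chartXS.
    - by exists (p + q); rewrite rmorphD /= Ep Eq rmorphD.
    - by exists (p * q); rewrite rmorphM /= Ep Eq rmorphM.
  elim/poly_ind => [|a c [p <-]]; first by exists 0; rewrite rmorph0.
  by have [q Eq] := surjC c; exists (p * 'X_ord0 + q); rewrite rmorphD rmorphM /= cone_chartX0 Eq.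
move=> v v1; pose w i := v 0 (lift ord0 (lift ord0 i)).
exists (horner_eval (v 0 ord0) \o map_poly (meval w)).
apply: (@eq_mpoly_rmorph K m.+2 K
  ((horner_eval (v 0 ord0) \o map_poly (meval w)) \o @cone_chart m) (meval (v 0))) => /= [c|].
  by rewrite cone_chartC map_polyC /horner_eval hornerC /= !mevalC.
apply: ord0_ind => [|]; first by rewrite cone_chartX0 map_polyX /horner_eval hornerX mevalXU.
apply: ord0_ind => [|i]; rewrite cone_chartXS ?chartX0 ?chartXS map_polyC /horner_eval hornerC.
  by rewrite mevalXU v1 /= rmorph1.
by rewrite /= !mevalXU.
Qed.

Lemma cone_chart_deriv m (F : {mpoly K[m.+2]}) : (cone_chart F)^`() = cone_chart (F^`M(ord0)).
Proof.
elim/mpoly_ring_ind: F => [c|i|p q Hp Hq|p q Hp Hq].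
- by rewrite cone_chartC derivC mderivC rmorph0.
- rewrite mderivXU; case: (unliftP ord0 i) => [j ->|->].
    by rewrite cone_chartXS derivC rmorph_nat.
  by rewrite cone_chartX0 derivX rmorph1.
- by rewrite mderivD [in RHS]rmorphD /= -Hp -Hq -derivD; congr deriv; exact: rmorphD.
- rewrite mderivM [in RHS]rmorphD [X in _ = X + _]rmorphM [X in _ = _ + X]rmorphM /= -Hp -Hq -derivM.
  congr deriv; exact: rmorphM.
Qed.

Definition affine_mnm m (u : 'X_{1..m.+2}) : 'X_{1..m} :=
  [multinom u (lift ord0 (lift ord0 i)) | i < m].

Lemma cone_chartX m (u : 'X_{1..m.+2}) :
  cone_chart 'X_[u] = 'X_[affine_mnm u] *: 'X^(u ord0).
Proof.
rewrite /cone_chart mmapX /mmap1 big_ord_recl unlift_none big_ord_recl liftK /= -/(chart _).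
rewrite chartX0 expr1n mul1r -mul_polyC mulrC; congr (_ * _).
rewrite mpolyXE_id rmorph_prod; apply: eq_bigr => i _ /=.
by rewrite liftK /= -/(chart _) chartXS mnmE rmorphXn.
Qed.

Lemma mdeg_affine m (u : 'X_{1..m.+2}) :
  mdeg u = (u ord0 + (u (lift ord0 ord0) + mdeg (affine_mnm u)))%N.
Proof.
by rewrite !mdegE !big_ord_recl; congr (_ + (_ + _))%N; apply: eq_bigr => i _; rewrite mnmE.
Qed.

Lemma cone_chartE m (F : {mpoly K[m.+2]}) e v :
  (cone_chart F)`_e@_v = \sum_(u <- msupp F | (u ord0 == e) && (affine_mnm u == v)) F@_u.
Proof.
rewrite [F in cone_chart F]mpolyE rmorph_sum coef_sum raddf_sum [RHS]big_mkcond; apply: eq_bigr => u _ /=.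
rewrite -mul_mpolyC rmorphM /= cone_chartC cone_chartX mul_polyC.
rewrite !coefZ coefXn eq_sym; case: eqP => [_|_]; last by rewrite !mulr0 mcoeff0.
by rewrite mulr1 mcoeffCM mcoeffX; case: eqP => _; rewrite ?mulr1 ?mulr0.
Qed.
End Charts.

Section Restriction.
Variable K : closedFieldType.

Definition kill_last m (p : {mpoly K[m.+1]}) : {mpoly K[m]} := (muni p)`_0.

Lemma kill_lastE m (p : {mpoly K[m.+1]}) : kill_last p = horner_eval 0 (@muni m K p).
Proof. by rewrite /kill_last /horner_eval horner_coef0. Qed.

Lemma kill_last_zmod m : zmod_morphism (@kill_last m).
Proof. by move=> p q; rewrite /kill_last muniB coefB. Qed.

Lemma kill_last_monoid m : monoid_morphism (@kill_last m).
Proof.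
split=> [|p q]; first by rewrite /kill_last rmorph1 coef1.
by rewrite !kill_lastE rmorphM /= rmorphM.
Qed.

HB.instance Definition _ m := GRing.isZmodMorphism.Build _ _ (@kill_last m) (@kill_last_zmod m).
HB.instance Definition _ m := GRing.isMonoidMorphism.Build _ _ (@kill_last m) (@kill_last_monoid m).

Arguments kill_last {m} p : simpl never.

Lemma kill_lastC m c : kill_last (c%:MP : {mpoly K[m.+1]}) = c%:MP.
Proof. by rewrite /kill_last muniC coefC eqxx. Qed.

Lemma kill_lastX m i : kill_last ('X_(widen_ord (leqnSn m) i) : {mpoly K[m.+1]}) = 'X_i.
Proof. by rewrite /kill_last muni_widen coefC eqxx. Qed.

Lemma kill_last_max m : kill_last ('X_ord_max : {mpoly K[m.+1]}) = 0.
Proof. by rewrite /kill_last muni_max coefX. Qed.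

Lemma kill_last_prime m : prime_reduction (@kill_last m) 'X_ord_max.
Proof.
split.
- by rewrite -msize_poly_eq0 msizeX.
- exact: kill_last_max.
- by move=> a'; exists (mwiden a'); rewrite /= /kill_last muni_mwiden coefC eqxx.
- move=> a ra; have /factor_theorem [q] : root (muni a) 0.
    by rewrite /root horner_coef0; apply/eqP.
  rewrite subr0 => E; exists (of_uni q).
  by apply: muni_inj; rewrite rmorphM /= of_uniK muni_max E mulrC.
move=> a a0; have [l [q]] := multiplicity_XsubC (muni a) 0.
rewrite muni_eq0 a0 subr0 /= => q0 E; exists l, (of_uni q); split.
  by apply: muni_inj; rewrite rmorphM rmorphXn /= of_uniK muni_max E mulrC.
by apply: contra q0 => /eqP; rewrite /= /kill_last of_uniK -horner_coef0 => /eqP.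
Qed.

Definition drop_last m : 'M[K]_(m, m.+1) := \matrix_(i, j) (j == widen_ord (leqnSn m) i)%:R.

Lemma mul_drop_last m p (B : 'M[K]_(m.+1, p)) i :
  row i (drop_last m *m B) = row (widen_ord (leqnSn m) i) B.
Proof.
apply/rowP => k; rewrite !mxE (bigD1 (widen_ord (leqnSn m) i)) //= mxE eqxx mul1r.
by rewrite big1 ?addr0 // => j /negPf nj; rewrite mxE nj mul0r.
Qed.

(** Restricting to the hyperplane where the last coordinate vanishes commutes with the chart; this
    identifies the equation of the section with a reduction of [f] modulo a variable of the base. *)
Lemma cone_chart_drop_last m (F : {mpoly K[m.+3]}) :
  map_poly (@kill_last m) (cone_chart F) = cone_chart (lsub (drop_last m.+2) F).
Proof.
apply: (@eq_mpoly_rmorph K m.+3 _ (map_poly (@kill_last m) \o @cone_chart K m.+1)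
  (@cone_chart K m \o lsub (drop_last m.+2))) => /= [c|].
  by rewrite lsubC !cone_chartC map_polyC /= kill_lastC.
have lX (i : 'I_m.+2) : lsub (drop_last m.+2) 'X_(widen_ord (leqnSn _) i) = 'X_i.
  rewrite lsubX (bigD1 i) //= mxE eqxx scale1r big1 ?addr0 // => j ji.
  by rewrite mxE -val_eqE /= val_eqE eq_sym (negPf ji) scale0r.
have lXm : lsub (drop_last m.+2) 'X_ord_max = 0.
  rewrite lsubX big1 // => j _.
  by rewrite mxE -val_eqE /= gtn_eqF ?scale0r.
apply: ordS_ind; last first.
  rewrite lXm rmorph0; have -> : ord_max = lift ord0 (lift ord0 (ord_max : 'I_m.+1)) by apply: val_inj.
  by rewrite cone_chartXS chartXS map_polyC /= kill_last_max.
move=> i; rewrite lX; move: i; apply: ord0_ind => [|].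
  have -> : widen_ord (leqnSn m.+2) ord0 = ord0 by apply: val_inj.
  by rewrite !cone_chartX0 map_polyX.
apply: ord0_ind => [|i].
  have -> : widen_ord (leqnSn m.+2) (lift ord0 ord0) = lift ord0 ord0 by apply: val_inj.
  by rewrite !cone_chartXS !chartX0 map_polyC /= rmorph1.
have -> : widen_ord (leqnSn m.+2) (lift ord0 (lift ord0 i)) =
  lift ord0 (lift ord0 (widen_ord (leqnSn m) i)) by apply: val_inj.
by rewrite !cone_chartXS !chartXS map_polyC /= kill_lastX.
Qed.

End Restriction.

Section LeadingCoefficient.
Variable K : closedFieldType.
Local Notation e0 := (delta_mx 0 ord0 : 'rV[K]__).

Lemma meval_vertex m d (F : {mpoly K[m.+1]}) : F \is d.-homog ->
  F.@[e0 0] = F@_(U_(ord0) *+ d).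
Proof.
move=> hF; have E (u : 'X_{1..m.+1}) : \prod_i (e0 : 'rV[K]_m.+1) 0 i ^+ u i = (u == U_(ord0) *+ mdeg u)%MM%:R.
  have [Eu|nu] := eqVneq u (U_(ord0) *+ mdeg u)%MM.
    rewrite big1 // => i _; rewrite Eu mulmnE mnm1E mxE eqxx /= eq_sym.
    by case: eqP => _; rewrite ?expr1n ?mul0n ?expr0.
  have [i [i0 ui]] : exists i, i != ord0 /\ u i != 0%N.
    apply: NNPP => H; case/eqP: nu; have u0 i : i != ord0 -> u i = 0%N.
      by move=> i0; apply/eqP; apply: contra_notT H => ui; exists i.
    apply/mnmP => i; rewrite mulmnE mnm1E eq_sym; case: eqP => [->|/eqP /u0->]; last by rewrite mul0n.
    by rewrite mul1n mdegE (bigD1 ord0) //= big1 ?addn0 // => k /u0.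
  by rewrite (bigD1 i) //= mxE (negPf i0) andbF expr0n (negPf ui) mul0r.
rewrite mevalE; under eq_bigr do rewrite E.
rewrite (eq_big_seq (fun u => F@_u * (u == U_(ord0) *+ d)%MM%:R)); last first.
  by move=> u hu; have /= -> := dhomog_mf hF hu.
set v := (U_(ord0) *+ d)%MM; have [hv|hv] := boolP (v \in msupp F).
  rewrite (bigD1_seq v) //= eqxx mulr1 big1 ?addr0 // => u /negPf->; by rewrite mulr0.
rewrite (memN_msupp_eq0 hv) big_seq big1 // => u hu.
by rewrite (negPf (_ : u != v)) ?mulr0 //; apply: contraNneq hv => <-.
Qed.

Variables (m d : nat) (F : {mpoly K[m.+2]}).
Hypothesis hF : F \is d.-homog.

Lemma coef_cone_chart_neq0 e v : (cone_chart F)`_e@_v != 0 ->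
  exists u, [/\ u \in msupp F, u ord0 = e & affine_mnm u = v].
Proof.
rewrite cone_chartE => H; apply: NNPP => Hno; case/eqP: H.
rewrite big_seq_cond big1 // => u /and3P[hu /eqP u0 /eqP uv].
by case: Hno; exists u.
Qed.

Lemma coef_cone_chart u : u \in msupp F -> (cone_chart F)`_(u ord0)@_(affine_mnm u) = F@_u.
Proof.
move=> hu; rewrite cone_chartE big_mkcond (bigD1_seq u) ?msupp_uniq //= !eqxx /=.
rewrite big1_seq ?addr0 // => w /andP[/eqP nwu hw]; case: andP => // -[/eqP w0 /eqP wu].
have dw : mdeg w = mdeg u by rewrite (dhomog_mf hF hw) (dhomog_mf hF hu).
case: nwu; apply/mnmP; apply: ord0_ind => [//|]; apply: ord0_ind => [|i].
  move: dw; rewrite !mdeg_affine w0 wu => /eqP; rewrite eqn_add2l eqn_add2r => /eqP //.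
by have := congr1 (fun x : 'X_{1..m} => x i) wu; rewrite !mnmE.
Qed.

Lemma msize_coef_cone_chart e : (cone_chart F)`_e != 0 ->
  (msize (cone_chart F)`_e + e <= d.+1)%N.
Proof.
move=> n0; rewrite -(mlead_deg n0) addSn ltnS.
have [|u [hu <- <-]] := @coef_cone_chart_neq0 e (mlead (cone_chart F)`_e).
  by rewrite mleadc_eq0.
by have /= <- := dhomog_mf hF hu; rewrite mdeg_affine addnC leq_add2l leq_addl.
Qed.

(* The coefficients of degree at least [d - 1] of the dehomogenized equation are
   those of [F] at [x_0^d] and [x_0^(d-1) x_i], i.e. the value and the partial
   derivatives of [F] at the vertex. *)
Lemma Sing_cone_chart : (1 < d)%N -> Sing F e0 <-> (size (cone_chart F) < d)%N.
Proof.
move=> d1; have hd i : F^`M(i) \is d.-1.-homog by apply: mderiv_homog; rewrite prednK // ltnW.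
split=> [[[_ F0] dF]|sF].
  rewrite -[d]prednK ?ltnS; last exact: ltnW.
  apply/leq_sizeP => e le_e; apply/mpolyP => v; rewrite mcoeff0; apply/eqP.
  apply: contraTT isT => /coef_cone_chart_neq0 [u [hu ue _]]; move: (hu).
  rewrite mcoeff_msupp => /eqP; case.
  have du : mdeg u = d by apply: (dhomog_mf hF hu).
  have [i Eu] : exists i, u = (U_(ord0) *+ d.-1 + U_(i))%MM.
    have le_u : (U_(ord0) *+ d.-1 <= u)%MM.
      apply/mnm_lepP; apply: ord0_ind => [|j]; rewrite mulmnE mnm1E; first by rewrite eqxx mul1n ue.
      by rewrite mul0n.
    have : (mdeg (u - U_(ord0) *+ d.-1)%MM == 1)%N.
      have := congr1 mdeg (submK le_u); rewrite mdegD du mdegMn mdeg1 mul1n => E.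
      by rewrite -(eqn_add2r d.-1) E add1n prednK // ltnW.
    by move=> /mdeg1P [i /eqP Ei]; exists i; rewrite -Ei addmC submK.
  have [i0|i0] := eqVneq i ord0.
    have -> : u = (U_(ord0) *+ d)%MM; last by rewrite -(meval_vertex hF).
    by rewrite Eu i0 -{2}(prednK (ltnW d1)) mulmSr.
  have := meval_vertex (hd i); rewrite dF mcoeff_mderiv -Eu => /esym.
  by rewrite mulmnE mnm1E eq_sym (negPf i0) mul0n.
have coef (u : 'X_{1..m.+2}) : (d.-1 <= u ord0)%N -> F@_u = 0.
  move=> ud; apply/eqP; rewrite mcoeff_eq0; apply/negP => hu.
  have := coef_cone_chart hu; rewrite nth_default ?mcoeff0; last by apply: leq_trans ud; rewrite -ltnS prednK // ltnW.
  by move/esym/eqP; rewrite mcoeff_eq0 hu.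
split; first split.
- by apply/eqP => /rowP/(_ ord0)/eqP; rewrite !mxE !eqxx oner_eq0.
- by rewrite (meval_vertex hF) coef // mulmnE mnm1E eqxx mul1n leq_pred.
move=> i; rewrite (meval_vertex (hd i)) mcoeff_mderiv coef ?mul0rn //.
by rewrite mnmDE mulmnE mnm1E eqxx mul1n leq_addr.
Qed.
End LeadingCoefficient.

Section Vertex.
Variable K : closedFieldType.
Local Notation e0 := (delta_mx 0 ord0 : 'rV[K]__).

(** As the vertex is not singular, the degree in the polynomial variable is at least [d - 1], and
    the leading coefficient has degree at most one. If it vanishes with the last variable, it is a
    nonzero constant times that variable. *)
Lemma lead_cone_chart m d (F : {mpoly K[m.+3]}) : F \is d.-homog -> (1 < d)%N -> ~ Sing F e0 ->
  kill_last (lead_coef (cone_chart F)) != 0 \/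
  exists a, lead_coef (cone_chart F) = 'X_ord_max * a /\ kill_last a != 0.
Proof.
move=> hF d1 smF; have sz : (d <= size (cone_chart F))%N.
  by rewrite leqNgt; apply/negP => H; apply: smF; apply/(Sing_cone_chart hF).
have dich (z : {mpoly K[m]}) : z = 0 \/ z != 0 by case: (eqVneq z 0); auto.
have [l0|n0] := dich (kill_last (lead_coef (cone_chart F))); [right | left; exact: n0].
have [_ _ _ ker _] := kill_last_prime K m; have [a Ea] := ker _ l0.
exists a; split=> //.
have f0 : cone_chart F != 0 by rewrite -size_poly_gt0; apply: leq_trans sz; apply: ltnW.
have := f0; rewrite -lead_coef_eq0 => la; have := la; rewrite Ea mulf_eq0 negb_or => /andP[X0 a0].
have := msize_coef_cone_chart hF la; rewrite -lead_coefE Ea msizeM // msizeX mdeg1.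
have a1 : (0 < msize a)%N by rewrite lt0n msize_poly_eq0.
have : (size (cone_chart F)).-1.+1 = size (cone_chart F) by rewrite prednK // size_poly_gt0.
move=> E H; have : (msize a <= 1)%N.
  move: (msize a) (size (cone_chart F)).-1 (size (cone_chart F)) sz a1 E H => x y z; lia.
move=> /msize1_polyC Ec; move: a0; rewrite Ec kill_lastC !mpolyC_eq0; exact.
Qed.

Lemma Sing_lsub n r (M : 'M[K]_(n, r)) (G : {mpoly K[r]}) x :
  x != 0 -> Sing G (x *m M) -> Sing (lsub M G) x.
Proof.
move=> x0 [[_ G0] dG]; split; first by split=> //; rewrite meval_lsub.
move=> i; rewrite mderiv_lsub raddf_sum big1 // => j _ /=.
by rewrite mevalZ meval_lsub dG mulr0.
Qed.

Lemma vertex_neq0 m : (e0 : 'rV[K]_m.+1) != 0.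
Proof. by apply/eqP => /rowP/(_ ord0)/eqP; rewrite !mxE !eqxx oner_eq0. Qed.

Lemma Sing_vertex m (B : 'M[K]_m.+1) (F : {mpoly K[m.+1]}) : B \in unitmx ->
  Sing (lsub B F) e0 <-> Sing F (row ord0 B).
Proof.
move=> UB; rewrite rowE; split=> [H|]; last exact/Sing_lsub/vertex_neq0.
rewrite -[F]lsub1 -(mulVmx UB) -lsubA; apply: Sing_lsub; last by rewrite mulmxK.
apply: contraNneq (vertex_neq0 m) => E; apply/eqP.
by rewrite -[LHS](mulmxK UB) E mul0mx.
Qed.

Lemma cone_chart_deriv_eq0 m d (F : {mpoly K[m.+2]}) (B : 'M[K]_m.+2) :
  F \is d.+1.-homog -> B \in unitmx ->
  ((cone_chart (lsub B F))^`() == 0) = (polar F (row ord0 B) == 0).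
Proof.
move=> hF UB; rewrite cone_chart_deriv.
have -> : (lsub B F)^`M(ord0) = lsub B (polar F (row ord0 B)).
  rewrite rowE -lsub_polar /polar (bigD1 ord0) //= mxE !eqxx scale1r big1 ?addr0 // => i /negPf i0.
  by rewrite mxE i0 andbF scale0r.
apply/eqP/eqP => [|->]; last by rewrite !rmorph0.
move/(dehom_eq0 (cone_chart_dehom K m) (lsub_homog B (polar_homog _ hF))) => E.
by rewrite -[LHS]lsub1 -(mulVmx UB) -lsubA E rmorph0.
Qed.
End Vertex.

(** * Projections from a point and models *)

Section FunctionFields.
Variable K : closedFieldType.

Lemma function_field_lsub r (I : {mpoly K[r]} -> Prop) (E : fieldType) (iota : {rmorphism K -> E})
    (xi : 'rV[E]_r) (M : 'M[K]_r) : M \in unitmx -> function_field_at I iota xi ->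
  function_field_at (fun g => I (lsub M g)) iota (xi *m map_mx iota M).
Proof.
move=> UM [ker frac]; split=> [d g hg|z]; first by rewrite -mmap_lsub; exact: (ker _ _ (lsub_homog M hg)).
have [d [g [h [hg hh h0 ->]]]] := frac z.
have back p : mmap iota ((xi *m map_mx iota M) 0) (lsub (invmx M) p) = mmap iota (xi 0) p.
  by rewrite -mmap_lsub lsubA mulmxV // lsub1.
by exists d, (lsub (invmx M) g), (lsub (invmx M) h); rewrite !back !lsub_homog.
Qed.

Lemma mmap_chart m (E : comNzRingType) (f : {rmorphism K -> E}) (y : 'I_m -> E)
    (x : 'rV[E]_m.+1) g :
  x 0 ord0 = 1 -> (forall i, x 0 (lift ord0 i) = y i) ->
  mmap f (x 0) g = mmap f y (chart g).
Proof.
move=> x0 xS; apply: (@eq_mpoly_rmorph K m.+1 E (mmap f (x 0))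
  (mmap f y \o @chart K m)) => /= [c|].
  by rewrite chartC !mmapC.
apply: ord0_ind => [|i]; first by rewrite chartX0 rmorph1 mmapX mmap1U.
by rewrite chartXS !mmapX !mmap1U.
Qed.

Lemma evp_cone_chart m (k : fieldType) (L : fieldExtType k) (f : {rmorphism K -> k})
    (y : 'I_m -> k) (x : 'rV[L]_m.+2) g :
  x 0 (lift ord0 ord0) = 1 -> (forall i, x 0 (lift ord0 (lift ord0 i)) = in_alg L (y i)) ->
  mmap (emb L f) (x 0) g = evp (emb L (mmap f y)) (x 0 ord0) (cone_chart g).
Proof.
move=> x1 xS; apply: (@eq_mpoly_rmorph K m.+2 L (mmap (emb L f) (x 0))
  (evp (emb L (mmap f y)) (x 0 ord0) \o @cone_chart K m)) => /= [c|].
  rewrite cone_chartC evpC mmapC; congr (in_alg L _); exact/esym/mmapC.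
apply: ord0_ind => [|]; first by rewrite cone_chartX0 evpX mmapX mmap1U.
apply: ord0_ind => [|i]; rewrite cone_chartXS evpC.
  by rewrite chartX0 rmorph1 mmapX mmap1U.
rewrite chartXS mmapX mmap1U xS; congr (in_alg L _); exact/esym/(etrans (mmapX _ _ _) (mmap1U _ _)).
Qed.
End FunctionFields.

Section ProjectionToModel.
Variable K : closedFieldType.

Definition drop_first m : 'M[K]_(m, m.+1) := \matrix_(i, j) (j == lift ord0 i)%:R.

Lemma mul_drop_first m p (B : 'M[K]_(m.+1, p)) i j :
  (drop_first m *m B) i j = B (lift ord0 i) j.
Proof.
rewrite mxE (bigD1 (lift ord0 i)) //= mxE eqxx mul1r.
by rewrite big1 ?addr0 // => l /negPf nl; rewrite mxE nl mul0r.
Qed.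

Lemma drop_first_unit m (B : 'M[K]_m.+1) (lam : 'M[K]_(m.+1, m)) : B \in unitmx ->
  (kermx lam == row ord0 B)%MS -> drop_first m *m B *m lam \in unitmx.
Proof.
move=> UB /andP[ker _]; rewrite -row_free_unit; apply: inj_row_free => v.
rewrite mulmxA => /sub_kermxP/submx_trans/(_ ker)/sub_rVP [a].
rewrite rowE mulmxA scalemxAl => /(can_inj (mulmxK UB)) E; apply/rowP => i.
have := congr1 (fun w : 'rV_m.+1 => w 0 (lift ord0 i)) E.
rewrite !mxE andbF mulr0 (bigD1 i) //= mxE eqxx mulr1 big1 ?addr0 // => l li.
by rewrite mxE (inj_eq (@lift_inj _ _)) eq_sym (negPf li) mulr0.
Qed.

(** In coordinates starting with [P], and after the change [Lam] of the target, the projection drops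
    the first coordinate. The factor [c] cancels in ratios, so the affine coordinates of the two
    generic points agree: [psi] evaluates at those of the base, and [al] is the ratio of the first
    two coordinates upstairs. *)
Lemma model_of_projection m d (F : {mpoly K[m.+2]}) (B : 'M[K]_m.+2)
    (k : fieldType) (L : fieldExtType k) :
  F \is d.-homog -> B \in unitmx -> projection_extension F (row ord0 B) L ->
  exists psi al, @model _ (cone_chart (lsub B F)) k L psi al.
Proof.
move=> hF UB [iota [lam [eta [xi [c [kerP ff_eta ff_xi c0 Eeta]]]]]].
pose Lam := drop_first m.+1 *m B *m lam; have ULam : Lam \in unitmx := drop_first_unit UB kerP.
have UB' : invmx B \in unitmx by rewrite unitmx_inv.
have UL' : invmx Lam \in unitmx by rewrite unitmx_inv.
pose j : {rmorphism K -> L} := emb L iota; have {}ff_xi : function_field_at (fun g => exists q, g = q * F) j xi := ff_xi.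
have [ker_eta frac_eta] := function_field_lsub UL' ff_eta.
have [ker_xi frac_xi] := function_field_lsub UB' ff_xi.
set eta' := eta *m _ in ker_eta frac_eta; set xi' := xi *m _ in ker_xi frac_xi.
have EB : B *m lam = (drop_first m.+1)^T *m Lam.
  have dT a b : (drop_first m.+1)^T a b = (a == lift ord0 b)%:R by rewrite !mxE.
  apply/matrixP; apply: ord0_ind => [i|i l].
    have /sub_kermxP/rowP/(_ i) : (row ord0 B <= kermx lam)%MS by case/andP: kerP.
    rewrite -row_mul [LHS]mxE [RHS]mxE => ->; rewrite [RHS]mxE big1 // => l _.
    by rewrite dT mul0r.
  rewrite [RHS]mxE (bigD1 i) //= dT eqxx mul1r big1 ?addr0; last first.
    by move=> l' /negPf n; rewrite dT (inj_eq (@lift_inj _ _)) eq_sym n mul0r.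
  by rewrite /Lam -mulmxA mul_drop_first.
have Eeta' i : in_alg L (eta' 0 i) = c * xi' 0 (lift ord0 i).
  have -> : in_alg L (eta' 0 i) = (map_mx (in_alg L) eta') 0 i by rewrite [RHS]mxE.
  have Exi : xi *m map_mx j lam = xi' *m map_mx j (drop_first m.+1)^T *m map_mx j Lam.
    rewrite -mulmxA -map_mxM -EB map_mxM mulmxA /xi' -[xi *m _ *m _]mulmxA -map_mxM.
    by rewrite mulVmx // map_mx1 mulmx1.
  have -> : map_mx (in_alg L) eta' = c *: (xi' *m map_mx j (drop_first m.+1)^T).
    rewrite /eta' map_mxM Eeta -/j Exi -map_mx_comp -/j -[map_mx (_ \o _) _]/(map_mx j _).
    by rewrite -scalemxAl map_invmx mulmxK // map_unitmx.
  have dT a b : (map_mx j (drop_first m.+1)^T) a b = (a == lift ord0 b)%:R by rewrite !mxE rmorph_nat.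
  rewrite [LHS]mxE; congr (_ * _); rewrite mxE (bigD1 (lift ord0 i)) //= dT eqxx mulr1 big1 ?addr0 // => l /negPf n.
  by rewrite dT n mulr0.
have eta_eq0 g e : g \is e.-homog -> mmap iota (eta' 0) g = 0 -> g = 0.
  move=> hg /(ker_eta _ _ hg) E; rewrite -[g]lsub1 -(mulmxV ULam) -lsubA E.
  exact: rmorph0.
have eta0 : eta' 0 ord0 != 0.
  have hX : ('X_ord0 : {mpoly K[m.+1]}) \is 1.-homog by rewrite dhomogX /= mdeg1.
  apply/eqP => E; have := eta_eq0 _ _ hX; rewrite mmapX mmap1U => /(_ E)/eqP.
  by rewrite -msize_poly_eq0 msizeX.
pose y i := eta' 0 (lift ord0 i) / eta' 0 ord0; pose psi : {rmorphism {mpoly K[m]} -> k} := mmap iota y.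
have etaE e g : g \is e.-homog -> mmap iota (eta' 0) g = eta' 0 ord0 ^+ e * psi (chart g).
  move=> hg; pose x := (eta' 0 ord0)^-1 *: eta'.
  have -> : eta' = eta' 0 ord0 *: x by rewrite scalerA mulfV // scale1r.
  rewrite (mmap_scale _ _ _ hg) [X in _ = X ^+ _ * _]mxE [x 0 ord0]mxE mulVf // mulr1.
  congr (_ * _); apply: mmap_chart => [|i]; first by rewrite mxE mulVf.
  by rewrite mxE mulrC.
have xi1 : xi' 0 (lift ord0 ord0) != 0.
  apply: contraNneq eta0 => E; have := Eeta' ord0; rewrite E mulr0 => /eqP.
  by rewrite fmorph_eq0.
pose x := (xi' 0 (lift ord0 ord0))^-1 *: xi'.
have xi'E e g : g \is e.-homog -> mmap j (xi' 0) g =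
    xi' 0 (lift ord0 ord0) ^+ e * evp (emb L psi) (x 0 ord0) (cone_chart g).
  move=> hg; have -> : xi' = xi' 0 (lift ord0 ord0) *: x by rewrite scalerA mulfV // scale1r.
  rewrite (mmap_scale _ _ _ hg) [X in _ = X ^+ _ * _]mxE [x 0 _ in RHS]mxE mulVf // mulr1.
  congr (_ * _); apply: evp_cone_chart => [|i]; first by rewrite mxE mulVf.
  have -> : in_alg L (y i) = in_alg L (eta' 0 (lift ord0 i)) / in_alg L (eta' 0 ord0).
    by rewrite /y rmorphM fmorphV.
  by rewrite !Eeta' mxE; field; rewrite c0 xi1.
have psi0 g : psi g = 0 -> g = 0.
  have [M HM] := dehom_lift (chart_dehom K m) g; have [G hG <-] := HM _ (leqnn M) => E.
  by rewrite (eta_eq0 _ _ hG) ?rmorph0 // (etaE _ _ hG) /= E mulr0.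
set al := x 0 ord0 in xi'E *; exists psi, al; split.
- by move=> a b E; apply/eqP; rewrite -subr_eq0; apply/eqP/psi0; rewrite rmorphB E subrr.
- move=> z; have [e [g [h [hg hh h0 ->]]]] := frac_eta z.
  move: h0; rewrite (etaE _ _ hh) mulf_eq0 expf_eq0 (negPf eta0) andbF /= => h0.
  exists (chart g), (chart h); split=> //; rewrite (etaE _ _ hg).
  by rewrite -mulf_div mulfV ?mul1r // expf_neq0.
- have invF : lsub (invmx B) (lsub B F) = F by rewrite lsubA mulVmx // lsub1.
  have xi_ker e g : g \is e.-homog -> (mmap j (xi' 0) g = 0 <-> divides (lsub B F) g).
    move=> hg; apply: (iff_trans (ker_xi _ _ hg)); split=> -[q E].
      exists (lsub B q); by rewrite -rmorphM -E /= lsubA mulmxV // lsub1.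
    by exists (lsub (invmx B) q); rewrite E rmorphM [X in _ * X]invF.
  have f0 : evp (emb L psi) al (cone_chart (lsub B F)) = 0.
    have hF' := lsub_homog B hF; apply: (mulfI (expf_neq0 d xi1)); rewrite mulr0.
    by rewrite -(xi'E _ _ hF'); apply/(xi_ker _ _ hF'); exists 1; rewrite mul1r.
  move=> g; split=> [E|[q ->]].
    have [M HM] := dehom_lift (cone_chart_dehom K m) g; have [G hG EG] := HM _ (leqnn M).
    have {}EG : cone_chart G = g := EG.
    have E0 : mmap j (xi' 0) G = 0 by rewrite (xi'E _ _ hG) EG E mulr0.
    have [q Eq] := (xi_ker _ _ hG).1 E0.
    by exists (cone_chart q); rewrite -EG Eq -rmorphM.
  by rewrite rmorphM [X in _ * X]f0 mulr0.
apply/vspaceP => z; rewrite memvf; apply/idP.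
have [e [g [h [hg hh h0 ->]]]] := frac_xi z.
have memev p : evp (emb L psi) al p \in <<1; al>>%VS.
  by apply: mempx_Fadjoin; apply: map_emb_polyOver.
move: h0; rewrite (xi'E _ _ hh) (xi'E _ _ hg) => h0.
by rewrite -mulf_div mulfV ?mul1r ?rpred_div // expf_neq0.
Qed.
End ProjectionToModel.

Section ModelToProjection.
Variable K : closedFieldType.

Lemma divides_lsub r (C : 'M[K]_r) (G g : {mpoly K[r]}) : C \in unitmx ->
  divides (lsub C G) (lsub C g) <-> divides G g.
Proof.
move=> UC; have inv p : lsub (invmx C) (lsub C p) = p by rewrite lsubA mulVmx // lsub1.
split=> -[q E]; last by exists (lsub C q); rewrite E rmorphM.
by exists (lsub (invmx C) q); rewrite -[g]inv E rmorphM /= inv.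
Qed.

Lemma prime_lsub r (C : 'M[K]_r) (G : {mpoly K[r]}) : C \in unitmx ->
  prime_elt G -> prime_elt (lsub C G).
Proof.
move=> UC [G0 UG PG]; have UC' : invmx C \in unitmx by rewrite unitmx_inv.
have inv p : lsub (invmx C) (lsub C p) = p by rewrite lsubA mulVmx // lsub1.
split.
- by apply: contraNneq G0 => E; rewrite -[G]inv E rmorph0.
- by apply: contra UG => U; rewrite -[G]inv; apply: (rmorph_unit (lsub (invmx C))).
move=> a b [q E]; have [] := PG (lsub (invmx C) a) (lsub (invmx C) b).
- exists (lsub (invmx C) q); transitivity (lsub (invmx C) (a * b)); first exact/esym/rmorphM.
  by rewrite E -[in RHS](inv G); apply: rmorphM.
- by rewrite -{1}[G]inv => /(divides_lsub _ _ UC'); left.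
by rewrite -{1}[G]inv => /(divides_lsub _ _ UC'); right.
Qed.

Lemma not_divides_X r d (G : {mpoly K[r]}) i : G \is d.-homog -> (1 < d)%N -> G != 0 ->
  ~ divides G 'X_i.
Proof.
move=> hG d1 G0 /divides_msize; rewrite (homog_msizeE G0 hG) msizeX mdeg1 -msize_poly_eq0 msizeX.
by move=> /(_ isT); rewrite ltnS leqNgt d1.
Qed.

Lemma mmap_coef m (k : fieldType) (psi : {rmorphism {mpoly K[m]} -> k}) :
  mmap (psi \o @mpolyC m K) (fun i => psi 'X_i) =1 psi.
Proof.
apply: (@eq_mpoly_rmorph K m k (mmap (psi \o @mpolyC m K) (fun i => psi 'X_i))) => /= [c|i].
  by rewrite mmapC.
by rewrite mmapX mmap1U.
Qed.

(** The generic points are read off the model: 1 followed by the [psi 'X_i] below, and [al] put in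
    front of these above, in coordinates moved by [C]. The bound [1 < d] ensures that [G] does not
    divide the variable set to 1, so divisibility can be tested in the chart. *)
Lemma projection_of_model m d (G : {mpoly K[m.+2]}) (C : 'M[K]_m.+2) (k : fieldType)
    (L : fieldExtType k) (psi : {rmorphism {mpoly K[m]} -> k}) (al : L) :
  G \is d.-homog -> (1 < d)%N -> prime_elt G -> C \in unitmx ->
  model (cone_chart (lsub C G)) psi al -> projection_extension G (row ord0 C) L.
Proof.
move=> hG d1 prG UC mod; have [inj frac ker gen] := mod.
have dehom2 := cone_chart_dehom K m; have dehom1 := chart_dehom K m.
pose iota : {rmorphism K -> k} := psi \o @mpolyC m K.
pose eta : 'rV[k]_m.+1 := \row_i oapp (fun j => psi 'X_j) 1 (unlift ord0 i).
pose x : 'rV[L]_m.+2 := \row_i oapp (fun j => in_alg L (eta 0 j)) al (unlift ord0 i).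
pose j : {rmorphism K -> L} := emb L iota.
have eta0 : eta 0 ord0 = 1 by rewrite mxE unlift_none.
have etaS i : eta 0 (lift ord0 i) = psi 'X_i by rewrite mxE liftK.
have x0 : x 0 ord0 = al by rewrite mxE unlift_none.
have xS i : x 0 (lift ord0 i) = in_alg L (eta 0 i) by rewrite mxE liftK.
have etaE g : mmap iota (eta 0) g = psi (chart g).
  by rewrite (mmap_chart _ _ eta0 etaS) mmap_coef.
pose xi := x *m map_mx j C.
have xiE g : mmap j (xi 0) g = evp (emb L psi) al (cone_chart (lsub C g)).
  rewrite -mmap_lsub (@evp_cone_chart _ _ _ _ iota (fun i => psi 'X_i)).
  - rewrite x0 /evp /= /horner_eval; congr _.[_]; apply: eq_map_poly => p.
    by rewrite /emb /=; congr (_ *: _); apply: mmap_coef.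
  - by rewrite xS eta0 rmorph1.
  - by move=> i; rewrite xS etaS.
have drop0 (w : 'rV[K]_m.+2) i : (w *m (drop_first K m.+1)^T) 0 i = w 0 (lift ord0 i).
  rewrite mxE (bigD1 (lift ord0 i)) //= !mxE eqxx mulr1 big1 ?addr0 // => l /negPf n.
  by rewrite !mxE n mulr0.
exists iota, (invmx C *m (drop_first K m.+1)^T), eta, xi, 1; split.
- apply/andP; split; last first.
    apply/sub_kermxP; rewrite rowE mulmxA mulmxK //; apply/rowP => i.
    by rewrite drop0 !mxE andbF.
  apply/row_subP => i; set w := row i _.
  have /sub_kermxP : (w <= kermx (invmx C *m (drop_first K m.+1)^T))%MS by apply: row_sub.
  rewrite mulmxA => E; apply/sub_rVP; exists ((w *m invmx C) 0 ord0).
  rewrite rowE scalemxAl -[LHS](mulmxKV UC); congr (_ *m _); apply/rowP.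
  apply: ord0_ind => [|l]; first by rewrite !mxE !eqxx mulr1.
  by have := drop0 (w *m invmx C) l; rewrite E mxE => <-; rewrite !mxE andbF mulr0.
- split=> [e g hg|z].
    rewrite etaE; split=> [|->]; last by rewrite !rmorph0.
    by rewrite -(rmorph0 psi) => /inj; apply: (dehom_eq0 dehom1 hg).
  have [a [b [b0 ->]]] := frac z.
  have [Ma Ha] := dehom_lift dehom1 a; have [Mb Hb] := dehom_lift dehom1 b.
  have [g hg Eg] := Ha _ (leq_addr Mb Ma); have [h hh Eh] := Hb _ (leq_addl Ma Mb).
  have {}Eg : chart g = a := Eg; have {}Eh : chart h = b := Eh.
  by exists (Ma + Mb)%N, g, h; rewrite !etaE Eg Eh.
- rewrite -[fun a : K => _]/(j : K -> L); split=> [e g hg|z].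
    have G0 : G != 0 by case: prG.
    have hG' := lsub_homog C hG; have prG' := prime_lsub UC prG.
    have G'0 : lsub C G != 0 by case: prG'.
    have nX := not_divides_X (i := lift ord0 ord0) hG' d1 G'0.
    rewrite xiE; split=> [/ker|].
      by move/(dehom_divides dehom2 hG' prG' nX (lsub_homog C hg))/(divides_lsub _ _ UC).
    move=> /(divides_lsub G g UC) [q Eq]; apply/ker; exists (cone_chart q).
    by rewrite Eq rmorphM.
  have [b [g [b0 E]]] := model_elem mod z.
  have [Ma Ha] := dehom_lift dehom2 g; have [Mb Hb] := dehom_lift dehom2 b%:P.
  have [p hp Ep] := Ha _ (leq_addr Mb Ma); have [q hq Eq] := Hb _ (leq_addl Ma Mb).
  have {}Ep : cone_chart p = g := Ep; have {}Eq : cone_chart q = b%:P := Eq.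
  exists (Ma + Mb)%N, (lsub (invmx C) p), (lsub (invmx C) q); rewrite !lsub_homog //.
  rewrite !xiE !lsubA !mulmxV // !lsub1 Ep Eq evpC (emb_eq0 mod) b0; split=> //.
  by rewrite -E [_ * z]mulrC mulfK ?(emb_eq0 mod).
- exact: oner_neq0.
rewrite scale1r -[fun a : K => _]/(j : K -> L) map_mxM mulmxA /xi map_invmx mulmxK ?map_unitmx //.
have dT a b : (map_mx j (drop_first K m.+1)^T) a b = (a == lift ord0 b)%:R.
  by rewrite !mxE rmorph_nat.
apply/rowP => i; rewrite [LHS]mxE -xS [RHS]mxE (bigD1 (lift ord0 i)) //= dT eqxx mulr1.
by rewrite big1 ?addr0 // => l /negPf n; rewrite dT n mulr0.
Qed.
End ModelToProjection.

Section ExistenceOfModel.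

Lemma frac_quotient (S : idomainType) (z : {fraction S}) :
  exists a b, FracField.tofrac b != 0 :> {fraction S} /\
    z = FracField.tofrac a / FracField.tofrac b.
Proof.
elim/quotW: z => r; exists (frac r).1, (frac r).2.
have b0 : FracField.tofrac (frac r).2 != 0 :> {fraction S} by rewrite tofrac_eq0 denom_ratioP.
split=> //; apply: (mulIf b0); rewrite divfK //.
change (FracField.mul (\pi r)%qT (FracField.tofrac (frac r).2) = FracField.tofrac (frac r).1).
unlock FracField.tofrac; rewrite -FracField.pi_mul; apply/eqmodP.
rewrite /= FracField.equivfE /FracField.mulf !numden_Ratio ?oner_neq0 ?mulr1 ?denom_ratioP //.
by rewrite mulrC.
Qed.

(** Clearing denominators in a factorization gives a product [g * h] that is a multiple of the prime
    [f]; so [f] divides [g] or [h], and that factor has full size. *)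
Lemma prime_irreducible_frac (S : idomainType) (k : fieldType) (psi : {rmorphism S -> k}) (f : {poly S}) :
  injective psi -> (forall z, exists a b, psi b != 0 /\ z = psi a / psi b) ->
  prime_elt f -> (1 < size f)%N -> irreducible_poly (map_poly psi f).
Proof.
have ar (x y : nat) : x != 1%N -> (0 < x)%N -> ((y + x).-1 <= y)%N -> False by lia.
move=> inj frac [f0 _ Pf] sf; have szE g : size (map_poly psi g) = size g.
  exact: size_map_inj_poly inj (rmorph0 _) _.
split=> [|q sq /dvdpP [r Er]]; first by rewrite szE.
have [b [g [b0 Eg]]] := clear_denominators r frac.
have [c [h [c0 Eh]]] := clear_denominators q frac.
have pb0 : psi b != 0 by rewrite -(rmorph0 psi) (inj_eq inj).
have pc0 : psi c != 0 by rewrite -(rmorph0 psi) (inj_eq inj).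
have E : (b * c) *: f = g * h.
  apply: (map_inj_poly inj (rmorph0 _)); rewrite rmorphM /= -Eg -Eh.
  by rewrite -scalerAl -scalerAr scalerA -Er map_polyZ /= rmorphM.
have bcf0 : (b * c) *: f != 0 by rewrite -mul_polyC mulf_neq0 // polyC_eq0 mulf_neq0.
have := bcf0; rewrite E mulf_eq0 negb_or => /andP[g0 h0].
have size_dvd p : p != 0 -> divides f p -> (size f <= size p)%N.
  move=> p0 [s Es]; have s0 : s != 0 by apply: contraNneq p0 => s0; rewrite Es s0 mul0r.
  by rewrite Es size_mul // -(subnK (_ : 0 < size s)%N) ?size_poly_gt0 // addn1 addSn leq_addl.
have sr : size r = size g by rewrite -(size_scale r pb0) Eg szE.
have sq' : size q = size h by rewrite -(size_scale q pc0) Eh szE.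
have dvdq : q %| map_poly psi f by apply/dvdpP; exists r.
have mf0 : map_poly psi f != 0 by rewrite -size_poly_eq0 szE size_poly_eq0.
have [] := Pf g h; first by exists (b * c)%:P; rewrite mul_polyC.
  move/(size_dvd _ g0); rewrite -sr -szE Er size_mul; last 2 first.
  - by apply: contraNneq mf0 => r0; rewrite Er r0 mul0r.
  - by apply: contraNneq mf0 => q0; rewrite Er q0 mulr0.
  have : (0 < size q)%N.
    by rewrite size_poly_gt0; apply: contraNneq mf0 => q0; rewrite Er q0 mulr0.
  by move=> q0 le; case: (ar _ _ sq q0 le).
move/(size_dvd _ h0); rewrite -sq' => le; rewrite -(dvdp_size_eqp dvdq) szE eqn_leq le andbT.
by rewrite -szE; apply: dvdp_leq.
Qed.

(** A root of [f] is adjoined to the fraction field. If [g] vanishes at it, clearing denominators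
    shows that [f] divides [b%:P * g]; being nonconstant, the prime [f] does not divide [b%:P]. *)
Lemma exists_model (S : idomainType) (f : {poly S}) : prime_elt f -> (1 < size f)%N ->
  exists (k : fieldType) (L : fieldExtType k) psi al, @model S f k L psi al.
Proof.
move=> prf sf; pose psi : {rmorphism S -> {fraction S}} := @FracField.tofrac S.
have inj : injective psi by move=> x y /eqP; rewrite tofrac_eq => /eqP.
have frac := @frac_quotient S.
have irr := prime_irreducible_frac (inj : injective psi) frac prf sf.
have [L _ [al rt gen]] := irredp_FAdjoin irr.
exists {fraction S}, L, psi, al; split=> // g; have [f0 _ Pf] := prf.
have mapE h : map_poly (in_alg L) (map_poly psi h) = map_poly (emb L psi) h.
  by rewrite -map_poly_comp.
split=> [E|[q ->]]; last first.
  by rewrite rmorphM /= {2}/evp /= /horner_eval -mapE (rootP rt) mulr0.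
have dvd : map_poly psi f %| map_poly psi g.
  have /polyOver1P [q Eq] := minPolyOver 1 al.
  have dvd_q h : root (map_poly (in_alg L) (map_poly psi h)) al -> q %| map_poly psi h.
    move=> rh; rewrite -(dvdp_map (in_alg L)) -Eq; apply: minPoly_dvdp => //.
    by apply/polyOver1P; exists (map_poly psi h).
  have /eqp_dvdl <- : q %= map_poly psi f.
    apply: irr.2 (dvd_q _ rt); rewrite -(size_map_poly (in_alg L)) -Eq size_minPoly.
    by rewrite eqSS.
  by apply: dvd_q; apply/rootP; rewrite mapE.
have /dvdpP [r Er] := dvd; have [b [h [b0 Eh]]] := clear_denominators r frac.
have [] := Pf b%:P g.
- exists h; apply: (map_inj_poly inj (rmorph0 _)).
  by rewrite !rmorphM /= -Eh map_polyC /= mul_polyC Er scalerAl.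
- move=> [s Es]; have s0 : s != 0 by apply: contraNneq b0 => s0; move: Es; rewrite s0 mul0r => /eqP; rewrite polyC_eq0.
  have := size_polyC b; rewrite Es size_mul // b0; move: s0; rewrite -size_poly_gt0.
  by move: sf; move: (size f) (size s) => x y; lia.
by [].
Qed.
End ExistenceOfModel.

(** * Galois points of hyperplane sections *)

Lemma galois_deriv_neq0 (S : idomainType) (f : {poly S}) (k : fieldType)
    (L : splittingFieldType k) (psi : {rmorphism S -> k}) (al : L) :
  model f psi al -> galois 1 {:L} -> f^`() != 0.
Proof.
move=> mod galL; have sep : separable_element 1 al.
  by have /and3P[_ /separableP H _] := galL; apply: H; apply: memvf.
move: sep; rewrite separable_nz_der; apply: contraNneq => f'0.
have l0 : emb L psi (lead_coef f) != 0 by rewrite (emb_eq0 mod) lead_coef_eq0 (model_neq0 mod).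
have := congr1 (fun p => p^`()) (model_minPoly mod); rewrite /= deriv_map f'0 rmorph0 derivZ.
by move/esym/eqP; rewrite scaler_eq0 (negPf l0).
Qed.

(** Specialization along the identity reduction, for which every element has a residue: it carries
    the group from one choice of the function field to another. *)
Lemma model_isog (S : idomainType) (f : {poly S}) (k k' : fieldType)
    (L : splittingFieldType k) (L' : splittingFieldType k')
    (psi : {rmorphism S -> k}) (psi' : {rmorphism S -> k'}) (al : L) (al' : L') :
  model f psi al -> model f psi' al' -> galois 1 {:L} ->
  ('Gal({:L} / 1) \isog 'Gal({:L'} / 1))%g.
Proof.
move=> mod mod' galL; have idE g : map_poly (@idfun S) g = g by rewrite map_poly_id.
have mod1 : model (map_poly (@idfun S) f) psi' al' by rewrite idE.
have pl z : exists z', place (@idfun S) psi psi' al al' z z'.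
  have [b [g [b0 E]]] := model_elem mod z.
  have b1 : emb L' psi' b != 0 by rewrite (emb_eq0 mod').
  exists (evp (emb L' psi') al' g / emb L' psi' b), g, b%:P.
  by rewrite /= !idE !evpC b1 divfK // mulrC.
have [c Hc] := choose_residues (fun s (sG : s \in 'Gal({:L} / 1)%g) => pl (s al)).
apply: (specialization_isog mod galL mod1 _ _ Hc); rewrite idE //.
exact: galois_deriv_neq0 mod galL.
Qed.

Section Specialize.
Variables (K : closedFieldType) (m d : nat) (F : {mpoly K[m.+3]}) (P : 'rV[K]_m.+3).
Hypotheses (d_ge4 : (4 <= d)%N) (hypX : hypersurface d F) (galP : galois_point F P).

Let hF : F \is d.-homog. Proof. by case: hypX. Qed.
Let d1 : (1 < d)%N. Proof. exact: ltnW (ltnW d_ge4). Qed.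
Let degree_gt3 x : (d <= x)%N -> x.-1 = 2%N -> False. Proof. by move: d_ge4; lia. Qed.

Lemma galois_point_not_Sing : ~ Sing F P.
Proof. by case: galP => _ [[_ H]|H] _ // [Hz _]; apply: H. Qed.

Lemma galois_point_polar : polar F P != 0.
Proof.
have [P0 _ [k [L [pe galL]]]] := galP.
have [B UB rB] := complete_row ord0 P0.
have [psi [al mod]] : exists psi al, @model _ (cone_chart (lsub B F)) k L psi al.
  by apply: (model_of_projection hF UB); rewrite rB.
have := galois_deriv_neq0 mod galL.
by rewrite (@cone_chart_deriv_eq0 _ _ d.-1) ?rB // prednK // ltnW.
Qed.

Section Chart.
Variables (h : 'rV[K]_m.+3) (A : 'M[K]_(m.+2, m.+3)) (Q : 'rV[K]_m.+2) (t : int).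
Hypotheses (chA : hyperplane_chart h P A Q) (starG : star d t (section_eq F A) Q).
Local Notation G := (section_eq F A).

(** [C] starts with [Q], and [B] is made of the rows of [C *m A], which span the hyperplane, with
    one further row at the end. Since [Q *m A = P], it starts with [P], and the hyperplane becomes
    the vanishing of the last coordinate. *)
Lemma adapted_frames : exists B C, [/\ B \in unitmx, C \in unitmx, row ord0 B = P, row ord0 C = Q
  & map_poly (@kill_last K m) (cone_chart (lsub B F)) = cone_chart (lsub C G)].
Proof.
have [P0 _ _] := galP; have [rA _ EQ] := chA.
have Q0 : Q != 0 by apply: contraNneq P0 => E; rewrite -EQ E mul0mx.
have [C UC rC] := complete_row ord0 Q0.
have [||B UB rB] := @complete_row_free K m.+2 m.+3 (C *m A) (widen_ord (leqnSn _)).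
- by move=> i j /(congr1 val) E; apply: val_inj.
- by rewrite /row_free mxrankMfree ?rA // -/(row_free C) row_free_unit.
exists B, C; split=> //.
  have -> : ord0 = widen_ord (leqnSn m.+2) ord0 by apply: val_inj.
  by rewrite rB row_mul rC.
rewrite cone_chart_drop_last lsubA; congr (cone_chart _).
rewrite -[section_eq F A]/(lsub A F) lsubA; congr (lsub _ F).
by apply/row_matrixP => i; rewrite mul_drop_last rB.
Qed.
Local Notation red := (@kill_last K m).

Let hG : G \is d.-homog. Proof. by case: starG => -[]. Qed.
Let prG : prime_elt G. Proof. by case: starG => -[_ /irreducible_mpoly_prime]. Qed.

Lemma star_polar : polar G Q != 0.
Proof.
case: starG => _ _ [Z [_ [x [Gx Zx]] H]]; apply/eqP => E; apply: (H x Gx Zx).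
by rewrite /in_tangent_space -meval_polar E meval0.
Qed.

Variables (B : 'M[K]_m.+3) (C : 'M[K]_m.+2).
Hypotheses (UB : B \in unitmx) (UC : C \in unitmx) (EB : row ord0 B = P) (EC : row ord0 C = Q).
Local Notation f := (cone_chart (lsub B F)).
Local Notation f' := (cone_chart (lsub C G)).
Hypothesis red_f : map_poly red f = f'.

Lemma section_deriv_neq0 : f'^`() != 0.
Proof.
rewrite (@cone_chart_deriv_eq0 _ _ d.-1) ?EC ?star_polar // prednK //; exact: ltnW.
Qed.

Lemma section_prime : prime_elt f'.
Proof.
have prG' := prime_lsub UC prG; have hG' := lsub_homog C hG.
have G'0 : lsub C G != 0 by case: prG'.
exact: (dehom_prime (cone_chart_dehom K m) hG' prG' (not_divides_X hG' d1 G'0)).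
Qed.

Lemma size_section_chart : (1 < size f')%N.
Proof.
rewrite ltnNge; apply/negP => le; case/eqP: section_deriv_neq0.
by rewrite (size1_polyC le) derivC.
Qed.

Lemma vertex_smooth : ~ Sing (lsub B F) (delta_mx 0 ord0).
Proof. by move/(Sing_vertex F UB); rewrite EB; apply: galois_point_not_Sing. Qed.

Lemma size_chart : (d <= size f)%N.
Proof.
rewrite leqNgt; apply/negP => H; apply: vertex_smooth.
by apply/(Sing_cone_chart (lsub_homog B hF)).
Qed.

(** In the tangent case [ramified_degree] would give [f] degree 2, whereas by [size_chart] its
    degree is at least [d - 1], that is at least 3. *)
Lemma lead_restriction : red (lead_coef f) != 0.
Proof.
have [//|[a [la ra]]] := lead_cone_chart (lsub_homog B hF) d1 vertex_smooth.
have [_ _ [k [L [pe galL]]]] := galP.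
have [psi [al mod]] : exists psi al, @model _ f k L psi al.
  by apply: (model_of_projection hF UB); rewrite EB.
have [k' [L' [psi' [al' mod']]]] := exists_model section_prime size_section_chart.
rewrite -red_f in mod'; have sep := section_deriv_neq0; rewrite -red_f in sep.
move: (ramified_degree mod mod' galL (kill_last_prime K m) la ra sep).
have := size_chart; move: (size f) => x le E; case: (degree_gt3 le E).
Qed.

Lemma size_section : size (map_poly red f) = size f.
Proof. exact: (size_map_poly_id0 lead_restriction). Qed.

Lemma section_galois_point : galois_point G Q.
Proof.
have [P0 _ [k [L [pe galL]]]] := galP; have [_ _ EQ] := chA.
have [psi [al mod]] : exists psi al, @model _ f k L psi al.
  by apply: (model_of_projection hF UB); rewrite EB.
have [k' [L' [psi' [al' mod']]]] := exists_model section_prime size_section_chart.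
have mod1 := mod'; rewrite -red_f in mod1.
have [c Hc] := residues_unit_lead mod mod1 (kill_last_prime K m) lead_restriction.
have splitL' := specialization_splitting_axiom mod galL mod1 Hc.
pose L1 : splittingFieldType k' := HB.pack L' (FieldExt_isSplittingField.Build k' L' splitL').
have mod1' : @model _ f' k' L1 psi' al' := mod'.
split.
- by apply: contraNneq P0 => E; rewrite -EQ E mul0mx.
(* A singular [Q] would force the chart polynomial of the section below size [d], but reduction
   keeps the size of [f]. *)
- apply: NNPP => /not_or_and [nsm /NNPP z]; apply: nsm; split=> // sing.
  have := size_chart; rewrite -size_section red_f leqNgt => /negP; apply.
  by apply/(Sing_cone_chart (lsub_homog C hG) d1)/(Sing_vertex G UC); rewrite EC.
exists k', L1; split.
  by rewrite -EC; apply: (projection_of_model hG d1 prG UC mod1').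
exact: (model_galois mod1' section_deriv_neq0).
Qed.

(** Only the field [L0] provided by [galP] is known to be Galois, so the comparison passes through
    it: from [L] to [L0] by [model_isog], then from [L0] to [L'] by specialization. *)
Lemma section_galois_group (k k' : fieldType) (L : splittingFieldType k) (L' : splittingFieldType k') :
  projection_extension F P L -> projection_extension G Q L' ->
  ('Gal({:L} / 1) \isog 'Gal({:L'} / 1))%g.
Proof.
move=> peL peL'; have [_ _ [k0 [L0 [pe galL0]]]] := galP.
rewrite -EB in peL pe; rewrite -EC in peL'.
have [psi0 [al0 mod0]] := model_of_projection hF UB pe.
have [psi [al mod]] := model_of_projection hF UB peL.
have [psi' [al' mod']] := model_of_projection hG UC peL'; rewrite -red_f in mod'.
have [c Hc] := residues_unit_lead mod0 mod' (kill_last_prime K m) lead_restriction.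
have sep := section_deriv_neq0; rewrite -red_f in sep.
apply: (isog_trans _ (specialization_isog mod0 galL0 mod' sep size_section Hc)).
by rewrite isog_sym; apply: (model_isog mod0 mod galL0).
Qed.
End Chart.
End Specialize.

Theorem theorem4 (K : closedFieldType) (n d : nat) (F : {mpoly K[n.+2]})
    (P : 'rV[K]_n.+2) (s t : int)
    (n_ge2 : (2 <= n)%N) (d_ge4 : (4 <= d)%N)
    (hypX : hypersurface d F) (dimSing : has_dim (Sing F) s)
    (s_t : (0 <= s <= n%:Z - 2 /\ t = s - 1) \/ (s = -1 /\ t = -1))
    (galP : galois_point F P) :
  [/\ (* (i) *)
      generally (hyperplanes_through P) (fun h =>
        forall A Q, hyperplane_chart h P A Q -> star d t (section_eq F A) Q),
      (* (ii) *)
      forall h A Q, hyperplanes_through P h -> hyperplane_chart h P A Q ->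
        star d t (section_eq F A) Q -> galois_point (section_eq F A) Q
    & (* (iii) *)
      forall h A Q, hyperplanes_through P h -> hyperplane_chart h P A Q ->
        star d t (section_eq F A) Q ->
        forall (k k' : fieldType) (L : splittingFieldType k)
               (L' : splittingFieldType k'),
          projection_extension F P L ->
          projection_extension (section_eq F A) Q L' ->
          ('Gal({:L} / 1) \isog 'Gal({:L'} / 1))%g].
Proof.
case: n => [|m] // in F P s_t n_ge2 hypX dimSing galP *; split.
- have [P0 _ _] := galP.
  exact: (general_section n_ge2 d_ge4 hypX P0 (galois_point_not_Sing galP)
    (galois_point_polar d_ge4 hypX galP) dimSing s_t).
- move=> h A Q _ chA starG; have [B [C [UB UC EB EC red_f]]] := adapted_frames galP chA.
  exact: (section_galois_point d_ge4 hypX galP chA starG UB UC EB EC red_f).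
move=> h A Q _ chA starG k k' L L'.
have [B [C [UB UC EB EC red_f]]] := adapted_frames galP chA.
exact: (section_galois_group d_ge4 hypX galP starG UB UC EB EC red_f).
Qed.
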